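(* Let $d\ge 2$ be an integer and let $b(n)=\sum_{i=1}^{\ell}B_i(n)\beta_i^n$ be an exponential polynomial over $K$, i.e. $B_i\in K[T]$ and $\beta_i\in K^*$. Let $\Gamma$ be the multiplicative subgroup of $K^*$ generated by $\beta_1,\dots,\beta_\ell$, and assume that $\Gamma\cap\mathbf{k}^*=\{1\}$. If $b(n)$ is a $d$-th power in $K$ for infinitely many $n\in\mathbb{N}$, then there exist an exponential polynomial $a(m)=\sum_{i=1}^{r}A_i(m)\alpha_i^m$ with $A_i\in\overline{K}[T]$, $\alpha_i\in\overline{K}^*$, and a polynomial $R\in\mathbf{k}[T]$ such that $b(m)=R(m)\,a(m)^d$ for all $m\in\mathbb{N}$.
   Context: $\mathbf{k}$ is an algebraically closed field of characteristic zero, $C$ is a smooth projective curve over $\mathbf{k}$ of genus $\mathfrak g$, and $K=\mathbf{k}(C)$ is its function field; $\overline K$ denotes an algebraic closure of $K$. An exponential polynomial over a field $k$ is a sequence $\mathbb{N}\to k$ of the form $n\mapsto\sum_{i\in I}B_i(n)\beta_i^n$ with $I$ finite, $\beta_i\in k^*$ and $B_i\in k[T]$. *)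

(* Defs.v *)
From HB Require Import structures.
From mathcomp Require Import all_boot all_order all_algebra.
Set Implicit Arguments. Unset Strict Implicit. Unset Printing Implicit Defensive.
Import Order.TTheory GRing.Theory Num.Theory.
Local Open Scope ring_scope.

Definition expoly (F : fieldType) (r : nat) (A : 'I_r -> {poly F})
  (alpha : 'I_r -> F) (n : nat) : F :=
  \sum_(i < r) (A i).[n%:R] * alpha i ^+ n.

Definition in_rat_fun (k : fieldType) (K : fieldType) (iota : {rmorphism k -> K})
  (t c : K) : Prop :=
  exists p q : {poly k}, q != 0 /\
    c = (map_poly iota p).[t] / (map_poly iota q).[t].

(* K is the function field of a (smooth projective) curve over k: K is a
   finite extension of a purely transcendental extension k(t) of k. *)
Definition function_field_of_curve (k : fieldType) (K : fieldType)
  (iota : {rmorphism k -> K}) : Prop :=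
  exists t : K,
    (forall p : {poly k}, p != 0 -> (map_poly iota p).[t] != 0) /\
    exists (n : nat) (e : 'I_n -> K),
      forall y : K, exists c : 'I_n -> K,
        (forall i, in_rat_fun iota t (c i)) /\ y = \sum_(i < n) c i * e i.

Definition algebraic_over (K : fieldType) (L : fieldType) (j : {rmorphism K -> L}) : Prop :=
  forall x : L, exists p : {poly K}, p != 0 /\ root (map_poly j p) x.

(* Main.v *)
Require Import Defs.
From HB Require Import structures.
From mathcomp Require Import all_boot all_order all_algebra separable.
From mathcomp Require Import mpoly ring lra zify.
From mathcomp Require boolp classical_sets.
Set Implicit Arguments. Unset Strict Implicit. Unset Printing Implicit Defensive.
Import Order.TTheory GRing.Theory Num.Theory.
Local Open Scope ring_scope.

(** Let u_1, ..., u_r be a basis of the free group Gamma. Up to a factor g^(dn), b(n) is the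
    value at (n, u^n) of a polynomial F(T, X) over K, and K[T, X] is factorial. Let P be a prime
    factor of F with at least two monomials, and Q the product of the factors of F not associated
    to P and of the image of P under the derivation extending that of K by T -> 0 and
    X_i -> T (u_i'/u_i) X_i; then P does not divide Q. Wronskian estimates (the subspace theorem
    over function fields) show that P(n, u^n) has at least a constant times n zeros outside a
    fixed set of places and, in the manner of Corvaja and Zannier, that only a small proportion of
    them are zeros of Q(n, u^n). So P(n, u^n) has a simple zero at which all other factors are
    units, and d divides the exponent of P in F when F(n, u^n) is a d-th power.

    Hence F = c(T) X^I G^d. An irreducible factor q of c that does not come from k[T] is treated
    in the same way, using a Bezout relation between q, its derivative and the other factors. What
    remains of c is a polynomial over k. *)

(** * Unique factorization in polynomial rings *)

(** A Wronskian detects linear independence over [k] only, whereas the coefficients of b(n) lie in K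
    and vary with n. They stay, however, in a fixed k-space of finite dimension, and all estimates
    are uniform over coefficients from such a space. The hypothesis on Gamma then enters in one
    form: distinct monomials u^m are not proportional over [k].

    In the gcd estimate, elements of the ideal (P, Q) of bounded degree are independent over K.
    Multiplying them by a k-basis t^a z^i of a large piece of K turns this into independence over
    [k] of a family that fills almost all of the ambient space, since P and Q are coprime.

    The lifted derivation is there because its value at (n, u^n) is the derivative of P(n, u^n), so
    that multiple zeros of P(n, u^n) are zeros of Q(n, u^n). The admissible proportion of bad zeros
    is fixed before the set of places is enlarged, which dictates the order of the quantifiers.

    A place is a valuation on [L] composed with an embedding of K over k(t). The product formula
    comes from the norm to k(t), and the behaviour of the derivation at a place from local
    parameters. *)

Section Factorial.
Variable A : idomainType.
Definition divides (p a : A) := exists c, a = c * p.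
Definition prime_el (p : A) :=
  [/\ p != 0, p \isn't a GRing.unit &
      forall a b, divides p (a * b) -> divides p a \/ divides p b].
Definition factorial :=
  forall x : A, x != 0 -> exists u : A, exists ps : seq A,
    [/\ u \is a GRing.unit, forall p, p \in ps -> prime_el p & x = u * \prod_(p <- ps) p].

Lemma divides_refl p : divides p p. Proof. by exists 1; rewrite mul1r. Qed.
Lemma divides_mull p a b : divides p b -> divides p (a * b).
Proof. by case=> c ->; exists (a * c); rewrite mulrA. Qed.
Lemma divides_mulr p a b : divides p a -> divides p (a * b).
Proof. by rewrite mulrC; apply: divides_mull. Qed.
Lemma divides0 p : divides p 0. Proof. by exists 0; rewrite mul0r. Qed.
Lemma dividesD p a b : divides p a -> divides p b -> divides p (a + b).
Proof. by case=> c -> [e ->]; exists (c + e); rewrite mulrDl. Qed.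
Lemma dividesB p a b : divides p a -> divides p b -> divides p (a - b).
Proof. by case=> c -> [e ->]; exists (c - e); rewrite mulrBl. Qed.

Lemma prime_el_prod_in p (r : seq A) : prime_el p ->
  divides p (\prod_(q <- r) q) -> exists2 q, q \in r & divides p q.
Proof.
move=> pp; have [_ pu pm] := pp; elim: r => [|i r IH].
  rewrite big_nil => -[c Ec]; case/negP: pu; apply/unitrPr.
  by exists c; rewrite mulrC -Ec.
rewrite big_cons => /pm [h|/IH [j jr hj]].
  by exists i; rewrite ?mem_head.
by exists j; rewrite // inE jr orbT.
Qed.

Lemma prime_el_assoc p q : prime_el p -> prime_el q -> divides p q ->
  exists2 u, u \is a GRing.unit & q = u * p.
Proof.
case=> p0 pu _ [q0 qu qm] [c Ec].
have : divides q (c * p) by rewrite -Ec; apply: divides_refl.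
case/qm => -[e Ee]; last first.
  exists c => //; apply/unitrPr; exists e.
  apply: (mulIf q0).
  by rewrite mul1r -mulrA -Ee -Ec.
case/negP: pu; apply/unitrPr; exists e; apply: (mulIf q0).
by rewrite mul1r -mulrA -Ee mulrC -Ec.
Qed.

End Factorial.

Lemma factorial_field (F : fieldType) : factorial F.
Proof.
move=> x x0; exists x, [::]; split => //; first by rewrite unitfE.
by rewrite big_nil mulr1.
Qed.

(** Only [f] is given as a morphism; the multiplicativity of [g], needed to transport units and
    primes, follows from cancellation. *)
Lemma factorial_iso (A B : idomainType) (f : {rmorphism B -> A}) (g : A -> B) :
  cancel f g -> cancel g f -> factorial A -> factorial B.
Proof.
move=> fK gK fA x x0.
have fi := can_inj fK.
have fx0 : f x != 0 by rewrite -(rmorph0 f) (inj_eq fi).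
have g1 : g 1 = 1 by rewrite -(rmorph1 f) fK.
have gM a b : g (a * b) = g a * g b by apply: fi; rewrite rmorphM !gK.
have gU a : a \is a GRing.unit -> g a \is a GRing.unit.
  by move=> /unitrPr [b ab]; apply/unitrPr; exists (g b); rewrite -gM ab.
have [u [ps [uu pps Ex]]] := fA _ fx0.
exists (g u), (map g ps); split; first exact: gU.
  move=> _ /mapP [p /pps [p0 pu pm] ->]; split.
  - by rewrite -(inj_eq fi) gK rmorph0.
  - by apply: contra pu => /(rmorph_unit f); rewrite gK.
  move=> a b [c Ec].
  have : divides p (f a * f b) by exists (f c); rewrite -rmorphM Ec rmorphM gK.
  by case/pm => -[e Ee]; [left|right]; exists (g e); rewrite -gM -Ee fK.
rewrite big_map -[LHS]fK Ex gM; congr (_ * _).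
by elim: {pps Ex} ps => [|p ps IH]; rewrite ?big_nil ?big_cons // gM IH.
Qed.

(** * Gauss's lemma: polynomials over a factorial ring *)

Section FactorialPoly.
Variable A : idomainType.
Implicit Types f g h : {poly A}.
Import Pdiv.Idomain Pdiv.CommonIdomain.

Lemma divides_polyC (p : A) f : divides p%:P f <-> forall i, divides p f`_i.
Proof.
split=> [[h ->] i|H]; first by rewrite coefMC; exists h`_i.
elim/poly_ind: f H => [|f c IH] H; first exact: divides0.
apply: dividesD.
  apply: divides_mulr; apply: IH => i.
  by have := H i.+1; rewrite coefD coefMX coefC /= addr0.
have := H 0%N; rewrite coefD coefMX coefC /= add0r => -[e ->].
by exists e%:P; rewrite polyCM.
Qed.

(** The product of the leading coefficients is divisible by p, hence one of them is. Removing that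
    leading term keeps p dividing f g and lowers the total size. *)
Lemma prime_el_polyC (p : A) : prime_el p -> prime_el p%:P.
Proof.
move=> [p0 pu pm]; split.
- by rewrite polyC_eq0.
- by rewrite poly_unitE coefC /= negb_and pu orbT.
move=> f g.
have [n] := ubnP (size f + size g)%N; elim: n f g => // n IH f g.
have [->|f0] := eqVneq f 0; first by left; apply: divides0.
have [->|g0] := eqVneq g 0; first by right; apply: divides0.
have trunc h : h != 0 -> (size (h - lead_coef h *: 'X^((size h).-1))%R < size h)%N.
  move=> h0; have sh : (0 < size h)%N by rewrite size_poly_gt0.
  rewrite -[X in (_ < X)%N](prednK sh) ltnS; apply/leq_sizeP => j.
  rewrite leq_eqVlt => /orP [/eqP <-|jl].
    by rewrite coefB coefZ coefXn eqxx mulr1 lead_coefE subrr.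
  rewrite coefB coefZ coefXn gtn_eqF // mulr0 subr0 nth_default //.
  by rewrite -(prednK sh).
have lead h : divides p (lead_coef h) -> divides p%:P (lead_coef h *: 'X^((size h).-1)).
  by case=> c ->; exists (c *: 'X^((size h).-1)); rewrite [RHS]mulrC mul_polyC scalerA [p * c]mulrC.
move=> sfg dfg.
have : divides p (lead_coef f * lead_coef g).
  by rewrite -lead_coefM lead_coefE; move/divides_polyC: dfg; apply.
case/pm => dl.
  case: (IH (f - lead_coef f *: 'X^((size f).-1)) g) => [||h|h]; last by right.
  - by rewrite -ltnS; apply: leq_trans sfg; rewrite ltnS ltn_add2r trunc.
  - by rewrite mulrBl; apply: dividesB => //; apply: divides_mulr; apply: lead.
  left; rewrite -[f](subrK (lead_coef f *: 'X^((size f).-1))).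
  by apply: dividesD => //; apply: lead.
case: (IH f (g - lead_coef g *: 'X^((size g).-1))) => [||h|h]; last first.
- right; rewrite -[g](subrK (lead_coef g *: 'X^((size g).-1))).
  by apply: dividesD => //; apply: lead.
- by left.
- by rewrite mulrBr; apply: dividesB => //; apply: divides_mull; apply: lead.
by rewrite -ltnS; apply: leq_trans sfg; rewrite ltnS ltn_add2l trunc.
Qed.

Definition primitive_poly f := forall p, prime_el p -> ~ divides p%:P f.

(** Gauss's lemma in the form used below: the prime factors of c are cancelled one by one, each
    being prime in A[X] and not dividing f, so that it divides the cofactor of f. *)
Lemma primitive_cancel f h (c : A) : factorial A -> primitive_poly f -> c != 0 ->
  divides f (c%:P * h) -> divides f h.
Proof.
move=> fA pf c0; have [u [ps [uu pps ->]]] := fA _ c0.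
rewrite polyCM -mulrA => -[q Eq].
have : divides f ((\prod_(p <- ps) p)%:P * h).
  by exists ((u^-1)%:P * q); rewrite -mulrA -Eq [RHS]mulrA -polyCM mulVr // mul1r.
move=> {q Eq}; elim: ps pps h => [|p ps IH] pps h; first by rewrite big_nil mul1r.
rewrite big_cons polyCM -mulrA => -[e Ee].
have pp : prime_el p by apply: pps; rewrite mem_head.
have [_ _ ppm] := prime_el_polyC pp.
have : divides p%:P (e * f) by rewrite -Ee; apply: divides_mulr; apply: divides_refl.
case/ppm => [[e' Ee']|/(pf _ pp) //].
apply: IH => [q qin|]; first by apply: pps; rewrite inE qin orbT.
exists e'; have p0 : p%:P != 0 by rewrite polyC_eq0; case: pp.
by apply: (mulfI p0); rewrite Ee Ee' mulrA [p%:P * _]mulrC.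
Qed.

(** Each prime extracted from f removes one prime factor of the leading coefficient; their number
    bounds the recursion. *)
Lemma primitive_part f : factorial A -> f != 0 ->
  exists c, exists2 g, primitive_poly g & f = c%:P * g.
Proof.
move=> fA f0.
have [u [ps [uu pps Ef]]] : exists u : A, exists ps : seq A,
    [/\ u \is a GRing.unit, forall p, p \in ps -> prime_el p &
     lead_coef f = u * \prod_(p <- ps) p] by apply: fA; rewrite lead_coef_eq0.
have [n sn] := ubnP (size ps); elim: n => // n IH in f f0 u ps uu pps Ef sn *.
case: (boolp.EM (primitive_poly f)) => [pf|].
  by exists 1, f; rewrite // mul1r.
move=> /boolp.existsNP [p /boolp.not_implyP [pp ndiv]]; have [g Eg] := boolp.contrapT ndiv.
have pc0 : p != 0 by case: pp.
have g0 : g != 0 by apply: contraNneq f0 => g0; rewrite Eg g0 mul0r.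
have El : lead_coef f = lead_coef g * p by rewrite Eg lead_coefM lead_coefC.
have : divides p (\prod_(p <- ps) p).
  by exists (u^-1 * lead_coef g); rewrite -mulrA -El Ef mulrA mulVr // mul1r.
case/(prime_el_prod_in pp) => q qps /(prime_el_assoc pp (pps _ qps)) [w wu Eq].
have [||||c [h ph Eh]] := IH g g0 (u * w) (rem q ps).
- by rewrite unitrM uu.
- by move=> x /mem_rem; apply: pps.
- apply: (mulIf pc0); rewrite -El Ef (perm_big _ (perm_to_rem qps)) big_cons /= Eq.
  by rewrite -!mulrA; congr (_ * (_ * _)); rewrite mulrC.
- by rewrite size_rem //; case: (ps) qps sn.
by exists (p * c), h => //; rewrite Eg Eh polyCM mulrC mulrA.
Qed.

Lemma irreducible_divisor f : (1 < size f)%N -> exists2 g, irreducible_poly g & g %| f.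
Proof.
have [n sn] := ubnP (size f); elim: n => // n IH in f sn * => sf.
case: (boolp.EM (irreducible_poly f)) => [|nf]; first by exists f; rewrite ?dvdpp.
have f0 : f != 0 by rewrite -size_poly_gt0; apply: ltn_trans sf.
have : exists g, [/\ size g != 1%N, g %| f & ~~ (g %= f)].
  apply/boolp.not_existsP => H; apply: nf; split => // q sq qf.
  by apply/negPn/negP => nq; apply: (H q).
case=> g [sg gf ngf].
have g0 : g != 0 by apply: contraNneq f0 => g0; move: gf; rewrite g0 dvd0p.
have sgf : (size g < size f)%N.
  by rewrite ltn_neqAle dvdp_leq // andbT (dvdp_size_eqp gf).
have sg1 : (1 < size g)%N.
  by rewrite ltn_neqAle eq_sym sg size_poly_gt0.
have [|h ih hg] := IH g _ sg1; first by apply: leq_trans sgf _; rewrite -ltnS.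
by exists h => //; apply: dvdp_trans gf.
Qed.

(** The relation [%|] allows a scalar factor, so it behaves as divisibility over the fraction field,
    where irreducible means prime. Primitivity then turns [%|] into divisibility in A[X]. *)
Lemma prime_el_primitive g : factorial A -> irreducible_poly g -> primitive_poly g ->
  prime_el g.
Proof.
move=> fA ig pg; have [sg _] := ig.
have ex h : g %| h -> divides g h.
  case/dvdpP => -[c q] /= c0; rewrite -mul_polyC => E.
  by apply: (primitive_cancel fA pg c0); exists q.
split.
- by rewrite -size_poly_gt0; apply: ltn_trans sg.
- by rewrite poly_unitE gtn_eqF.
move=> a b [c Ec].
have gab : g %| a * b by rewrite Ec dvdp_mulIr.
case: (boolP (g %| a)) => [/ex|nga]; first by left.
right; apply: ex; move: gab; rewrite Gauss_dvdpr //.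
case: (eqVneq (size (gcdp g a)) 1%N) => [/eqP //|sg1].
have [_ /(_ _ sg1 (dvdp_gcdl g a))] := ig => /eqp_dvdl E.
by move: nga; rewrite -E dvdp_gcdr.
Qed.

Lemma factorial_poly : factorial A -> factorial {poly A}.
Proof.
move=> fA f; have [n sn] := ubnP (size f); elim: n => // n IH in f sn * => f0.
have [sf|sf] := leqP (size f) 1.
  have Ef := size1_polyC sf; have c0 : f`_0 != 0 by by apply: contraNneq f0 => c0; rewrite Ef c0.
  have [u [ps [uu pps Ec]]] := fA _ c0.
  exists u%:P, (map polyC ps); split.
  - rewrite poly_unitE size_polyC coefC /= uu andbT; have : u != 0 by apply: contraTneq uu => ->; rewrite unitr0.
    by move=> ->.
  - by move=> _ /mapP [p /pps pp ->]; apply: prime_el_polyC.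
  by rewrite {1}Ef Ec polyCM big_map rmorph_prod.
have [g ig /dvdpP [[c h] /= c0 E]] := irreducible_divisor sf.
have g0 : g != 0 by have [sg _] := ig; rewrite -size_poly_gt0; apply: ltn_trans sg.
have [e [g1 pg1 Eg]] := primitive_part fA g0.
have e0 : e != 0 by apply: contraNneq g0 => e0; rewrite Eg e0 mul0r.
have g1g : g1 %= g by rewrite Eg mul_polyC eqp_sym eqp_scale.
have ig1 : irreducible_poly g1.
  have [sg gi] := ig; split=> [|q sq qg]; first by rewrite (eqp_size g1g).
  apply: (@eqp_trans _ g); last by rewrite eqp_sym.
  by apply: gi => //; rewrite -(eqp_dvdr _ g1g).
have pr := prime_el_primitive fA ig1 pg1.
have [f1 Ef] : divides g1 f.
  by apply: (primitive_cancel fA pg1 c0); exists (h * e%:P); rewrite mul_polyC E Eg mulrA.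
have f10 : f1 != 0 by apply: contraNneq f0 => f10; rewrite Ef f10 mul0r.
have g10 : g1 != 0 by case: pr.
have sg1 : (1 < size g1)%N by case: ig1.
have sf1 : (0 < size f1)%N by rewrite size_poly_gt0.
have [||u [ps [uu pps Ef1]]] := IH f1 => //.
  move: sn; rewrite Ef size_mul //; lia.
exists u, (rcons ps g1); split => //.
  by move=> p; rewrite mem_rcons inE => /orP [/eqP -> //|]; apply: pps.
by rewrite -cats1 big_cat big_seq1 /= mulrA -Ef1.
Qed.

End FactorialPoly.

(** * Separating the last variable of a multivariate polynomial *)

Section MUniBijective.
Variables (R : idomainType) (n : nat).

Definition muni_inv (p : {poly {mpoly R[n]}}) : {mpoly R[n.+1]} :=
  (mpwiden p).['X_ord_max].

Lemma muni_mwiden (c : {mpoly R[n]}) : muni (mwiden c) = c%:P.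
Proof.
rewrite [c in LHS]mpolyE (raddf_sum (@mwiden n R)) (raddf_sum (@muni n R)).
rewrite [c in RHS]mpolyE (raddf_sum polyC); apply: eq_bigr => m _ /=.
rewrite mwidenZ mwidenX muniZ muniE msuppX big_seq1 mcoeffX eqxx scale1r.
rewrite mnmwiden_ordmax expr0 -!mul_polyC mulr1 -polyCM mul_mpolyC.
congr (_ *: 'X_[_])%:P; apply/mnmP => i; by rewrite mnmE mnmwiden_widen.
Qed.

Lemma muni_ordmax : muni ('X_ord_max : {mpoly R[n.+1]}) = 'X.
Proof.
rewrite muniE msuppX big_seq1 mcoeffX eqxx scale1r mnm1E eqxx expr1.
rewrite (_ : [multinom _ | i < n] = 0%MM) ?mpolyX0 ?scale1r //.
apply/mnmP => i; rewrite mnmE mnm1E mnm0E; apply/eqP; rewrite eqb0.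
by apply/eqP => /(congr1 val) /= E; have := ltn_ord i; rewrite -E ltnn.
Qed.

Lemma muni_invK : cancel muni_inv (@muni n R).
Proof.
elim/poly_ind => [|p c IH]; first by rewrite /muni_inv /mpwiden rmorph0 horner0 muni0.
rewrite /muni_inv rmorphD rmorphM /= mpwidenX mpwidenC hornerD hornerMX hornerC.
by rewrite muniD muniM -/(muni_inv p) IH muni_ordmax muni_mwiden.
Qed.

Lemma muniK : cancel (@muni n R) muni_inv.
Proof.
move=> p; rewrite muniE /muni_inv raddf_sum /= horner_sum [RHS]mpolyE.
apply: eq_bigr => m _; rewrite mpwidenZ /mpwiden map_polyXn hornerZ hornerXn.
rewrite mwidenZ mwidenX -scalerAl mpolyXn -mpolyXD; congr (_ *: 'X_[_]).
apply/mnmP => i; rewrite mnmDE mulmnE mnm1E.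
have [<-|ni] := eqVneq ord_max i; first by rewrite mnmwiden_ordmax add0n mul1n.
have li : (i < n)%N.
  have := ltn_ord i; rewrite ltnS leq_eqVlt => /orP [/eqP E|//].
  by case/eqP: ni; apply: val_inj; rewrite /= E.
rewrite mul0n addn0; have -> : i = widen_ord (leqnSn n) (Ordinal li) by apply: val_inj.
by rewrite mnmwiden_widen mnmE.
Qed.
End MUniBijective.

Lemma factorial_mpoly (R : idomainType) n : factorial R -> factorial {mpoly R[n]}.
Proof.
move=> fR; elim: n => [|n IH].
  exact: (@factorial_iso _ _ (mcoeff 0%MM) (@mpolyC 0 R) (@mpolyKC R) (@mpolyCK 0 R)).
exact: (@factorial_iso _ _ (@muni n R) _ (@muniK R n) (@muni_invK R n) (factorial_poly IH)).
Qed.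

(** * Ideals generated by two coprime polynomials *)

Lemma card_bmultinom r b : #|{: 'X_{1..r < b.+1}}| = 'C(r + b, r).
Proof.
rewrite -card_partial_ord_partitions.
pose tup (m : 'X_{1..r < b.+1}) : r.-tuple 'I_b.+1 := [tuple inord ((m : 'X_{1..r}) i) | i < r].
have lem (m : 'X_{1..r < b.+1}) i : ((m : 'X_{1..r}) i <= b)%N.
  have := bmdeg m; rewrite ltnS; apply: leq_trans.
  by rewrite mdegE (bigD1 i) //= leq_addr.
have tupE m i : val (tnth (tup m) i) = (m : 'X_{1..r}) i.
  by rewrite tnth_mktuple /= inordK // ltnS.
have tupI : injective tup.
  move=> m1 m2 E; apply: val_inj; apply/mnmP => i.
  by rewrite -!tupE E.
rewrite -(card_imset _ tupI); apply: eq_card => t; rewrite inE.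
apply/imsetP/idP => [[m _ ->]|st].
  rewrite big_tuple; have := bmdeg m; rewrite ltnS mdegE; apply: leq_trans.
  by rewrite leq_eqVlt; apply/orP; left; apply/eqP; apply: eq_bigr => i _; rewrite -tupE.
have md : (mdeg [multinom (tnth t i : nat) | i < r] < b.+1)%N.
  rewrite ltnS mdegE; move: st; rewrite big_tuple; apply: leq_trans.
  by rewrite leq_eqVlt; apply/orP; left; apply/eqP; apply: eq_bigr => i _; rewrite mnmE.
exists (BMultinom md) => //; apply: eq_from_tnth => i; apply: val_inj.
by rewrite tupE /= mnmE.
Qed.

(** The Hilbert function: the rank of the polynomials in r variables of degree less than b. *)
Definition nmon (r b : nat) : nat := #|{: 'X_{1..r < b}}|.

Lemma nmonS r b : nmon r b.+1 = 'C(r + b, r). Proof. exact: card_bmultinom. Qed.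
Lemma nmon0 r : nmon r 0 = 0%N.
Proof.
by rewrite /nmon; apply/eqP; rewrite -leqn0 leqNgt; apply/negP => /card_gt0P [m _]; have := bmdeg m.
Qed.

Lemma nmon_rec r b : nmon r.+1 b.+1 = (nmon r.+1 b + nmon r b.+1)%N.
Proof.
case: b => [|b]; first by rewrite nmon0 !nmonS !addn0 !binn.
by rewrite !nmonS addSn binS addSnnS.
Qed.

Lemma nmon_mono r b b' : (b <= b')%N -> (nmon r b <= nmon r b')%N.
Proof.
case: b => [|b]; first by rewrite nmon0.
case: b' => [//|b']; rewrite ltnS !nmonS => le; apply: leq_bin2l.
by rewrite leq_add2l.
Qed.

Lemma nmon_diff1 r b p : (p <= b)%N ->
  (nmon r.+1 b <= nmon r.+1 (b - p) + p * nmon r b)%N.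
Proof.
elim: p => [|p IH] lepb; first by rewrite subn0 leq_addr.
apply: leq_trans (IH (ltnW lepb)) _.
have -> : (b - p = (b - p.+1).+1)%N by lia.
rewrite nmon_rec mulSn -addnA leq_add2l leq_add2r; apply: nmon_mono; lia.
Qed.

(** A mixed second difference with steps p and q; by Pascal's rule each difference lowers the number
    of variables by one. It will bound the codimension of (P, Q) in degree less than b, for P and Q
    of degrees p and q. *)
Lemma nmon_diff2 r b p q : (p + q <= b)%N ->
  (nmon r.+2 b + nmon r.+2 (b - p - q) <=
   nmon r.+2 (b - p) + nmon r.+2 (b - q) + p * q * nmon r b)%N.
Proof.
elim: p => [|p IH] le; first by rewrite !subn0 /=; lia.
have {}IH := IH ltac:(lia).
have E1 : (b - p = (b - p.+1).+1)%N by lia.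
have E2 : (b - p - q = (b - p.+1 - q).+1)%N by lia.
have E3 : ((b - p.+1).+1 - q = (b - p.+1 - q).+1)%N by lia.
have := @nmon_diff1 r (b - p.+1).+1 q ltac:(lia); rewrite E3 => D.
have M : (nmon r (b - p.+1).+1 <= nmon r b)%N by apply: nmon_mono; lia.
rewrite E2 E1 !(nmon_rec r.+1) in IH; rewrite mulSn mulnDl.
have := leq_mul (leqnn q) M; lia.
Qed.

Lemma nmon_diff_1 b p q : (p + q <= b)%N ->
  (nmon 1 b + nmon 1 (b - p - q) <= nmon 1 (b - p) + nmon 1 (b - q))%N.
Proof.
have E c : nmon 1 c = c by case: c => [|c]; rewrite ?nmon0 // nmonS bin1 add1n.
rewrite !E; lia.
Qed.

Lemma nmon_diff_0 b p q : (p + q < b)%N ->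
  (nmon 0 b + nmon 0 (b - p - q) <= nmon 0 (b - p) + nmon 0 (b - q))%N.
Proof.
have E c : (0 < c)%N -> nmon 0 c = 1%N by case: c => // c; rewrite nmonS bin0.
move=> lt; rewrite !E; lia.
Qed.

Lemma nmon_grow r b : (b * nmon r b <= r.+1 * nmon r.+1 b)%N.
Proof.
case: b => [//|b]; rewrite !nmonS.
have := mul_bin_diag (r + b).+1 r; rewrite addSn => E.
have -> : (r.+1 * 'C((r + b).+1, r.+1) = (r + b).+1 * 'C(r + b, r))%N by rewrite -E.
by rewrite leq_mul2r; apply/orP; right; lia.
Qed.

(** In r variables the second difference is of order b^(r-2) and [nmon r b] of order b^r, so the
    former is negligible even after multiplication by b. For r at most 1 it vanishes. *)
Lemma nmon_large r p q A : exists2 b, (p + q < b)%N &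
  (A * b * (nmon r b + nmon r (b - p - q) - (nmon r (b - p) + nmon r (b - q)))
   <= nmon r b)%N.
Proof.
case: r => [|[|r]].
- exists (p + q).+1 => //; have := @nmon_diff_0 (p + q).+1 p q (ltnSn _).
  by rewrite -subn_eq0 => /eqP ->; rewrite muln0.
- exists (p + q).+1 => //; have := @nmon_diff_1 (p + q).+1 p q (leqnSn _).
  by rewrite -subn_eq0 => /eqP ->; rewrite muln0.
(* Two uses of [nmon_grow] give b^2 nmon r b <= (r+1)(r+2) nmon (r+2) b, so b has to exceed A p q
   (r+1)(r+2); the summand p + q + 1 ensures p + q < b. *)
pose b := (A * p * q * r.+1 * r.+2 + p + q).+1.
exists b; first by rewrite /b; lia.
have le : (p + q <= b)%N by rewrite /b; lia.
have D := @nmon_diff2 r b p q le.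
have {D} : (nmon r.+2 b + nmon r.+2 (b - p - q) -
  (nmon r.+2 (b - p) + nmon r.+2 (b - q)) <= p * q * nmon r b)%N by lia.
move=> D; apply: leq_trans (leq_mul (leqnn _) D) _.
have G1 := nmon_grow r b; have G2 := nmon_grow r.+1 b.
have G3 : (b * (b * nmon r b) <= r.+1 * r.+2 * nmon r.+2 b)%N.
  apply: leq_trans (leq_mul (leqnn b) G1) _.
  by rewrite mulnCA -mulnA leq_mul2l G2 orbT.
rewrite -(leq_pmul2l (m := r.+1 * r.+2)) ?muln_gt0 //.
apply: leq_trans G3.
have -> : (r.+1 * r.+2 * (A * b * (p * q * nmon r b)) =
  (A * p * q * r.+1 * r.+2) * (b * nmon r b))%N by ring.
rewrite leq_mul2r; apply/orP; right; rewrite /b; lia.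
Qed.

(** * Clearing denominators *)

Section ClearDenominators.
Variable R : idomainType.
Local Notation "x %:F" := (@tofrac R x).

Lemma frac_numden (x : {fraction R}) : exists n d : R, d != 0 /\ x * d%:F = n%:F.
Proof.
elim/quotW: x => r; exists (frac r).1, (frac r).2.
rewrite denom_ratioP; split => //.
rewrite !piE; apply/eqmodP; rewrite /= FracField.equivfE /FracField.mulf.
have d1 (x : R) : (\n_(Ratio x 1) = x) * (\d_(Ratio x 1) = 1).
  by rewrite numer_Ratio ?denom_Ratio ?oner_neq0.
by rewrite !d1 !mulr1 numer_Ratio ?denom_Ratio ?denom_ratioP // mulrC.
Qed.

Lemma frac_row_clear n (v : 'rV[{fraction R}]_n) :
  exists c (w : 'rV[R]_n), c != 0 /\ c%:F *: v = map_mx (@tofrac R) w.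
Proof.
have [nd H] := fin_all_exists (fun i => 
  (let: ex_intro a (ex_intro b h) := frac_numden (v 0 i) in
  ex_intro (fun ab : R * R => ab.2 != 0 /\ v 0 i * ab.2%:F = ab.1%:F) (a, b) h)).
exists (\prod_i (nd i).2), (\row_i ((nd i).1 * \prod_(j | j != i) (nd j).2)).
split; first by apply/prodf_neq0 => i _; case: (H i).
apply/rowP => i; rewrite !mxE (bigD1 i) //= !rmorphM /= -[in RHS](H i).2 mulrC.
by rewrite mulrA.
Qed.
End ClearDenominators.

(** * Koszul relations and the rank of the ideal (P, Q) in bounded degree *)

Section IdealMinor.
Variables (R : idomainType) (r : nat) (P Q : {mpoly R[r]}).
Hypotheses (Pp : prime_el P) (nPQ : ~ divides P Q).
Local Notation "x %:F" := (@tofrac R x).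

Let P0 : P != 0. Proof. by case: Pp. Qed.
Let Q0 : Q != 0. Proof. by apply/eqP => E; apply: nPQ; rewrite E; apply: divides0. Qed.

Variable b : nat.
Let p := (msize P).-1.
Let q := (msize Q).-1.
Hypothesis lepq : (p + q < b)%N.

(** The monomial multiples of P and Q of degree less than b; [p] and [q] are total degrees, [msize]
    being the degree plus one. *)
Let gen (s : 'X_{1..r < b - p} + 'X_{1..r < b - q}) : {mpoly R[r]} :=
  match s with inl m => 'X_[m] * P | inr m => 'X_[m] * Q end.

Let I := ('X_{1..r < b - p} + 'X_{1..r < b - q})%type.
Let J := 'X_{1..r < b}.

Let msP : msize P = p.+1. Proof. by rewrite /p -mpolySpred. Qed.
Let msQ : msize Q = q.+1. Proof. by rewrite /q -mpolySpred. Qed.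

Let msX (m : 'X_{1..r}) (S : {mpoly R[r]}) : S != 0 -> msize ('X_[m] * S) = (mdeg m + msize S)%N.
Proof.
move=> S0; rewrite msizeM ?msizeX //.
by rewrite -msize_poly_eq0 msizeX.
Qed.

Let gen_size s : (msize (gen s) <= b)%N.
Proof.
case: s => m; rewrite /= msX // ?msP ?msQ; have := bmdeg m; lia.
Qed.

Let G : 'M[R]_(#|{: I}|, #|{: J}|) := \matrix_(i, j) (gen (enum_val i : I))@_(enum_val j : J).
Let GF := map_mx (@tofrac R) G.

Let K := 'X_{1..r < b - p - q}.
(** The rows are the Koszul relations (X^k Q) P - (X^k P) Q = 0. *)
Let B : 'M[R]_(#|{: K}|, #|{: I}|) := \matrix_(k, i)
  match (enum_val i : I) with
  | inl m => ('X_[(enum_val k : K)] * Q)@_m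
  | inr m => - ('X_[(enum_val k : K)] * P)@_m end.

(** From a P + c Q = 0 it follows that P divides c Q, hence c = e P and a = - e Q. So every relation
    is a combination of Koszul relations, with e of degree less than b - p - q. *)
Let kernel (w : 'rV[R]_#|{: I}|) : w *m G = 0 -> exists u, w = u *m B.
Proof.
move=> wG.
pose a := \sum_(m : 'X_{1..r < b - p}) w 0 (enum_rank (inl m : I)) *: 'X_[m] : {mpoly R[r]}.
pose c := \sum_(m : 'X_{1..r < b - q}) w 0 (enum_rank (inr m : I)) *: 'X_[m] : {mpoly R[r]}.
have ca (m : 'X_{1..r < b - p}) : a@_m = w 0 (enum_rank (inl m : I)).
  rewrite /a raddf_sum (bigD1 m) //= mcoeffZ mcoeffX eqxx mulr1 big1 ?addr0 // => m' nm.
  by rewrite mcoeffZ mcoeffX -bmeqP (negPf nm) mulr0.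
have cc (m : 'X_{1..r < b - q}) : c@_m = w 0 (enum_rank (inr m : I)).
  rewrite /c raddf_sum (bigD1 m) //= mcoeffZ mcoeffX eqxx mulr1 big1 ?addr0 // => m' nm.
  by rewrite mcoeffZ mcoeffX -bmeqP (negPf nm) mulr0.
have sum_ms n (F : 'X_{1..r < n} -> R) : (msize (\sum_m F m *: 'X_[m] : {mpoly R[r]}) <= n)%N.
  apply: leq_trans (msize_sum _ _ _) _; apply/bigmax_leqP => m _.
  apply: leq_trans (msizeZ_le _ _) _; rewrite msizeX; exact: bmdeg.
have E : a * P + c * Q = 0.
  have -> : a * P + c * Q = \sum_(i : 'I_#|{: I}|) w 0 i *: gen (enum_val i).
    rewrite (reindex enum_rank) /=; last by apply: onW_bij; apply: enum_rank_bij.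
    rewrite big_sumType /= /a /c !mulr_suml; congr (_ + _); apply: eq_bigr => m _.
      by rewrite enum_rankK /= scalerAl.
    by rewrite enum_rankK /= scalerAl.
  apply/mpolyP => m; rewrite mcoeff0 raddf_sum /=.
  have [lm|lm] := ltnP (mdeg m) b; last first.
    apply: big1 => i _; rewrite mcoeffZ (@memN_msupp_eq0 _ _ (gen _)) ?mulr0 //.
    by apply: msize_mdeg_ge; apply: leq_trans (gen_size _) lm.
  have /matrixP /(_ 0 (enum_rank (BMultinom lm))) := wG.
  rewrite !mxE => E0; rewrite -[RHS]E0; apply: eq_bigr => i _; rewrite mcoeffZ mxE; congr (_ * mcoeff _ _).
  by rewrite enum_rankK.
have [e Ee] : divides P c.
  have [_ _ pm] := Pp.
  have : divides P (c * Q).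
    by exists (- a); rewrite mulNr; apply/eqP; rewrite -addr_eq0 addrC E.
  by case/pm.
have Ea : a = - (e * Q).
  apply: (mulIf P0); apply/eqP; rewrite -subr_eq0 mulNr opprK -[X in _ == X]E Ee.
  by apply/eqP; ring.
have se : (msize e <= b - p - q)%N.
  have [->|e0] := eqVneq e 0; first by rewrite msize0.
  have : (msize c <= b - q)%N by apply: sum_ms.
  rewrite Ee msizeM // msP (mpolySpred _ e0); lia.
pose u : 'rV[R]_#|{: K}| := \row_k - e@_(enum_val k : K).
exists u.
have Ee' : e = \sum_(k : 'I_#|{: K}|) (e@_(enum_val k : K)) *: 'X_[(enum_val k : K)].
  rewrite {1}(mpolywE se) (reindex (fun k : 'I_#|{: K}| => (enum_val k : K))) //=.
  by apply: onW_bij; apply: enum_val_bij.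
apply/rowP => i; rewrite !mxE.
rewrite -[i]enum_valK; case: (enum_val i) => m.
  rewrite -ca Ea Ee' mulr_suml -sumrN raddf_sum /=; apply: eq_bigr => k _.
  by rewrite !mxE enum_rankK -scalerAl mcoeffN mcoeffZ mulNr.
rewrite -cc Ee {1}Ee' mulr_suml raddf_sum /=; apply: eq_bigr => k _.
by rewrite !mxE enum_rankK -scalerAl mcoeffZ mulrNN.
Qed.

Let rank_lower : (nmon r (b - p) + nmon r (b - q) <= \rank GF + nmon r (b - p - q))%N.
Proof.
have le : (kermx GF <= map_mx (@tofrac R) B)%MS.
  apply/row_subP => i; have := row_sub i (kermx GF); move: (row i _) => v /sub_kermxP vG.
  have [c [w [c0 Ew]]] := frac_row_clear v.
  have [u Eu] : exists u, w = u *m B.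
    apply: kernel; have E : map_mx (@tofrac R) (w *m G) = 0.
      by rewrite map_mxM -Ew -scalemxAl vG scaler0.
    apply/matrixP => x y; apply/eqP; rewrite -tofrac_eq.
    by have /matrixP /(_ x y) := E; rewrite [in X in X -> _]mxE => ->; rewrite !mxE.
  have cF0 : c%:F != 0 by rewrite tofrac_eq0.
  rewrite -[v]scale1r -(mulVf cF0) -scalerA Ew Eu map_mxM.
  by apply: scalemx_sub; apply: submxMl.
have := mxrankS le; rewrite mxrank_ker.
have := rank_leq_row (map_mx (@tofrac R) B); have := rank_leq_row GF.
have cI : #|{: I}| = (nmon r (b - p) + nmon r (b - q))%N by rewrite card_sum.
have cK : #|{: K}| = nmon r (b - p - q) by [].
move: cI cK; move: (\rank (map_mx _ B)) (\rank GF) => x y; lia.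
Qed.

(** A basis of the row space and then pivot columns give an invertible square block. Its size is the
    rank, bounded below by counting the Koszul relations. *)
Lemma ideal_minor_aux : exists (n : nat) (f : 'I_n -> {mpoly R[r]}) (c : 'I_n -> 'X_{1..r < b}),
  [/\ (n <= nmon r b)%N, (nmon r (b - p) + nmon r (b - q) <= n + nmon r (b - p - q))%N,
      forall i, exists m, f i = 'X_[m] * P \/ f i = 'X_[m] * Q,
      forall i, (msize (f i) <= b)%N &
      \det (\matrix_(i, j) (f i)@_(c j)) != 0].
Proof.
pose H := rowsub (maxrankfun GF) GF.
have Hf : row_full H^T.
  by rewrite /row_full mxrank_tr; exact: (maxrowsub_free GF).
pose fr := fullrankfun Hf.
exists (\rank GF), (fun i => gen (enum_val (maxrankfun GF i))),
  (fun j => enum_val (fr j)); split.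
- by have := rank_leq_col GF.
- exact: rank_lower.
- by move=> i; case: (enum_val _) => m /=; exists m; [left|right].
- by move=> i; apply: gen_size.
have := fullrowsub_unit Hf; rewrite unitmxE unitfE -det_tr.
have -> : (rowsub (fullrankfun Hf) H^T)^T = map_mx (@tofrac R)
  (\matrix_(i, j) (gen (enum_val (maxrankfun GF i)))@_(enum_val (fr j))).
  by apply/matrixP => i j; rewrite !mxE.
by rewrite det_map_mx tofrac_eq0.
Qed.
End IdealMinor.

(* The ideal (P, Q) has codimension o(b^(r-1)) among polynomials of degree < b *)
Lemma ideal_minor (R : idomainType) (r : nat) (P Q : {mpoly R[r]}) (A : nat) :
  prime_el P -> ~ divides P Q ->
  exists b n (f : 'I_n -> {mpoly R[r]}) (c : 'I_n -> 'X_{1..r < b}),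
  [/\ (n <= nmon r b)%N /\ (0 < b)%N, (A * b * (nmon r b - n) <= nmon r b)%N,
      forall i, exists m, f i = 'X_[m] * P \/ f i = 'X_[m] * Q,
      forall i, (msize (f i) <= b)%N &
      \det (\matrix_(i, j) (f i)@_(c j)) != 0].
Proof.
move=> Pp nPQ.
have [b lt H] := nmon_large r (msize P).-1 (msize Q).-1 A.
have [n [f [c [h1 h2 h3 h4 h5]]]] := ideal_minor_aux Pp nPQ lt.
exists b, n, f, c; split => //; first by split => //; lia.
apply: leq_trans H; rewrite leq_mul2l; apply/orP; right; lia.
Qed.

(** * Valuations of algebraic extensions of k(t) *)

Section ValuationRing.
Variables (k : closedFieldType) (L : fieldType) (kappa : {rmorphism k -> L}) (s : L).
Hypothesis s_transc : forall p : {poly k}, p != 0 -> (map_poly kappa p).[s] != 0.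

(** The subrings containing k[s] in which s is not invertible. By Chevalley's argument a maximal one
    is a valuation ring with s in its maximal ideal. *)
Definition sub_ring (R : L -> Prop) :=
  [/\ (forall c, R (kappa c)), R s, (forall x y, R x -> R y -> R (x - y)),
      (forall x y, R x -> R y -> R (x * y)) & ~ R s^-1].

Lemma s_neq0 : s != 0.
Proof. by have := @s_transc (polyX k) (negbT (polyX_eq0 k)); rewrite map_polyX hornerX. Qed.

Lemma sub_ring_base : sub_ring (fun x => exists p, x = (map_poly kappa p).[s]).
Proof.
split.
- by move=> c; exists c%:P; rewrite map_polyC hornerC.
- by exists 'X; rewrite map_polyX hornerX.
- by move=> _ _ [p ->] [q ->]; exists (p - q); rewrite rmorphB hornerD hornerN.
- by move=> _ _ [p ->] [q ->]; exists (p * q); rewrite rmorphM hornerM.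
case=> p E; have : ('X * p - 1 : {poly k}) != 0.
  apply/eqP => /(congr1 (horner^~ 0)); rewrite !hornerE => /eqP.
  by rewrite oppr_eq0 oner_eq0.
move/s_transc; rewrite rmorphB rmorphM /= map_polyX rmorph1 !hornerE -E.
by rewrite mulfV ?s_neq0 // subrr eqxx.
Qed.

Lemma maximal_sub_ring : exists R, sub_ring R /\
  forall R', sub_ring R' -> (forall x, R x -> R' x) -> forall x, R' x -> R x.
Proof.
pose P (A : L -> Prop) := (forall x, ~ A x) \/ sub_ring A.
have [|A [PA mA]] := @classical_sets.Zorn_bigcup L P.
  move=> F FP tF.
  have [e|/boolp.existsNP [A0 /boolp.not_implyP [FA0 nA0]]] :=
    boolp.EM (forall A, F A -> forall x, ~ A x).
    by left=> x [A FA Ax]; exact: e FA x Ax.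
  have [x0 A0x0] : exists x, A0 x.
    by apply/boolp.not_existsP => H; apply: nA0.
  have sA A : F A -> forall x, A x -> sub_ring A.
    by move=> /FP [H x /H //|].
  have [B0 [FB0 sB0]] : exists B, F B /\ sub_ring B.
    by exists A0; split => //; exact: sA FA0 _ A0x0.
  have two x y : classical_sets.bigcup F id x -> classical_sets.bigcup F id y ->
      exists A, [/\ F A, sub_ring A, A x & A y].
    move=> [A FA Ax] [B FB By].
    case: (tF A B FA FB) => h.
      by exists B; split => //; [exact: sA FB _ By|exact: h].
    by exists A; split => //; [exact: sA FA _ Ax|exact: h].
  right; have [b1 b2 _ _ _] := sB0; split.
  - by move=> c; exists B0.
  - by exists B0.
  - by move=> x y /two h /h [A [FA [_ _ a3 _ _] Ax Ay]]; exists A => //; apply: a3.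
  - by move=> x y /two h /h [A [FA [_ _ _ a4 _] Ax Ay]]; exists A => //; apply: a4.
  - by case=> A FA Ax; have [_ _ _ _] := sA _ FA _ Ax; apply.
have sA : sub_ring A.
  case: PA => // eA; case: (mA (fun x => exists p, x = (map_poly kappa p).[s])); last first.
    by right; exact: sub_ring_base.
  split; first by move=> x /eA.
  by move=> /(_ s) h; apply: (eA s); apply: h; exists 'X; rewrite map_polyX hornerX.
exists A; split => // R' sR' AR' x R'x; apply: boolp.contrapT => nAx.
apply: (mA R'); last by right.
by split=> // h; apply: nAx; apply: h.
Qed.

Section MaximalRing.
Variable R : L -> Prop.
Hypotheses (sR : sub_ring R)
  (mR : forall R', sub_ring R' -> (forall x, R x -> R' x) -> forall x, R' x -> R x).

Lemma ringC c : R (kappa c). Proof. by case: sR. Qed.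
Lemma ringS : R s. Proof. by case: sR. Qed.
Lemma ringB x y : R x -> R y -> R (x - y). Proof. by case: sR => _ _ h _ _; apply: h. Qed.
Lemma ringM x y : R x -> R y -> R (x * y). Proof. by case: sR => _ _ _ h _; apply: h. Qed.
Lemma ring_sV : ~ R s^-1. Proof. by case: sR. Qed.
Lemma ring0 : R 0. Proof. by rewrite -(rmorph0 kappa); apply: ringC. Qed.
Lemma ring1 : R 1. Proof. by rewrite -(rmorph1 kappa); apply: ringC. Qed.
Lemma ringN x : R x -> R (- x). Proof. by move=> h; rewrite -sub0r; apply: ringB => //; apply: ring0. Qed.
Lemma ringD x y : R x -> R y -> R (x + y).
Proof. by move=> hx hy; rewrite -[y]opprK; apply: ringB => //; apply: ringN. Qed.
Lemma ringX x n : R x -> R (x ^+ n).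
Proof. by move=> h; elim: n => [|n IH]; [apply: ring1|rewrite exprS; apply: ringM]. Qed.
Lemma ring_sum I (r : seq I) (P : pred I) (F : I -> L) : (forall i, P i -> R (F i)) -> R (\sum_(i <- r | P i) F i).
Proof. by move=> h; elim/big_ind: _ => //; [apply: ring0|apply: ringD]. Qed.
Lemma ring_horner (p : {poly L}) x : (forall i, R p`_i) -> R x -> R p.[x].
Proof. by move=> hp hx; rewrite horner_coef; apply: ring_sum => i _; apply: ringM => //; apply: ringX. Qed.

(** With y = 1 + s r, the ring R[1/y] does not contain 1/s: otherwise y^N = a s, while y^N = 1 + s
    c, and 1/s = a - c would lie in R. By maximality 1/y is in R. *)
Lemma ring_1ps r : R r -> R (1 + s * r)^-1.
Proof.
move=> Rr; set y := 1 + s * r.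
have Ry : R y by apply: ringD; [apply: ring1|apply: ringM => //; apply: ringS].
have y0 : y != 0.
  apply/eqP => E; apply: ring_sV; have <- : - r = s^-1; last exact: ringN.
  apply: (mulfI s_neq0); rewrite mulfV ?s_neq0 // mulrN.
  by apply/eqP; rewrite eqr_oppLR -subr_eq0 opprK addrC -/y E.
pose R' x := exists a N, R a /\ x = a / y ^+ N.
have sub x : R x -> R' x by move=> h; exists x, 0%N; rewrite expr0 divr1.
have yN N : exists c, R c /\ y ^+ N = 1 + s * c.
  elim: N => [|N [c [Rc E]]]; first by exists 0; rewrite mulr0 addr0 expr0; split => //; apply: ring0.
  exists (r + c + s * r * c); split; last by rewrite exprS E /y; ring.
  apply: ringD; first exact: ringD.
  by apply: ringM => //; apply: ringM => //; apply: ringS.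
case: (boolp.EM (sub_ring R')) => [sR'|nsR'].
  by apply: (mR sR' sub); exists 1, 1%N; rewrite expr1 mul1r; split => //; apply: ring1.
have [a [N [Ra Ea]]] : R' s^-1.
  apply: boolp.contrapT => ns; apply: nsR'; split => //.
  - by move=> c; apply: sub; apply: ringC.
  - by apply: sub; apply: ringS.
  - move=> _ _ [a [N [Ra ->]]] [b [M [Rb ->]]].
    exists (a * y ^+ M - b * y ^+ N), (N + M)%N; split.
      by apply: ringB; apply: ringM => //; apply: ringX.
    have := expf_neq0 N y0; have := expf_neq0 M y0; rewrite exprD => h1 h2.
    by field; rewrite h1 h2.
  move=> _ _ [a [N [Ra ->]]] [b [M [Rb ->]]]; exists (a * b), (N + M)%N.
  by split; [apply: ringM|rewrite exprD invfM; ring].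
have [c [Rc Ec]] := yN N.
case: ring_sV; have <- : a - c = s^-1; last exact: ringB.
apply: (mulfI s_neq0); rewrite mulfV ?s_neq0 //.
have : y ^+ N = a * s.
  have -> : a = s^-1 * y ^+ N by rewrite Ea mulfVK ?expf_neq0.
  by rewrite mulrC mulVKf ?s_neq0.
rewrite Ec => E; apply/eqP; rewrite -subr_eq0; apply/eqP.
have -> : s * (a - c) - 1 = a * s - (1 + s * c) by ring.
by rewrite E subrr.
Qed.

Let inR (p : {poly L}) := forall i, R p`_i.
(** A witness, of degree less than n in x, that 1/s lies in R[x]. *)
Let hasrel (x : L) n := exists p : {poly L}, [/\ (size p <= n)%N, inR p & s * p.[x] = 1].

Let inRB p q : inR p -> inR q -> inR (p - q).
Proof. by move=> hp hq i; rewrite coefB; apply: ringB. Qed.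
Let inRD p q : inR p -> inR q -> inR (p + q).
Proof. by move=> hp hq i; rewrite coefD; apply: ringD. Qed.
Let inRM p q : inR p -> inR q -> inR (p * q).
Proof. by move=> hp hq i; rewrite coefM; apply: ring_sum => j _; apply: ringM. Qed.
Let inRC c : R c -> inR c%:P.
Proof. by move=> hc i; rewrite coefC; case: ifP => _ //; apply: ring0. Qed.
Let inRX : inR 'X.
Proof. by move=> i; rewrite coefX; case: eqP => _; [apply: ring1|apply: ring0]. Qed.

Let adjoin x : ~ R x -> exists n, hasrel x n.
Proof.
move=> nRx; pose R' y := exists p, inR p /\ y = p.[x].
have sub y : R y -> R' y by move=> h; exists y%:P; rewrite hornerC; split => //; apply: inRC.
case: (boolp.EM (sub_ring R')) => [sR'|nsR'].
  by case: nRx; apply: (mR sR' sub); exists 'X; rewrite hornerX.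
have [p [hp E]] : R' s^-1.
  apply: boolp.contrapT => ns; apply: nsR'; split => //.
  - by move=> c; apply: sub; apply: ringC.
  - by apply: sub; apply: ringS.
  - by move=> _ _ [p [hp ->]] [q [hq ->]]; exists (p - q); rewrite hornerD hornerN; split => //; apply: inRB.
  by move=> _ _ [p [hp ->]] [q [hq ->]]; exists (p * q); rewrite hornerM; split => //; apply: inRM.
by exists (size p), p; rewrite -E mulfV ?s_neq0.
Qed.

(** The relation for 1/x, multiplied by x^m and by the inverse of the unit 1 - s q_0, expresses x^m
    as s t(x) with t of lower degree; this eliminates the top term of the relation for x. *)
Let reduce x m l : x != 0 -> hasrel x m.+1 -> hasrel x^-1 l.+1 -> (l <= m)%N -> hasrel x m.
Proof.
move=> x0 [p [sp hp Ep]] [q [sq hq Eq]] lm.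
pose e := (1 - s * q`_0)^-1.
have u0 : 1 - s * q`_0 != 0.
  apply/eqP => E; case: ring_sV.
  suff -> : s^-1 = q`_0 by apply: hq.
  apply: (mulfI s_neq0); rewrite mulfV ?s_neq0 //.
  by apply/eqP; rewrite -subr_eq0 E.
have Re : R e by rewrite /e -mulrN; apply: ring_1ps; apply: ringN.
pose t := \sum_(i < l) (e * q`_i.+1) *: 'X^(m - i.+1) : {poly L}.
have Et : s * t.[x] = x ^+ m.
  have -> : t.[x] = e * x ^+ m * (q.[x^-1] - q`_0).
    rewrite (horner_coef_wide _ sq) big_ord_recl expr0 mulr1 addrC addKr mulr_sumr.
    rewrite horner_sum; apply: eq_bigr => i _ /=; rewrite hornerZ hornerXn -!mulrA; congr (_ * _).
    have im : (i.+1 <= m)%N by apply: leq_trans lm; apply: ltn_ord.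
    by rewrite /bump /= add1n mulrCA exprVn -expfB_cond // (negPf x0).
  rewrite mulrBr [q.[_]](_ : _ = s^-1); last first.
    by apply: (mulfI s_neq0); rewrite mulfV ?s_neq0.
  by rewrite /e; field; rewrite s_neq0 u0.
exists (p - p`_m *: 'X^m + (p`_m * s) *: t); split.
- apply/leq_sizeP => i mi; rewrite coefD coefB !coefZ coefXn.
  have -> : t`_i = 0.
    rewrite /t coef_sum big1 // => j _; rewrite coefZ coefXn.
    case: eqP => [E|]; last by rewrite mulr0.
    by have := ltn_ord j; lia.
  rewrite mulr0 addr0; move: mi; rewrite leq_eqVlt => /orP [/eqP <-|mi].
    by rewrite eqxx mulr1 subrr.
  by rewrite gtn_eqF // mulr0 subr0 nth_default //; apply: leq_trans sp mi.
- apply: inRD; first apply: inRB => //.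
    rewrite -mul_polyC; apply: inRM; first exact: inRC.
    by move=> i; rewrite coefXn; case: eqP => _; [apply: ring1|apply: ring0].
  rewrite -mul_polyC; apply: inRM; first by apply: inRC; apply: ringM => //; apply: ringS.
  move=> i; rewrite /t coef_sum; apply: ring_sum => j _; rewrite coefZ coefXn.
  apply: ringM; first by apply: ringM.
  by case: eqP => _; [apply: ring1|apply: ring0].
rewrite !(hornerD, hornerN, hornerZ) hornerXn mulrDr mulrBr Ep.
by rewrite -Et; ring.
Qed.

(** If neither x nor 1/x is in R, both satisfy a relation by maximality. The longer one can always
    be shortened by the other, down to the absurd empty relation. *)
Lemma ring_total x : x != 0 -> R x \/ R x^-1.
Proof.
move=> x0; apply: boolp.contrapT => /boolp.not_orP [nx nxV].
have [n0 h0] := adjoin nx; have [m0 h1] := adjoin nxV.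
have mono y a b : (a <= b)%N -> hasrel y a -> hasrel y b.
  by move=> ab [p [sp hp E]]; exists p; split => //; apply: leq_trans ab.
have base y : ~ hasrel y 0.
  case=> p [sp _ E]; move: E; have /eqP -> : p == 0 by rewrite -size_poly_eq0 -leqn0.
  by rewrite horner0 mulr0 => /eqP; rewrite eq_sym oner_eq0.
have [n sn] := ubnP (n0 + m0)%N; elim: n => // n IH in n0 m0 sn h0 h1 *.
case: n0 => [|n0] in sn h0 *; first exact: base h0.
case: m0 => [|m0] in sn h1 *; first exact: base h1.
have [le|le] := leqP m0 n0.
  by apply: (IH n0 m0.+1); [lia|exact: reduce x0 h0 h1 le|].
apply: (IH n0.+1 m0); [lia|by []|].
apply: (reduce _ h1 _ (ltnW le)); first by rewrite invr_eq0.
by rewrite invrK.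
Qed.

End MaximalRing.
End ValuationRing.

(** * The valuation with v(s) = 1 attached to the valuation ring *)

Section Valuation.
Variables (k : closedFieldType) (L : fieldType) (kappa : {rmorphism k -> L}) (s : L).
Hypothesis s_transc : forall p : {poly k}, p != 0 -> (map_poly kappa p).[s] != 0.

Definition poly2_eval (P : {poly {poly k}}) (x : L) : L :=
  (map_poly (horner_eval s \o map_poly kappa) P).[x].

Definition alg_over x := exists2 P : {poly {poly k}}, P != 0 & poly2_eval P x = 0.

Let s0 := s_neq0 s_transc.

Variable R : L -> Prop.
Hypotheses (sR : sub_ring kappa s R)
  (R1ps : forall r, R r -> R (1 + s * r)^-1)
  (Rtot : forall x, x != 0 -> R x \/ R x^-1).

Let RC := ringC sR.
Let RS := ringS sR.
Let RB := ringB sR.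
Let RM := ringM sR.
Let RD := ringD sR.
Let RX := ringX sR.
Let R1 := ring1 sR.
Let R0 := ring0 sR.

Definition runit x := [/\ x != 0, R x & R x^-1].
(** The maximal ideal of R. Zero is a separate case, since its inverse is 0 by convention and lies
    in R. *)
Definition rmax x := x = 0 \/ R x /\ ~ R x^-1.

Lemma rmax_ring x : rmax x -> R x. Proof. by case=> [->|[]]. Qed.
Lemma ring_unit_max x : R x -> runit x \/ rmax x.
Proof.
move=> Rx; have [->|x0] := eqVneq x 0; first by right; left.
by case: (boolp.EM (R x^-1)) => h; [left|right; right].
Qed.
Lemma unit_not_max x : runit x -> rmax x -> False.
Proof. by case=> x0 _ RV [/eqP|[_ /(_ RV)]] //; rewrite (negPf x0). Qed.
Lemma runitM x y : runit x -> runit y -> runit (x * y).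
Proof. by case=> x0 Rx Rx' [y0 Ry Ry']; split; rewrite ?mulf_neq0 ?invfM //; apply: RM. Qed.
Lemma runitV x : runit x -> runit x^-1.
Proof. by case=> x0 Rx Rx'; split; rewrite ?invr_eq0 ?invrK. Qed.
Lemma runit1 : runit 1. Proof. by split; rewrite ?oner_eq0 ?invr1. Qed.
Lemma runitX x n : runit x -> runit (x ^+ n).
Proof. by move=> ux; elim: n => [|n IH]; [apply: runit1|rewrite exprS; apply: runitM]. Qed.
Lemma rmaxM x y : R x -> rmax y -> rmax (x * y).
Proof.
move=> Rx my; have Rxy : R (x * y) by apply: RM => //; apply: rmax_ring.
case: (ring_unit_max Rxy) => // -[xy0 _ RV].
case: my => [E|[Ry nRV]]; first by rewrite E mulr0 eqxx in xy0.
case: nRV; have -> : y^-1 = x * (x * y)^-1; last exact: RM.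
by rewrite invfM mulVKf //; apply: contraNneq xy0 => ->; rewrite mul0r.
Qed.
Lemma rmaxD x y : rmax x -> rmax y -> rmax (x + y).
Proof.
move=> mx my; have [->|x0] := eqVneq x 0; first by rewrite add0r.
have [->|y0] := eqVneq y 0; first by rewrite addr0.
have q0 : y / x != 0 by rewrite mulf_neq0 ?invr_eq0.
case: (Rtot q0) => h.
  have -> : x + y = (1 + y / x) * x by rewrite mulrDl mul1r divfK.
  by apply: rmaxM => //; apply: RD.
have -> : x + y = (1 + (y / x)^-1) * y by rewrite mulrDl mul1r invfM invrK -mulrA mulrCA mulVf // mulr1 addrC.
by apply: rmaxM => //; apply: RD.
Qed.
Lemma rmax_sum I (r : seq I) (P : pred I) (F : I -> L) :
  (forall i, P i -> rmax (F i)) -> rmax (\sum_(i <- r | P i) F i).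
Proof. by move=> h; elim/big_ind: _ => //; [left|apply: rmaxD]. Qed.
Lemma rmaxN x : rmax x -> rmax (- x).
Proof. by rewrite -mulN1r; apply: rmaxM; rewrite -sub0r; apply: RB. Qed.
Lemma rmax_s : rmax s. Proof. by right; split => //; apply: ring_sV sR. Qed.
Lemma unit_kappa c : c != 0 -> runit (kappa c).
Proof. by move=> c0; split; rewrite ?fmorph_eq0 // -fmorphV. Qed.
Lemma rmax_X x n : (0 < n)%N -> rmax x -> rmax (x ^+ n).
Proof.
case: n => // n _ mx; rewrite exprSr; apply: rmaxM => //.
by apply: RX; apply: rmax_ring.
Qed.

(** The value is l / b when x^b is s^l times a unit. This is a relation, since an element
    transcendental over k(s) may have no rational value. *)
Definition has_val (x : L) (q : rat) := exists (b : nat) (l : int),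
  [/\ (0 < b)%N, x != 0, q = l%:~R / b%:R & runit (x ^+ b * s ^ (- l))].

Lemma runit_sz (l : int) : runit (s ^ l) -> l = 0.
Proof.
have pos n : runit (s ^+ n) -> n = 0%N.
  case: n => // n u; case: (unit_not_max u); apply: rmax_X => //; exact: rmax_s.
case: l => n u; first by rewrite (pos _ u).
by have := pos n.+1; rewrite -[_ ^+ _]invrK => /(_ (runitV u)).
Qed.

Lemma expfz_expn x (b : nat) (l : int) : (x ^ l) ^+ b = x ^ (l * b) :> L.
Proof. by rewrite exprnP exprz_exp. Qed.

Lemma has_val_uniq x q q' : has_val x q -> has_val x q' -> q = q'.
Proof.
case=> b [l [b0 x0 -> u]] [b' [l' [b'0 _ -> u']]].
have : runit (s ^ (l' * b - l * b')).
  have -> : s ^ (l' * b - l * b') = (x ^+ b * s ^ (- l)) ^+ b' / (x ^+ b' * s ^ (- l')) ^+ b.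
    rewrite !exprMn !expfz_expn -!exprM [(b' * b)%N]mulnC invfM mulrACA mulfV ?expf_neq0 // mul1r.
    by rewrite invr_expz -expfzDr //; congr (_ ^ _); ring.
  by apply: runitM; last apply: runitV; apply: runitX.
move/runit_sz => /eqP; rewrite subr_eq0 => /eqP E.
apply/eqP; rewrite eqr_div ?pnatr_eq0 -?lt0n //; apply/eqP.
by have := congr1 (fun z : int => z%:~R : rat) E; rewrite !rmorphM /= !pmulrn => <-.
Qed.

Lemma has_valM x y q q' : has_val x q -> has_val y q' -> has_val (x * y) (q + q').
Proof.
case=> b [l [b0 x0 -> u]] [b' [l' [b'0 y0 -> u']]].
exists (b * b')%N, (l * b' + l' * b); split.
- by rewrite muln_gt0 b0.
- by rewrite mulf_neq0.
- rewrite rmorphD !rmorphM /= ?natrM -!pmulrn; field.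
  by rewrite !pnatr_eq0 -!lt0n b0 b'0.
have -> : (x * y) ^+ (b * b') * s ^ (- (l * b' + l' * b)) =
    (x ^+ b * s ^ (- l)) ^+ b' * (y ^+ b' * s ^ (- l')) ^+ b.
  rewrite !exprMn !expfz_expn -!exprM [(b' * b)%N]mulnC mulrACA -expfzDr //.
  by congr (_ * _ ^ _); ring.
by apply: runitM; apply: runitX.
Qed.

Lemma has_valV x q : has_val x q -> has_val x^-1 (- q).
Proof.
case=> b [l [b0 x0 -> u]]; exists b, (- l); split => //.
- by rewrite invr_eq0.
- by rewrite rmorphN mulNr.
have -> : x^-1 ^+ b * s ^ (- - l) = (x ^+ b * s ^ (- l))^-1; last exact: runitV.
by rewrite invfM exprVn invr_expz.
Qed.

Lemma has_val_unit x : runit x -> has_val x 0.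
Proof.
move=> u; have [x0 _ _] := u.
by exists 1%N, 0; split => //; rewrite ?mul0r // oppr0 expr0z mulr1 expr1.
Qed.

Lemma has_val_s : has_val s 1.
Proof.
exists 1%N, 1; split; rewrite ?divr1 // expr1 exprN1 mulfV //; exact: runit1.
Qed.

Lemma has_val_ge0 x q : has_val x q -> 0 <= q <-> R x.
Proof.
case=> b [l [b0 x0 -> u]].
have lE : (0 <= l%:~R / b%:R :> rat) = (0 <= l).
  by rewrite pmulr_lge0 ?invr_gt0 ?ltr0n // ler0z.
rewrite lE; split => [l0|Rx].
  case: l l0 u {lE} => // n _ u.
  have Rxb : R (x ^+ b).
    have -> : x ^+ b = (x ^+ b * s ^ (- n%:Z)) * s ^+ n by rewrite -mulrA (exprnP s) -expfzDr // addNr expr0z mulr1.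
    by apply: RM; [case: u|apply: RX].
  case: (Rtot x0) => // RV; case: (ring_unit_max RV) => [[_ _]|mV]; first by rewrite invrK.
  have : rmax (x ^+ b * x^-1 ^+ b) by apply: rmaxM => //; apply: rmax_X.
  by rewrite exprVn mulfV ?expf_neq0 // => /(unit_not_max runit1).
rewrite leNgt; apply/negP => l0; case: (unit_not_max u).
apply: rmaxM; first exact: RX.
case: l l0 {u lE} => // n _; have -> : - Negz n = n.+1 by rewrite NegzE opprK.
exact: (rmax_X _ rmax_s).
Qed.

Lemma has_val_gt0 x q : has_val x q -> 0 < q <-> rmax x.
Proof.
move=> hx; have [b [l [b0 x0 _ _]]] := hx.
have h1 := has_val_ge0 hx; have h2 := has_val_ge0 (has_valV hx).
rewrite oppr_ge0 in h2; rewrite ltNge; split.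
  move=> /negP nq; right; split; last by move/h2.
  by apply/h1; rewrite leNgt; apply/negP => /ltW.
by case=> [E|[_ nR]]; [rewrite E eqxx in x0|apply/negP => /h2].
Qed.

Lemma has_valD x y q q' q'' : has_val x q -> has_val y q' -> has_val (x + y) q'' ->
  Num.min q q' <= q''.
Proof.
wlog : x y q q' / q <= q' => [H|le].
  have [le|le] := leP q q' => hx hy hs; first by have := H _ _ _ _ le hx hy hs; rewrite min_l.
  by rewrite addrC in hs; have := H _ _ _ _ (ltW le) hy hx hs; rewrite min_l // ltW.
move=> hx hy hs; rewrite min_l //.
have [_ [_ [_ x0 _ _]]] := hx.
have hyx := has_valM hy (has_valV hx).
have hsx := has_valM hs (has_valV hx).
rewrite -subr_ge0; apply/(has_val_ge0 hsx).
rewrite mulrDl mulfV //; apply: RD => //.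
by apply/(has_val_ge0 hyx); rewrite subr_ge0.
Qed.

(** After the powers of s are removed, the constant term c is nonzero and the rest is c (1 + s r), a
    unit. *)
Lemma poly_val (p : {poly k}) : p != 0 -> exists n : nat, exists2 u,
  runit u & (map_poly kappa p).[s] = s ^+ n * u.
Proof.
move=> p0; have [m] := ubnP (size p); elim: m => // m IH in p p0 *.
have [c0|c0] := eqVneq p.[0] 0 => sp.
  have /factor_theorem [q Eq] : root p 0 by apply/rootP.
  rewrite subr0 in Eq; have q0 : q != 0 by apply: contraNneq p0 => q0; rewrite Eq q0 mul0r.
  have [|n [u uu E]] := IH _ q0.
    by move: sp; rewrite Eq size_mulX.
  exists n.+1, u => //; rewrite Eq rmorphM /= map_polyX hornerMX E exprS.
  by rewrite mulrC mulrA.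
exists 0%N, (map_poly kappa p).[s]; last by rewrite mul1r.
have /factor_theorem [q Eq] : root (p - p.[0]%:P) 0 by rewrite rootE !hornerE subrr.
rewrite subr0 in Eq.
have -> : (map_poly kappa p).[s] =
  kappa p.[0] * (1 + s * ((map_poly kappa q).[s] * (kappa p.[0])^-1)).
  rewrite -[in LHS](subrK p.[0]%:P p) Eq rmorphD rmorphM /= map_polyX map_polyC.
  rewrite hornerD hornerMX hornerC; field; by rewrite fmorph_eq0.
have Rq : R ((map_poly kappa q).[s] / kappa p.[0]).
  rewrite -fmorphV; apply: RM => //; apply: (ring_horner sR) => // i.
  by rewrite coef_map; apply: RC.
apply: runitM; first exact: unit_kappa.
have RE : R (1 + s * ((map_poly kappa q).[s] / kappa p.[0])) by apply: RD => //; apply: RM.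
split => //; last exact: R1ps.
apply/eqP => E; case: (unit_not_max runit1).
have -> : 1 = - ((map_poly kappa q).[s] / kappa p.[0] * s) :> L.
  by apply/eqP; rewrite -addr_eq0 [_ * s]mulrC E.
by apply: rmaxN; apply: rmaxM => //; apply: rmax_s.
Qed.

(** Divide by a term of least value: if it were the only one of that value, 1 would be a sum of
    elements of the maximal ideal. *)
Lemma sum0_max n (f : 'I_n -> L) : \sum_i f i = 0 -> (exists i, f i != 0) ->
  exists i j, [/\ i != j, f i != 0, f j != 0 & runit (f i / f j)].
Proof.
move=> sf [i0 fi0].
have [i [fi Hi]] : exists i, f i != 0 /\ forall j, R (f j / f i).
  have H (r : seq 'I_n) : exists i, f i != 0 /\ forall j, j \in r -> R (f j / f i).
    elim: r => [|x r [i [fi IH]]]; first by exists i0.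
    have [x0|x0] := eqVneq (f x) 0.
      by exists i; split => // j; rewrite inE => /orP [/eqP ->|/IH //]; rewrite x0 mul0r.
    have q0 : f x / f i != 0 by rewrite mulf_neq0 ?invr_eq0.
    case: (Rtot q0) => h.
      by exists i; split => // j; rewrite inE => /orP [/eqP ->|/IH //].
    exists x; split => // j; rewrite inE => /orP [/eqP ->|/IH hj]; first by rewrite mulfV.
    have -> : f j / f x = (f j / f i) * (f x / f i)^-1 by field; rewrite fi x0.
    exact: RM.
  by have [i [fi Hi]] := H (enum 'I_n); exists i; split => // j; apply: Hi; rewrite mem_enum.
apply: boolp.contrapT => H.
have mj j : j != i -> rmax (f j / f i).
  move=> ji; case: (ring_unit_max (Hi j)) => // u; case: H; exists j, i; split => //.
  by case: u; rewrite mulf_eq0 negb_or => /andP [].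
case: (unit_not_max runit1).
have -> : 1 = - \sum_(j | j != i) f j / f i.
  apply/eqP; rewrite -addr_eq0; have : \sum_j f j / f i = 0 by rewrite -mulr_suml sf mul0r.
  by rewrite (bigD1 i) //= mulfV // => ->.
by apply: rmaxN; apply: rmax_sum.
Qed.

(** Two terms of the relation, of degrees i > j, have the same value, so x^(i-j) is a power of s
    times a unit. The denominator is thus at most the degree of P. *)
Lemma alg_has_val x (P : {poly {poly k}}) : x != 0 -> P != 0 -> poly2_eval P x = 0 ->
  exists (b : nat) (l : int), (0 < b < size P)%N /\ has_val x (l%:~R / b%:R).
Proof.
move=> x0 P0 EP.
pose c i : {poly k} := P`_i.
pose f (i : 'I_(size P)) := (map_poly kappa (c i)).[s] * x ^+ i.
have sf : \sum_i f i = 0.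
  rewrite -[RHS]EP /poly2_eval (horner_coef_wide _ (size_poly _ _)).
  by apply: eq_bigr => i _; rewrite coef_poly ltn_ord.
have f0 i : (f i != 0) = (c i != 0).
  rewrite /f mulf_eq0 expf_eq0 (negPf x0) andbF orbF.
  by have [->|ci] := eqVneq (c i) 0; [rewrite rmorph0 horner0 eqxx|rewrite s_transc].
have [|i [j [ij fi fj u]]] := sum0_max sf.
  have sP : (0 < size P)%N by rewrite size_poly_gt0.
  have lt : ((size P).-1 < size P)%N by rewrite prednK.
  by exists (Ordinal lt); rewrite f0 /c /= -lead_coefE lead_coef_eq0.
wlog : i j ij fi fj u / (j < i)%N => [H|lt].
  have [lt|lt|E] := ltngtP i j; last by rewrite (val_inj E) eqxx in ij.
    apply: (H j i) => //; first by rewrite eq_sym.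
    by have := runitV u; rewrite invfM invrK mulrC.
  exact: (H i j).
have [n [w uw Ew]] := poly_val (etrans (esym (f0 i)) fi).
have [n' [w' uw' Ew']] := poly_val (etrans (esym (f0 j)) fj).
exists (i - j)%N, (n'%:Z - n%:Z); split.
  by rewrite subn_gt0 lt /=; apply: leq_ltn_trans (leq_subr _ _) (ltn_ord i).
exists (i - j)%N, (n'%:Z - n%:Z); split => //.
  by rewrite subn_gt0.
have [w0 _ _] := uw; have [w'0 _ _] := uw'.
have -> : x ^+ (i - j) * s ^ (- (n'%:Z - n%:Z)) = (f i / f j) * (w' / w).
  rewrite /f Ew Ew' opprB expfzDr // -invr_expz -!exprnP expfB_cond ?(negPf x0) ?(ltnW lt) //.
  have := expf_neq0 n s0; have := expf_neq0 n' s0; have := expf_neq0 i x0; have := expf_neq0 j x0.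
  by move=> *; field; do ?[apply/andP; split].
by apply: runitM => //; apply: runitM => //; apply: runitV.
Qed.

(** Dividing the relation by s as long as possible and then setting s = 0 yields a nonzero Q over
    [k] with Q(x) in the maximal ideal. Since Q splits over [k], some factor x - c lies there. *)
Lemma residue x : alg_over x -> R x -> exists c, rmax (x - kappa c).
Proof.
move=> [P P0 EP] Rx.
have [P1 [P10 EP1 [i Hi]]] : exists P1 : {poly {poly k}},
    [/\ P1 != 0, poly2_eval P1 x = 0 & exists i, (P1`_i).[0] != 0].
  have [m] := ubnP (size (lead_coef P)); elim: m => // m IH in P P0 EP *.
  case: (boolp.EM (exists i, (P`_i).[0] != 0)) => [h|H]; first by exists P.
  have H' i : P`_i = drop_poly 1 P`_i * 'X.
    rewrite -[LHS](poly_take_drop 1) expr1; suff -> : take_poly 1 P`_i = 0 by rewrite add0r.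
    apply/polyP => -[|l]; rewrite coef_take_poly coef0 //=.
    by rewrite -horner_coef0; apply/eqP/negPn/negP => h; apply: H; exists i.
  pose P' := map_poly (drop_poly 1) P.
  have cP' i : P'`_i = drop_poly 1 P`_i by rewrite coef_map_id0 // drop_poly0r.
  have PE : P = 'X%:P * P' by apply/polyP => i; rewrite coefCM cP' mulrC -H'.
  have P'0 : P' != 0 by apply: contraNneq P0 => h; rewrite PE h mulr0.
  rewrite PE lead_coefM lead_coefC mulrC size_mulX ?lead_coef_eq0 // => lt.
  apply: (IH P') => //; apply: (mulfI s0); rewrite mulr0 -[RHS]EP PE /poly2_eval.
  by rewrite rmorphM /= map_polyC hornerM hornerC /= horner_evalE map_polyX hornerX.
pose Q : {poly k} := map_poly (horner_eval 0) P1.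
have Qi j : Q`_j = (P1`_j).[0] by rewrite coef_map.
have Q0 : Q != 0 by apply: contraNneq Hi => E; rewrite -Qi E coef0.
have mQ : rmax (map_poly kappa Q).[x].
  have -> : (map_poly kappa Q).[x] = - \sum_(j < size P1)
     ((map_poly kappa (P1`_j)).[s] - kappa ((P1`_j).[0])) * x ^+ j.
    rewrite (horner_coef_wide (n := size P1)); last first.
      by apply: leq_trans (size_poly _ _) _; apply: size_poly.
    apply/eqP; rewrite -addr_eq0 -big_split /= -[X in _ == X]EP1 /poly2_eval.
    rewrite (horner_coef_wide (n := size P1)) ?size_poly //; apply/eqP; apply: eq_bigr => j _.
    by rewrite coef_map Qi [in RHS]coef_map /= horner_evalE -mulrDl addrC subrK.
  apply: rmaxN; apply: rmax_sum => j _; rewrite mulrC; apply: rmaxM; first exact: RX.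
  set p := P1`_j.
  have /factor_theorem [q Eq] : root (p - p.[0]%:P) 0 by rewrite rootE !hornerE subrr.
  rewrite subr0 in Eq.
  have -> : (map_poly kappa p).[s] - kappa p.[0] = (map_poly kappa q).[s] * s.
    by rewrite -hornerMX -(map_polyX kappa) -rmorphM -Eq rmorphB /= map_polyC hornerD hornerN hornerC.
  apply: rmaxM; last exact: rmax_s.
  by apply: (ring_horner sR) => // l; rewrite coef_map; apply: RC.
have [rs Ers] := closed_field_poly_normal Q.
move: mQ; rewrite Ers map_polyZ hornerZ rmorph_prod horner_prod => mQ.
apply: boolp.contrapT => H; case: (unit_not_max _ mQ).
apply: runitM; first by apply: unit_kappa; rewrite lead_coef_eq0.
elim: rs {Ers mQ} => [|c rs IH]; first by rewrite big_nil; apply: runit1.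
rewrite big_cons; apply: runitM => //.
rewrite rmorphB /= map_polyX map_polyC hornerD hornerN hornerX hornerC.
case: (ring_unit_max (RB Rx (RC c))) => // h; by case: H; exists c.
Qed.
End Valuation.

(** [v] is meaningful on [hv] only, the elements with a rational value, which include the nonzero
    elements algebraic over k(s). The implication in the last clause covers an x equal to its
    residue. *)
Theorem exists_valuation (k : closedFieldType) (L : fieldType) (kappa : {rmorphism k -> L})
    (s : L) (s_transc : forall p : {poly k}, p != 0 -> (map_poly kappa p).[s] != 0) :
  exists (v : L -> rat) (hv : L -> Prop),
  [/\ forall x (P : {poly {poly k}}), x != 0 -> P != 0 -> poly2_eval kappa s P x = 0 ->
        hv x /\ exists (b : nat) (l : int), (0 < b < size P)%N /\ v x = l%:~R / b%:R,
      forall x y, hv x -> hv y -> hv (x * y) /\ v (x * y) = v x + v y,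
      forall x y, hv x -> hv y -> hv (x - y) -> Num.min (v x) (v y) <= v (x - y),
      (forall c, c != 0 -> hv (kappa c) /\ v (kappa c) = 0) /\ (hv s /\ v s = 1) &
      forall x, alg_over kappa s x -> hv x -> 0 <= v x ->
        exists c, hv (x - kappa c) -> 0 < v (x - kappa c)].
Proof.
have [R [sR mR]] := maximal_sub_ring s_transc.
have R1 := ring_1ps s_transc sR mR; have Rt := ring_total s_transc sR mR.
pose hv x := exists q, has_val s R x q.
have [v Hv] : exists v : L -> rat, forall x, hv x -> has_val s R x (v x).
  have H x : exists q, hv x -> has_val s R x q.
    by case: (boolp.EM (hv x)) => [[q hq]|n]; [exists q|exists 0 => h; case: n].
  by have [v Hv] := boolp.choice H; exists v.
have vE x q : has_val s R x q -> v x = q.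
  by move=> h; exact: (has_val_uniq s_transc sR (Hv _ (ex_intro _ q h)) h).
exists v, hv; split.
- move=> x P x0 P0 EP; have [b [l [lt h]]] := alg_has_val s_transc sR R1 Rt x0 P0 EP.
  by split; [exists (l%:~R / b%:R)|exists b, l; rewrite (vE _ _ h)].
- move=> x y hx hy; have h := has_valM s_transc sR (Hv _ hx) (Hv _ hy).
  by split; [exists (v x + v y)|apply: vE].
- move=> x y hx hy hxy.
  have Ny : has_val s R (- y) (v y).
    rewrite -[v y]add0r -mulN1r; apply: (has_valM s_transc sR); last exact: Hv.
    apply: has_val_unit; rewrite -(rmorph1 kappa) -rmorphN.
    by apply: (unit_kappa sR); rewrite oppr_eq0 oner_eq0.
  exact: (has_valD s_transc sR Rt) (Hv _ hx) Ny (Hv _ hxy).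
- split=> [c c0|].
    have h : has_val s R (kappa c) 0 by apply: has_val_unit; apply: (unit_kappa sR).
    by split; [exists 0|apply: vE].
  have h : has_val s R s 1 by apply: (has_val_s s_transc sR).
  by split; [exists 1|apply: vE].
move=> x Ax hx /(has_val_ge0 s_transc sR Rt (Hv _ hx)) Rx.
have [c mc] := residue s_transc sR Rt Ax Rx; exists c => h.
by apply/(has_val_gt0 s_transc sR Rt (Hv _ h)).
Qed.

(** * Function fields of curves: embeddings, norm, derivation *)

Section RatFun.
Variables (k K : fieldType) (iota : {rmorphism k -> K}) (t : K).
Hypothesis t_transc : forall p : {poly k}, p != 0 -> (map_poly iota p).[t] != 0.

Definition ratfun_pred : {pred K} := fun x => boolp.asbool (in_rat_fun iota t x).

Local Notation evt p := ((map_poly iota p).[t]).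

Lemma ratfun_divring : divring_closed ratfun_pred.
Proof.
split; first by apply/boolp.asboolP; exists 1, 1; rewrite oner_neq0 rmorph1 hornerC divr1.
  move=> x y /boolp.asboolP [p [q [q0 ->]]] /boolp.asboolP [p' [q' [q'0 ->]]].
  apply/boolp.asboolP; exists (p * q' - p' * q), (q * q'); split; first by rewrite mulf_neq0.
  rewrite rmorphB !rmorphM /= hornerD hornerN !hornerM.
  by field; rewrite !t_transc.
move=> x y /boolp.asboolP [p [q [q0 ->]]] /boolp.asboolP [p' [q' [q'0 ->]]].
apply/boolp.asboolP; have [->|p'0] := eqVneq p' 0.
  exists 0, 1; rewrite oner_neq0; split => //.
  by rewrite rmorph0 horner0 !mul0r invr0 mulr0.
exists (p * q'), (q * p'); split; first by rewrite mulf_neq0.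
by rewrite !rmorphM /= !hornerM; field; rewrite !t_transc.
Qed.
End RatFun.

Section RatFunType.
Variables (k K : fieldType) (iota : {rmorphism k -> K}) (t : K).
Hypothesis t_transc : forall p : {poly k}, p != 0 -> (map_poly iota p).[t] != 0.
Let S := ratfun_pred iota t.
HB.instance Definition _ := GRing.isDivringClosed.Build K S (ratfun_divring t_transc).
Record ratfun_type := RatFun { ratfun_val : K; ratfun_valP : ratfun_val \in S }.
HB.instance Definition _ := [isSub for ratfun_val].
HB.instance Definition _ := [Choice of ratfun_type by <:].
HB.instance Definition _ := [SubChoice_isSubComUnitRing of ratfun_type by <:].
HB.instance Definition _ := [SubComUnitRing_isSubIntegralDomain of ratfun_type by <:].
HB.instance Definition _ := [SubIntegralDomain_isSubField of ratfun_type by <:].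

Lemma ratfun_field : exists (F : fieldType) (f : {rmorphism F -> K}),
  (forall x, in_rat_fun iota t (f x)) /\ (forall y, in_rat_fun iota t y -> exists x, f x = y).
Proof.
exists ratfun_type, (val : ratfun_type -> K); split.
  by move=> x; apply/boolp.asboolP; exact: (ratfun_valP x).
by move=> y /boolp.asboolP Sy; exists (RatFun (Sy : y \in S)).
Qed.
End RatFunType.

(** * Primitive elements *)

Section PrimitiveElement.
Variables (F K : fieldType) (f : {rmorphism F -> K}).
Hypothesis charF : [pchar F] =i pred0.
Variables (n : nat) (e : 'I_n -> K).
Hypothesis span_e : forall y, exists c : 'I_n -> F, y = \sum_i f (c i) * e i.

Lemma spanned_alg y : exists p : {poly F}, [/\ p != 0, (size p <= n.+1)%N & root (map_poly f p) y].
Proof.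
have [c Hc] := boolp.choice (fun i : nat => span_e (y ^+ i)).
pose M : 'M[F]_(n.+1, n) := \matrix_(i, j) c i j.
have : kermx M != 0.
  rewrite -mxrank_eq0 mxrank_ker -lt0n subn_gt0 ltnS; exact: rank_leq_col.
case/rowV0Pn => v /sub_kermxP vM v0.
exists (\poly_(i < n.+1) (if insub i is Some o then v 0 o else 0)); split.
- apply: contraNneq v0 => E; apply/eqP/rowP => i.
  by have /polyP /(_ i) := E; rewrite coef_poly ltn_ord valK coef0 mxE.
- exact: size_poly.
rewrite rootE (horner_coef_wide (n := n.+1)); last first.
  by apply: leq_trans (size_poly _ _) _; apply: size_poly.
have -> : \sum_(i < n.+1) (map_poly f (\poly_(i < n.+1) (if insub i is Some o then v 0 o else 0)))`_i * y ^+ i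
  = \sum_(j < n) f ((v *m M) 0 j) * e j.
  under [RHS]eq_bigr => j _ do rewrite mxE rmorph_sum mulr_suml.
  rewrite exchange_big /=; apply: eq_bigr => i _.
  rewrite coef_map coef_poly ltn_ord valK Hc mulr_sumr; apply: eq_bigr => j _.
  by rewrite !mxE rmorphM mulrA.
by rewrite vM big1 // => j _; rewrite mxE rmorph0 mul0r.
Qed.

Lemma primitive_element_seq (s : seq K) :
  exists z, forall x, x \in s -> exists q : {poly F}, (map_poly f q).[z] = x.
Proof.
elim: s => [|x s [z IH]]; first by exists 0.
have [p [p0 _ px]] := spanned_alg x; have [q [q0 _ qz]] := spanned_alg z.
have [m /= [[rx Ex] [rz Ez]]] := pchar0_PET p0 px q0 qz charF.
exists (z *+ m - x) => y; rewrite inE => /orP [/eqP ->|/IH [r <-]].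
  by exists rx.
by exists (r \Po rz); rewrite map_comp_poly horner_comp Ez.
Qed.

Lemma primitive_element : exists z, forall x, exists q : {poly F}, (map_poly f q).[z] = x.
Proof.
have [z Hz] := primitive_element_seq (codom e); exists z => x.
have [c ->] := span_e x.
have [q Hq] := fin_all_exists (fun i => Hz (e i) (codom_f e i)).
exists (\sum_i c i *: q i); rewrite rmorph_sum horner_sum; apply: eq_bigr => i _.
by rewrite /= map_polyZ hornerZ Hq.
Qed.
End PrimitiveElement.

(** Denominators in k(t) are cleared throughout. The bound n on the degree in y is uniform, which
    later gives the values of every place a common denominator. *)
Lemma function_field_model (k : closedFieldType) (hchar : [pchar k] =i pred0)
  (K : fieldType) (iota : {rmorphism k -> K}) : function_field_of_curve iota ->
  exists (t z : K) (n : nat),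
  [/\ forall p : {poly k}, p != 0 -> (map_poly iota p).[t] != 0,
      forall y, exists (P : {poly {poly k}}) (c : {poly k}),
        c != 0 /\ y * (map_poly iota c).[t] = poly2_eval iota t P z &
      forall y, exists P : {poly {poly k}}, [/\ P != 0, (size P <= n.+1)%N & poly2_eval iota t P y = 0]].
Proof.
case=> t [t_tr [n [e He]]].
have [F [f [fF fS]]] := ratfun_field t_tr.
have charF : [pchar F] =i pred0.
  move=> p; rewrite -(fmorph_pchar f) (fmorph_pchar iota); exact: hchar.
have span_e y : exists c : 'I_n -> F, y = \sum_i f (c i) * e i.
  have [c [Hc ->]] := He y; have [c' Hc'] := fin_all_exists (fun i => fS _ (Hc i)).
  by exists c'; apply: eq_bigr => i _; rewrite Hc'.
have clear (q : {poly F}) : exists (P : {poly {poly k}}) (c : {poly k}),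
    [/\ c != 0, (size P <= size q)%N, (q != 0 -> P != 0) &
      forall y, (map_poly f q).[y] * (map_poly iota c).[t] = poly2_eval iota t P y].
  pose evt : {rmorphism {poly k} -> K} := horner_eval t \o map_poly iota.
  have [P [c [c0 H]]] : exists (P : {poly {poly k}}) (c : {poly k}), c != 0 /\
      forall i, f q`_i * evt c = evt P`_i.
    elim/poly_ind: q => [|q a [P [c [c0 H]]]].
      by exists 0, 1; rewrite oner_neq0; split => // i; rewrite !coef0 !rmorph0 mul0r.
    have [x [b [b0 Ea]]] := fF a.
    exists (b *: P * 'X + (x * c)%:P), (b * c); split; first by rewrite mulf_neq0.
    move=> [|i]; rewrite !coefD !coefMX !coefC /= ?addr0 ?add0r.
      by rewrite Ea !rmorphM /= !horner_evalE; field; rewrite t_tr.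
    by rewrite coefZ !rmorphM /= mulrCA H.
  have PE i : (size q <= i)%N -> P`_i = 0.
    move=> si; apply/eqP; apply/negP => /negP h; have := t_tr _ h.
    by have := H i; rewrite nth_default // rmorph0 mul0r /evt /= horner_evalE => <-; rewrite eqxx.
  exists P, c; split => //.
  - by apply/leq_sizeP.
  - apply: contraNneq => P0; rewrite -lead_coef_eq0 lead_coefE.
    have := H (size q).-1; rewrite P0 coef0 rmorph0 => /eqP.
    by rewrite mulf_eq0 fmorph_eq0 /evt /= horner_evalE (negPf (t_tr _ c0)) orbF.
  move=> y; rewrite /poly2_eval -/evt [(map_poly f q).[y]](horner_coef_wide (n := size q)) ?size_poly //.
  rewrite [RHS](horner_coef_wide (n := size q)); last first.
    by apply: leq_trans (size_poly _ _) _; apply/leq_sizeP.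
  rewrite mulr_suml; apply: eq_bigr => i _; rewrite !coef_map mulrAC; congr (_ * _).
  exact: H.
have [z Hz] := primitive_element charF span_e.
exists t, z, n; split => //.
  by move=> y; have [q <-] := Hz y; have [P [c [c0 _ _ E]]] := clear q; exists P, c.
move=> y; have [q [q0 sq /rootP qy]] := spanned_alg span_e y.
have [P [c [c0 sP P0 E]]] := clear q; exists P; split; first exact: P0.
  exact: leq_trans sP sq.
by rewrite -E qy mul0r.
Qed.

Fact ev2_key : unit. Proof. exact: tt. Qed.
Definition ev2 (k L : fieldType) (kappa : {rmorphism k -> L}) (s x : L) : {rmorphism {poly {poly k}} -> L} :=
  locked_with ev2_key (horner_eval x \o map_poly (horner_eval s \o map_poly kappa) : {rmorphism _ -> _}).

Section Ev2.
Variables (k L : fieldType) (kappa : {rmorphism k -> L}) (s x : L).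
Lemma ev2_horner P : ev2 kappa s x P = (map_poly (horner_eval s \o map_poly kappa) P).[x].
Proof. by rewrite /ev2 unlock. Qed.
Lemma ev2C c : ev2 kappa s x c%:P = (map_poly kappa c).[s].
Proof. by rewrite ev2_horner map_polyC hornerC. Qed.
Lemma ev2X : ev2 kappa s x 'X = x.
Proof. by rewrite ev2_horner map_polyX hornerX. Qed.
Lemma ev2E (P : {poly {poly k}}) n : (size P <= n)%N ->
  ev2 kappa s x P = \sum_(i < n) (map_poly kappa P`_i).[s] * x ^+ i.
Proof.
move=> sP; rewrite ev2_horner (horner_coef_wide (n := n)); last first.
  by apply: leq_trans (size_poly _ _) _.
by apply: eq_bigr => i _; rewrite coef_map.
Qed.
End Ev2.

(** * K as k(t)(z): relations, embeddings into L, norm and derivation *)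

Section Model.
Variables (k : closedFieldType) (hchar : [pchar k] =i pred0).
Variables (K : fieldType) (iota : {rmorphism k -> K}) (t z : K).
Hypothesis t_tr : forall p : {poly k}, p != 0 -> (map_poly iota p).[t] != 0.
Hypothesis rep : forall y, exists (P : {poly {poly k}}) (c : {poly k}),
  c != 0 /\ y * (map_poly iota c).[t] = ev2 iota t z P.
Hypothesis z_alg : exists2 P : {poly {poly k}}, P != 0 & ev2 iota t z P = 0.

Local Notation ev := (ev2 iota t z).
Local Notation evt c := ((map_poly iota c).[t]).

Lemma minimal_relation : exists H : {poly {poly k}}, [/\ H != 0, ev H = 0 &
  forall P, P != 0 -> ev P = 0 -> (size H <= size P)%N].
Proof.
have [P P0 EP] := z_alg.
have [m] := ubnP (size P); elim: m => // m IH in P P0 EP *.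
move=> sP; case: (boolp.EM (exists Q : {poly {poly k}}, [/\ Q != 0, ev Q = 0 & (size Q < size P)%N])).
  by case=> Q [Q0 EQ sQ]; apply: (IH Q) => //; apply: leq_trans sQ _.
move=> nQ; exists P; split => // Q Q0 EQ; rewrite leqNgt; apply/negP => sQ.
by apply: nQ; exists Q.
Qed.

Variable H : {poly {poly k}}.
Hypotheses (H0 : H != 0) (EH : ev H = 0)
  (minH : forall P, P != 0 -> ev P = 0 -> (size H <= size P)%N).

Let N := (size H).-1.

Lemma char0_poly (R : idomainType) (p : {poly R}) : [pchar R] =i pred0 -> p^`() = 0 -> (size p <= 1)%N.
Proof.
move=> /pcharf0P cR dp; apply/leq_sizeP => -[//|i] _.
have := coef_deriv p i; rewrite dp coef0 => /esym /eqP.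
by rewrite -mulr_natr mulf_eq0 cR orbF => /eqP.
Qed.

Lemma size_H_gt1 : (1 < size H)%N.
Proof.
rewrite ltnNge; apply/negP => sH; have := EH; rewrite (size1_polyC sH) ev2C => /eqP.
by apply/negP; apply: t_tr; apply: contraNneq H0 => E; rewrite (size1_polyC sH) E.
Qed.
Lemma size_H : size H = N.+1. Proof. by rewrite /N prednK // ltnW // size_H_gt1. Qed.

Lemma ev_small (P : {poly {poly k}}) : P != 0 -> (size P <= N)%N -> ev P != 0.
Proof.
move=> P0 sP; apply/eqP => /(minH P0); rewrite size_H leqNgt ltnS; by rewrite sP.
Qed.

Lemma pseudo_div (P : {poly {poly k}}) : exists (Q R : {poly {poly k}}) (c : {poly k}), [/\ c != 0, c%:P * P = Q * H + R & (size R <= N)%N].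
Proof.
exists (Pdiv.Idomain.divp P H), (Pdiv.Idomain.modp P H), (lead_coef H ^+ (Pdiv.Idomain.scalp P H)).
split; first by rewrite expf_neq0 // lead_coef_eq0.
  by rewrite mul_polyC Pdiv.Idomain.divp_eq.
by rewrite -ltnS -size_H Pdiv.Idomain.ltn_modp.
Qed.

(** The remainder of the pseudo-division by H vanishes at (t, z) and is too short to be nonzero. The
    factor c comes from pseudo-division over k[t]. *)
Lemma ev_kernel P : ev P = 0 -> exists (Q : {poly {poly k}}) (c : {poly k}), c != 0 /\ c%:P * P = Q * H.
Proof.
move=> EP; have [Q [R [c [c0 E sR]]]] := pseudo_div P; exists Q, c; split => //.
have [R0|R0] := eqVneq R 0; first by rewrite E R0 addr0.
have := ev_small R0 sR; have := congr1 ev E.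
by rewrite rmorphD !rmorphM /= EH EP !mulr0 add0r => <-; rewrite eqxx.
Qed.

Lemma ev_dH : ev H^`() != 0.
Proof.
have cP : [pchar {poly k}] =i pred0 by move=> p; rewrite pchar_poly; apply: hchar.
apply: ev_small.
  apply/eqP => /(char0_poly cP); by rewrite leqNgt size_H_gt1.
by rewrite -ltnS -size_H; apply: lt_size_deriv.
Qed.

Lemma bezout_H P : ev P != 0 -> exists (A B : {poly {poly k}}) (c : {poly k}), c != 0 /\ A * H + B * P = c%:P.
Proof.
move=> P0; have [B [c [c0 E]]] := rep (ev P)^-1.
have : ev (B * P - c%:P) = 0.
  by rewrite rmorphB rmorphM /= -E ev2C mulrAC mulVf // mul1r subrr.
move/ev_kernel => [Q [c' [c'0 E']]]; exists (- Q), (c'%:P * B), (c' * c).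
split; first by rewrite mulf_neq0.
by rewrite mulNr -E' polyCM; ring.
Qed.

Section Embeddings.
Variables (L : closedFieldType) (j : {rmorphism K -> L}).
Local Notation kap := (j \o iota : {rmorphism k -> L}).
Local Notation evL x := (ev2 kap (j t) x).

Lemma evt_L c : j (evt c) = (map_poly kap c).[j t].
Proof. by rewrite map_poly_comp horner_map. Qed.

Lemma tL_tr (p : {poly k}) : p != 0 -> (map_poly kap p).[j t] != 0.
Proof. by move=> p0; rewrite -evt_L fmorph_eq0 t_tr. Qed.

(** The Bezout relation between H and its derivative survives the substitution of [j t] for t, so
    the N roots in [L] are distinct. *)
Lemma roots_H : exists zz : 'I_N -> L, injective zz /\ forall i, evL (zz i) H = 0.
Proof.
pose red : {rmorphism {poly k} -> L} := horner_eval (j t) \o map_poly kap.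
pose HL := map_poly red H.
have sHL : size HL = N.+1.
  by rewrite -size_H size_poly_eq // /= horner_evalE tL_tr // lead_coef_eq0.
have HL0 : HL != 0 by rewrite -size_poly_eq0 sHL.
have [rs Ers] := closed_field_poly_normal HL.
have srs : size rs = N.
  by have := sHL; rewrite Ers size_scale ?lead_coef_eq0 // size_prod_XsubC => -[].
have urs : uniq rs.
  rewrite -(separable_prod_XsubC rs) unlock.
  have [A [B [c [c0 E]]]] := bezout_H ev_dH.
  have : coprimep HL HL^`().
    apply/Bezout_coprimepP; exists (map_poly red A, map_poly red B).
    rewrite /= /HL deriv_map -!rmorphM -rmorphD /= E map_polyC /=.
    by rewrite polyC_eqp1 /= horner_evalE tL_tr.
  rewrite Ers derivZ coprimepZl ?lead_coef_eq0 // coprimepZr ?lead_coef_eq0 //.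
exists (fun i => nth 0 rs i); split.
  move=> i i' /eqP; rewrite nth_uniq ?srs ?ltn_ord // => /eqP; exact: val_inj.
move=> i; rewrite ev2_horner; apply/rootP.
rewrite -[X in root X _]/HL Ers rootZ ?lead_coef_eq0 // root_prod_XsubC.
by rewrite mem_nth // srs.
Qed.

(** Evaluation at ([j t], x) kills all relations satisfied by (t, z), so it factors through K. The
    image of y is read off from any presentation y = P(t, z) / c(t). *)
Lemma embed x : evL x H = 0 -> exists s : {rmorphism K -> L},
  [/\ forall c, s (iota c) = kap c, s t = j t & s z = x].
Proof.
move=> Ex.
have kerL P : ev P = 0 -> evL x P = 0.
  move=> /ev_kernel [Q [c [c0 E]]]; have := congr1 (evL x) E.
  rewrite !rmorphM /= Ex mulr0 ev2C => /eqP; rewrite mulf_eq0 (negPf (tL_tr c0)).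
  by move/eqP.
have Ex_s (y : K) : exists w : L, forall P (c : {poly k}), c != 0 -> y * evt c = ev P ->
    w * (map_poly kap c).[j t] = evL x P.
  have [P [c [c0 E]]] := rep y.
  exists (evL x P / (map_poly kap c).[j t]) => P' c' c'0 E'.
  have : ev (c'%:P * P - c%:P * P') = 0.
    by rewrite rmorphB !rmorphM /= !ev2C -E -E'; ring.
  move/kerL; rewrite rmorphB !rmorphM /= !ev2C => /eqP; rewrite subr_eq0 => /eqP E2.
  by rewrite mulrAC [evL x P * _]mulrC E2 mulrAC mulfV ?mul1r // tL_tr.
have [s Hs] := boolp.choice Ex_s.
have sP P : s (ev P) = evL x P.
  by have := Hs (ev P) P 1 (oner_neq0 _); rewrite !rmorph1 !hornerC !mulr1; apply.
have sB : zmod_morphism s.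
  move=> y y'; have [P [c [c0 E]]] := rep y; have [P' [c' [c'0 E']]] := rep y'.
  have h := tL_tr c0; have h' := tL_tr c'0.
  have cc0 : c * c' != 0 by rewrite mulf_neq0.
  have Es : (y - y') * evt (c * c') = ev (c'%:P * P - c%:P * P').
    by rewrite rmorphB !rmorphM /= hornerM !ev2C -E -E'; ring.
  apply: (mulIf (tL_tr cc0)); rewrite (Hs _ _ _ cc0 Es) rmorphM /= hornerM.
  by rewrite rmorphB !rmorphM /= !ev2C -(Hs _ _ _ c0 E) -(Hs _ _ _ c'0 E'); ring.
have sM : monoid_morphism s.
  split; first by rewrite -(rmorph1 ev) sP rmorph1.
  move=> y y'; have [P [c [c0 E]]] := rep y; have [P' [c' [c'0 E']]] := rep y'.
  have cc0 : c * c' != 0 by rewrite mulf_neq0.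
  have Es : (y * y') * evt (c * c') = ev (P * P').
    by rewrite !rmorphM /= hornerM -E -E'; ring.
  apply: (mulIf (tL_tr cc0)); rewrite (Hs _ _ _ cc0 Es) !rmorphM /= hornerM.
  by rewrite -(Hs _ _ _ c0 E) -(Hs _ _ _ c'0 E'); ring.
pose sr : {rmorphism K -> L} := HB.pack s (GRing.isZmodMorphism.Build _ _ s sB)
  (GRing.isMonoidMorphism.Build _ _ s sM).
exists sr; split => /=.
- by move=> c; have := sP c%:P%:P; rewrite !ev2C !map_polyC !hornerC.
- by have := sP ('X)%:P; rewrite !ev2C !map_polyX !hornerX.
- by have := sP 'X; rewrite !ev2X.
Qed.

Lemma embeddings : exists s : 'I_N -> {rmorphism K -> L},
  [/\ forall i c, s i (iota c) = kap c, forall i, s i t = j t & injective (fun i => s i z)].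
Proof.
have [zz [izz rzz]] := roots_H.
have [s Hs] := fin_all_exists (fun i => embed (rzz i)).
exists s; split.
- by move=> i c; have [] := Hs i.
- by move=> i; have [] := Hs i.
by move=> i i'; have [_ _ ->] := Hs i; have [_ _ ->] := Hs i'; apply: izz.
Qed.

(** The product of the conjugates is the determinant of multiplication by y on 1, z, ..., z^(N-1),
    whose matrix has entries in k(t). *)
Lemma norm_ratfun (s : 'I_N -> {rmorphism K -> L})
  (sc : forall i c, s i (iota c) = kap c) (st : forall i, s i t = j t)
  (sz : injective (fun i => s i z)) y : y != 0 ->
  exists a b : {poly k}, [/\ a != 0, b != 0 &
    (\prod_i s i y) * (map_poly kap b).[j t] = (map_poly kap a).[j t]].
Proof.
move=> y0.
have sev i P : s i (ev P) = evL (s i z) P.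
  rewrite !(ev2E _ _ _ (leqnn _)) rmorph_sum; apply: eq_bigr => l _.
  rewrite rmorphM rmorphXn -horner_map st -map_poly_comp /=; congr (_.[_] * _).
  by apply: eq_map_poly => c /=; rewrite sc.
have red w : exists (R : {poly {poly k}}) (c : {poly k}), [/\ c != 0, (size R <= N)%N & w * evt c = ev R].
  have [P [c [c0 E]]] := rep w; have [Q [R [c' [c'0 E' sR]]]] := pseudo_div P.
  exists R, (c' * c); rewrite mulf_neq0 //; split => //.
  have := congr1 ev E'; rewrite rmorphD !rmorphM /= EH mulr0 add0r => <-.
  by rewrite ev2C -E hornerM; ring.
have [R HR] := fin_all_exists (fun l : 'I_N => red (y * z ^+ l)).
have [c Hc] := fin_all_exists HR.
pose C := \prod_l c l.
have C0 : C != 0 by apply/prodf_neq0 => l _; have [] := Hc l.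
pose R' (l : 'I_N) : {poly {poly k}} := (\prod_(l' | l' != l) c l')%:P * R l.
have HC (l : 'I_N) : y * z ^+ l * evt C = ev (R' l).
  have [_ _ E] := Hc l; rewrite /C (bigD1 l) //= rmorphM hornerM mulrA E.
  by rewrite /R' rmorphM /= ev2C mulrC.
have sR' (l : 'I_N) : (size (R' l) <= N)%N.
  have [_ sR _] := Hc l; rewrite /R' mul_polyC; apply: leq_trans (size_scale_leq _ _) sR.
pose M : 'M[{poly k}]_N := \matrix_(l, m) (R' l)`_m.
pose red' : {rmorphism {poly k} -> L} := horner_eval (j t) \o map_poly kap.
pose V : 'M[L]_N := \matrix_(m, i) s i z ^+ m.
(* Up to the common denominator C, the powers of a conjugate of z form an eigenvector of
   multiplication by y, with the conjugate of y as eigenvalue; V is a Vandermonde matrix. *)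
have E : map_mx red' M *m V = V *m diag_mx (\row_i (red' C * s i y)).
  apply/matrixP => l i; rewrite mul_mx_diag !mxE.
  transitivity (s i (ev (R' l))).
    by rewrite sev (ev2E _ _ _ (sR' l)); apply: eq_bigr => m _; rewrite !mxE.
  rewrite -HC !rmorphM rmorphXn /= horner_evalE -horner_map st -map_poly_comp /=.
  rewrite (eq_map_poly (g := kap)) => [|x]; last by rewrite /= sc.
  by rewrite mulrAC mulrC [_ * s i y]mulrC mulrA mulrC.
have V0 : \det V != 0.
  have -> : V = Vandermonde N (\row_i s i z) by apply/matrixP => l i; rewrite !mxE.
  rewrite det_Vandermonde; apply/prodf_neq0 => i _; apply/prodf_neq0 => i' lt.
  rewrite !mxE subr_eq0; apply: contraTneq lt => /sz ->; by rewrite ltnn.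
have := congr1 determinant E; rewrite !det_mulmx det_map_mx mulrC => /(mulfI V0).
rewrite det_diag; under eq_bigr => i _ do rewrite mxE.
rewrite big_split prodr_const card_ord => Ed.
have b0 : C ^+ N != 0 by rewrite expf_neq0.
exists (\det M), (C ^+ N); split => //; last first.
  by rewrite -[RHS]/(red' _) Ed rmorphXn horner_exp mulrC.
apply/eqP => M0; move/eqP: Ed; rewrite M0 rmorph0 eq_sym mulf_eq0 expf_eq0.
rewrite /= horner_evalE (negPf (tL_tr C0)) andbF /=; apply/negP; apply/prodf_neq0 => i _.
by rewrite fmorph_eq0.
Qed.

End Embeddings.

(** * The derivation of K extending d/dt *)

Section Derivation.
(** Implicit differentiation of H(t, z) = 0 forces this value of Dz; [delta] is the resulting
    derivative of P(t, z). *)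
Let zeta := - ev (map_poly deriv H) / ev H^`().
Let delta P := ev (map_poly deriv P) + ev P^`() * zeta.

Let dX_add : {morph map_poly (@deriv k) : P Q / P + Q}.
Proof. by move=> P Q; apply/polyP => i; rewrite coefD !coef_map_id0 ?deriv0 // coefD derivD. Qed.
Let dX_M P Q : map_poly (@deriv k) (P * Q) = map_poly (@deriv k) P * Q + P * map_poly (@deriv k) Q.
Proof.
apply/polyP => i; rewrite coefD !coef_map_id0 ?deriv0 // !coefM.
rewrite (raddf_sum (@deriv k)) -big_split; apply: eq_bigr => l _ /=.
by rewrite derivM !coef_map_id0 ?deriv0.
Qed.

Let deltaD P Q : delta (P + Q) = delta P + delta Q.
Proof. by rewrite /delta dX_add derivD !rmorphD /=; ring. Qed.
Let deltaM P Q : delta (P * Q) = delta P * ev Q + ev P * delta Q.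
Proof. by rewrite /delta dX_M derivM !rmorphD !rmorphM /=; ring. Qed.
Let deltaC c : delta c%:P = evt c^`().
Proof.
rewrite /delta derivC rmorph0 mul0r addr0.
have -> : map_poly deriv c%:P = (c^`())%:P.
  by apply/polyP => i; rewrite coef_map_id0 ?deriv0 // !coefC; case: ifP; rewrite ?deriv0.
by rewrite ev2C.
Qed.
Let delta_kernel P : ev P = 0 -> delta P = 0.
Proof.
move=> EP; have [Q [c [c0 E]]] := ev_kernel EP.
have dH : delta H = 0 by rewrite /delta /zeta mulrC divfK ?ev_dH // subrr.
have := congr1 delta E; rewrite !deltaM EP EH dH !mulr0 !add0r ev2C => /eqP.
by rewrite mulf_eq0 (negPf (t_tr c0)) => /eqP.
Qed.

(** [delta] vanishes on H, hence on all relations, so it descends to K; the quotient rule prescribes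
    D on P(t, z) / c(t). *)
Lemma derivation_exists : exists D : K -> K,
  [/\ forall x y, D (x + y) = D x + D y, forall x y, D (x * y) = D x * y + x * D y,
     forall c, D (iota c) = 0 & D t = 1].
Proof.
have Ex_D (y : K) : exists w : K, forall P (c : {poly k}), c != 0 -> y * evt c = ev P ->
    w * evt c = delta P - y * evt c^`().
  have [P [c [c0 E]]] := rep y.
  exists ((delta P - y * evt c^`()) / evt c) => P' c' c'0 E'.
  have : ev (c'%:P * P - c%:P * P') = 0.
    by rewrite rmorphB !rmorphM /= !ev2C -E -E'; ring.
  rewrite -mulNr -polyCN; move/delta_kernel; rewrite deltaD !deltaM !deltaC !ev2C -E -E' derivN !rmorphN !hornerN /= => E2.
  have h := t_tr c0; have h' := t_tr c'0.
  apply: (mulfI h); rewrite mulrA [evt c * _]mulrC divfK //.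
  by apply/eqP; rewrite -subr_eq0; apply/eqP; rewrite -[RHS]E2; ring.
have [D HD] := boolp.choice Ex_D.
have DP P : D (ev P) = delta P.
  have := HD (ev P) P 1 (oner_neq0 _).
  by rewrite derivC !rmorph1 rmorph0 horner0 !hornerC !mulr1 mulr0 subr0; apply.
exists D; split.
- move=> y y'; have [P [c [c0 E]]] := rep y; have [P' [c' [c'0 E']]] := rep y'.
  have cc0 : c * c' != 0 by rewrite mulf_neq0.
  have Es : (y + y') * evt (c * c') = ev (c'%:P * P + c%:P * P').
    by rewrite rmorphD !rmorphM /= hornerM !ev2C -E -E'; ring.
  apply: (mulIf (t_tr cc0)); rewrite (HD _ _ _ cc0 Es) deltaD !deltaM !deltaC !ev2C.
  have := HD _ _ _ c0 E; have := HD _ _ _ c'0 E' => e1 e2.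
  have -> : delta P = D y * evt c + y * evt c^`() by rewrite e2 subrK.
  have -> : delta P' = D y' * evt c' + y' * evt c'^`() by rewrite e1 subrK.
  by rewrite -E -E' derivM rmorphD !rmorphM /= hornerD !hornerM; ring.
- move=> y y'; have [P [c [c0 E]]] := rep y; have [P' [c' [c'0 E']]] := rep y'.
  have cc0 : c * c' != 0 by rewrite mulf_neq0.
  have Es : (y * y') * evt (c * c') = ev (P * P').
    by rewrite !rmorphM /= hornerM -E -E'; ring.
  apply: (mulIf (t_tr cc0)); rewrite (HD _ _ _ cc0 Es) deltaM.
  have := HD _ _ _ c0 E; have := HD _ _ _ c'0 E' => e1 e2.
  have -> : delta P = D y * evt c + y * evt c^`() by rewrite e2 subrK.
  have -> : delta P' = D y' * evt c' + y' * evt c'^`() by rewrite e1 subrK.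
  by rewrite -E -E' derivM rmorphD !rmorphM /= hornerD !hornerM; ring.
- by move=> c; have := DP c%:P%:P; rewrite ev2C map_polyC hornerC deltaC derivC rmorph0 horner0.
- by have := DP ('X)%:P; rewrite ev2C map_polyX hornerX deltaC derivX rmorph1 hornerC.
Qed.
End Derivation.
End Model.

(** * Places and derivations *)

Section Derivations.
Variables (K : fieldType) (D : K -> K).
Hypotheses (DD : forall x y, D (x + y) = D x + D y)
  (DM : forall x y, D (x * y) = D x * y + x * D y).

Lemma D0 : D 0 = 0.
Proof. by apply: (addIr (D 0)); rewrite -DD !add0r. Qed.
Lemma D1 : D 1 = 0.
Proof. by apply: (addIr (D 1)); rewrite add0r -[in RHS](mulr1 1) DM mulr1 mul1r. Qed.
Lemma DN x : D (- x) = - D x.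
Proof. by apply: (addIr (D x)); rewrite -DD !addNr D0. Qed.
Lemma DB x y : D (x - y) = D x - D y. Proof. by rewrite DD DN. Qed.
Lemma D_sum I (r : seq I) (P : pred I) (F : I -> K) :
  D (\sum_(i <- r | P i) F i) = \sum_(i <- r | P i) D (F i).
Proof. by elim/big_rec2: _ => [|i y1 y2 _ <-]; rewrite ?D0 ?DD. Qed.
Lemma DXn x n : D (x ^+ n) = n%:R * x ^+ n.-1 * D x.
Proof.
elim: n => [|n IH]; first by rewrite expr0 D1 !mul0r.
rewrite exprS DM IH; case: n {IH} => [|n]; first by rewrite /= !expr0; ring.
by rewrite /= -[n.+2%:R]natr1 exprS; ring.
Qed.
Lemma DV x : x != 0 -> D x^-1 = - D x / x ^+ 2.
Proof.
move=> x0; have := DM x x^-1; rewrite mulfV // D1 => /esym /eqP.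
rewrite addrC addr_eq0 => /eqP E.
by apply: (mulfI x0); rewrite E; field.
Qed.
Lemma D_div x y : y != 0 -> D (x / y) = (D x * y - x * D y) / y ^+ 2.
Proof. by move=> y0; rewrite DM DV //; field. Qed.
Lemma D_horner (p : {poly K}) x : D p.[x] = (map_poly D p).[x] + p^`().[x] * D x.
Proof.
elim/poly_ind: p => [|p c IH].
  by rewrite horner0 D0 deriv0 horner0 mul0r addr0 map_poly0 horner0.
have -> : map_poly D (p * 'X + c%:P) = map_poly D p * 'X + (D c)%:P.
  apply/polyP => i; rewrite coef_map_id0 ?D0 // !coefD !coefMX !coefC.
  by case: i => [|i] /=; rewrite ?add0r ?addr0 // coef_map_id0 ?D0.
rewrite derivMXaddC !hornerE DD DM IH; ring.
Qed.
Lemma D_exprz x (l : int) : x != 0 -> D (x ^ l) = l%:~R * x ^ l * (D x / x).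
Proof.
move=> x0; have nat n : D (x ^+ n) = n%:R * x ^+ n * (D x / x).
  rewrite DXn; case: n => [|n]; first by rewrite !mul0r.
  by rewrite /= exprSr; field.
case: l => n; first by rewrite -!exprnP nat.
rewrite NegzE -exprnN DV ?expf_neq0 // nat rmorphN /=.
field; by rewrite x0 expf_neq0.
Qed.
End Derivations.

(** A valuation trivial on [k], with residue field [k]. Values are rational and not normalized. The
    value at 0 is arbitrary; [vge] and [vgt] below treat it as infinite. *)
Record is_place (k K : fieldType) (iota : {rmorphism k -> K}) (v : K -> rat) : Prop := IsPlace {
  placeM : forall x y, x != 0 -> y != 0 -> v (x * y) = v x + v y;
  placeB : forall x y, x != 0 -> y != 0 -> x - y != 0 -> Num.min (v x) (v y) <= v (x - y);
  placeC : forall c, c != 0 -> v (iota c) = 0;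
  place_res : forall x, x != 0 -> 0 <= v x -> exists c, x = iota c \/ 0 < v (x - iota c)
}.

Definition vge (K : fieldType) (v : K -> rat) (q : rat) (x : K) := (x == 0) || (q <= v x).
Definition vgt (K : fieldType) (v : K -> rat) (x : K) := (x == 0) || (0 < v x).

Section Place.
Variables (k K : fieldType) (iota : {rmorphism k -> K}) (v : K -> rat).
Hypothesis pv : is_place iota v.

Lemma place1 : v 1 = 0.
Proof. by rewrite -(rmorph1 iota) (placeC pv) ?oner_eq0. Qed.
Lemma placeN x : v (- x) = v x.
Proof.
have [->|x0] := eqVneq x 0; first by rewrite oppr0.
rewrite -mulN1r (placeM pv) ?oppr_eq0 ?oner_eq0 // -(rmorph1 iota) -rmorphN (placeC pv) ?add0r //.
by rewrite oppr_eq0 oner_eq0.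
Qed.
Lemma placeV x : x != 0 -> v x^-1 = - v x.
Proof.
move=> x0; apply/eqP; rewrite -addr_eq0 addrC -(placeM pv) ?invr_eq0 // mulfV //.
by rewrite place1.
Qed.
Lemma place_div x y : x != 0 -> y != 0 -> v (x / y) = v x - v y.
Proof. by move=> x0 y0; rewrite (placeM pv) ?invr_eq0 // placeV. Qed.
Lemma placeX x n : x != 0 -> v (x ^+ n) = n%:R * v x.
Proof.
move=> x0; elim: n => [|n IH]; first by rewrite expr0 place1 mul0r.
by rewrite exprS (placeM pv) ?expf_neq0 // IH -natr1; ring.
Qed.
Lemma place_exprz x (l : int) : x != 0 -> v (x ^ l) = l%:~R * v x.
Proof.
move=> x0; case: l => n; first by rewrite -exprnP placeX.
by rewrite NegzE -exprnN placeV ?expf_neq0 // placeX // rmorphN mulNr.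
Qed.
Lemma place_prod (I : eqType) (r : seq I) (F : I -> K) : (forall i, i \in r -> F i != 0) ->
  v (\prod_(i <- r) F i) = \sum_(i <- r) v (F i).
Proof.
elim: r => [|i r IH] h; first by rewrite !big_nil place1.
have h' l : l \in r -> F l != 0 by move=> lr; apply: h; rewrite inE lr orbT.
rewrite !big_cons (placeM pv) ?IH ?h ?mem_head //.
by rewrite prodf_seq_neq0; apply/allP => l /h'.
Qed.

Lemma vge_0 q : vge v q 0. Proof. by rewrite /vge eqxx. Qed.
Lemma vge_refl x : vge v (v x) x. Proof. by rewrite /vge lexx orbT. Qed.
Lemma vge_le q q' x : q' <= q -> vge v q x -> vge v q' x.
Proof. by move=> le /orP [/eqP -> |h]; rewrite ?vge_0 // /vge (le_trans le h) orbT. Qed.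
Lemma vge_nz q x : x != 0 -> vge v q x -> q <= v x.
Proof. by rewrite /vge => /negPf ->. Qed.
Lemma vgeN q x : vge v q (- x) = vge v q x.
Proof. by rewrite /vge oppr_eq0 placeN. Qed.
Lemma vgeB q x y : vge v q x -> vge v q y -> vge v q (x - y).
Proof.
have [->|x0] := eqVneq x 0; first by rewrite sub0r vgeN.
have [->|y0] := eqVneq y 0; first by rewrite subr0.
rewrite /vge (negPf x0) (negPf y0) /= => h1 h2.
case: eqP => //= /eqP xy0; apply: le_trans (placeB pv x0 y0 xy0).
by rewrite le_min h1.
Qed.
Lemma vgeD q x y : vge v q x -> vge v q y -> vge v q (x + y).
Proof. by move=> h1 h2; rewrite -[y]opprK; apply: vgeB => //; rewrite vgeN. Qed.
Lemma vge_sum q I (r : seq I) (P : pred I) (F : I -> K) :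
  (forall i, P i -> vge v q (F i)) -> vge v q (\sum_(i <- r | P i) F i).
Proof. by move=> h; elim/big_ind: _ => //; [apply: vge_0|move=> *; apply: vgeD]. Qed.
Lemma vgeM q q' x y : vge v q x -> vge v q' y -> vge v (q + q') (x * y).
Proof.
have [->|x0] := eqVneq x 0; first by move=> _ _; rewrite mul0r vge_0.
have [->|y0] := eqVneq y 0; first by move=> _ _; rewrite mulr0 vge_0.
rewrite /vge (negPf x0) (negPf y0) mulf_eq0 (negPf x0) (negPf y0) /= (placeM pv) //.
exact: lerD.
Qed.
Lemma vge0M x y : vge v 0 x -> vge v 0 y -> vge v 0 (x * y).
Proof. by move=> h1 h2; have := vgeM h1 h2; rewrite addr0. Qed.
Lemma vge_iota c : vge v 0 (iota c).
Proof. by rewrite /vge fmorph_eq0; case: eqP => //= /eqP /(placeC pv) ->. Qed.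
Lemma vge0X x n : vge v 0 x -> vge v 0 (x ^+ n).
Proof.
move=> h; elim: n => [|n IH]; last by rewrite exprS vge0M.
by rewrite expr0 -(rmorph1 iota) vge_iota.
Qed.
Lemma vge_horner q (p : {poly K}) x : (forall i, vge v q p`_i) -> vge v 0 x -> vge v q p.[x].
Proof.
move=> hp hx; rewrite horner_coef; apply: vge_sum => i _.
by have := vgeM (hp i) (vge0X i hx); rewrite addr0.
Qed.

Lemma vgt_ge x : vgt v x -> vge v 0 x.
Proof. by case/orP => [/eqP ->|/ltW h]; rewrite /vge ?eqxx // h orbT. Qed.
Lemma vgtB x y : vgt v x -> vgt v y -> vgt v (x - y).
Proof.
have [->|x0] := eqVneq x 0; first by rewrite sub0r /vgt oppr_eq0 placeN.
have [->|y0] := eqVneq y 0; first by rewrite subr0.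
rewrite /vgt (negPf x0) (negPf y0) /= => h1 h2.
case: eqP => //= /eqP xy0; apply: lt_le_trans (placeB pv x0 y0 xy0).
by rewrite lt_min h1.
Qed.
Lemma vgtN x : vgt v (- x) = vgt v x. Proof. by rewrite /vgt oppr_eq0 placeN. Qed.
Lemma vgtD x y : vgt v x -> vgt v y -> vgt v (x + y).
Proof. by move=> h1 h2; rewrite -[y]opprK; apply: vgtB => //; rewrite vgtN. Qed.
Lemma vgtMr x y : vge v 0 x -> vgt v y -> vgt v (x * y).
Proof.
have [->|x0] := eqVneq x 0; first by rewrite mul0r /vgt eqxx.
have [->|y0] := eqVneq y 0; first by rewrite mulr0 /vgt eqxx.
rewrite /vge /vgt (negPf x0) (negPf y0) mulf_eq0 (negPf x0) (negPf y0) /= (placeM pv) // => h1 h2.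
by rewrite ltr_wpDl.
Qed.
Lemma unit_sub_max x y : x != 0 -> v x = 0 -> vgt v y -> x - y != 0 /\ v (x - y) = 0.
Proof.
move=> x0 vx my.
have xy0 : x - y != 0.
  by rewrite subr_eq0; apply: contraTneq my => <-; rewrite /vgt (negPf x0) vx ltxx.
split => //.
have h1 : vge v 0 (x - y) by apply: vgeB; [rewrite -vx vge_refl|apply: vgt_ge].
have := vge_nz xy0 h1; rewrite le_eqVlt => /orP [/eqP //|h2].
have : vgt v ((x - y) + y) by apply: vgtD => //; rewrite /vgt h2 orbT.
by rewrite subrK /vgt (negPf x0) vx ltxx.
Qed.
Lemma vgt_res x : vge v 0 x -> exists c, vgt v (x - iota c).
Proof.
case/orP => [/eqP ->|h]; first by exists 0; rewrite rmorph0 subrr /vgt eqxx.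
have [->|x0] := eqVneq x 0; first by exists 0; rewrite rmorph0 subrr /vgt eqxx.
have [c [->|hc]] := place_res pv x0 h; exists c; first by rewrite subrr /vgt eqxx.
by rewrite /vgt hc orbT.
Qed.
End Place.

(** Subfields are predicates on K, so the valuation and the derivation of K apply to them
    directly. *)
Record subfield_pred (k K : fieldType) (iota : {rmorphism k -> K}) (F : K -> Prop) : Prop := SubfieldPred {
  sfC : forall c, F (iota c);
  sfB : forall x y, F x -> F y -> F (x - y);
  sfM : forall x y, F x -> F y -> F (x * y);
  sfV : forall x, F x -> F x^-1 }.

Section Subfield.
Variables (k K : fieldType) (iota : {rmorphism k -> K}) (F : K -> Prop).
Hypothesis sF : subfield_pred iota F.
Lemma sf0 : F 0. Proof. by rewrite -(rmorph0 iota); apply: sfC sF _. Qed.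
Lemma sf1 : F 1. Proof. by rewrite -(rmorph1 iota); apply: sfC sF _. Qed.
Lemma sfN x : F x -> F (- x). Proof. by move=> h; rewrite -sub0r; apply: sfB sF _ _ _ h; apply: sf0. Qed.
Lemma sfD x y : F x -> F y -> F (x + y).
Proof. by move=> h1 h2; rewrite -[y]opprK; apply: sfB sF _ _ h1 _; apply: sfN. Qed.
Lemma sfX x n : F x -> F (x ^+ n).
Proof. by move=> h; elim: n => [|n IH]; [apply: sf1|rewrite exprS; apply: sfM sF _ _ h IH]. Qed.
Lemma sfXz x (l : int) : F x -> F (x ^ l).
Proof.
by case: l => n h; [rewrite -exprnP; apply: sfX|rewrite NegzE -exprnN; apply: sfV sF _ _; apply: sfX].
Qed.
Lemma sf_sum I (r : seq I) (P : pred I) (G : I -> K) :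
  (forall i, P i -> F (G i)) -> F (\sum_(i <- r | P i) G i).
Proof. by move=> h; elim/big_ind: _ => //; [apply: sf0|apply: sfD]. Qed.
Lemma sf_horner (p : {poly K}) x : (forall i, F p`_i) -> F x -> F p.[x].
Proof. by move=> hp hx; rewrite horner_coef; apply: sf_sum => i _; apply: sfM sF _ _ _ _ => //; apply: sfX. Qed.

Definition adjoin (z : K) (x : K) := exists p q : {poly K},
  [/\ forall i, F p`_i, forall i, F q`_i, q.[z] != 0 & x = p.[z] / q.[z]].

Lemma coefB_F (p q : {poly K}) : (forall i, F p`_i) -> (forall i, F q`_i) -> forall i, F (p - q)`_i.
Proof. by move=> hp hq i; rewrite coefB; apply: sfB sF _ _ _ _. Qed.
Lemma coefM_F (p q : {poly K}) : (forall i, F p`_i) -> (forall i, F q`_i) -> forall i, F (p * q)`_i.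
Proof. by move=> hp hq i; rewrite coefM; apply: sf_sum => l _; apply: sfM sF _ _ _ _. Qed.
Lemma coefC_F c : F c -> forall i, F c%:P`_i.
Proof. by move=> hc i; rewrite coefC; case: ifP => // _; apply: sf0. Qed.

Lemma adjoin_sub z x : F x -> adjoin z x.
Proof.
move=> hx; exists x%:P, 1; split; first exact: coefC_F.
- by move=> i; rewrite coef1; case: eqP => _; [apply: sf1|apply: sf0].
- by rewrite hornerC oner_neq0.
by rewrite !hornerC divr1.
Qed.
Lemma adjoin_gen z : adjoin z z.
Proof.
exists 'X, 1; split.
- by move=> i; rewrite coefX; case: eqP => _; [apply: sf1|apply: sf0].
- by move=> i; rewrite coef1; case: eqP => _; [apply: sf1|apply: sf0].
- by rewrite hornerC oner_neq0.
by rewrite hornerX hornerC divr1.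
Qed.
Lemma adjoin_subfield z : subfield_pred iota (adjoin z).
Proof.
split.
- by move=> c; apply: adjoin_sub; apply: sfC sF _.
- move=> _ _ [p [q [hp hq q0 ->]]] [p' [q' [hp' hq' q'0 ->]]].
  exists (p * q' - p' * q), (q * q'); split.
  + by apply: coefB_F; apply: coefM_F.
  + exact: coefM_F.
  + by rewrite hornerM mulf_neq0.
  by rewrite !(hornerD, hornerN, hornerM); field; rewrite q0 q'0.
- move=> _ _ [p [q [hp hq q0 ->]]] [p' [q' [hp' hq' q'0 ->]]].
  exists (p * p'), (q * q'); split; try exact: coefM_F.
    by rewrite hornerM mulf_neq0.
  by rewrite !hornerM; field; rewrite q0 q'0.
move=> _ [p [q [hp hq q0 ->]]]; have [p0|p0] := eqVneq p.[z] 0.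
  by rewrite p0 mul0r invr0; apply: adjoin_sub; apply: sf0.
by exists q, p; split => //; rewrite invfM invrK mulrC.
Qed.
End Subfield.

(** * Adjoining a simple root over the local ring of a place *)

Section Smooth.
Variables (k K : fieldType) (iota : {rmorphism k -> K}) (v : K -> rat).
Hypothesis pv : is_place iota v.
Variable F : K -> Prop.
Hypothesis sF : subfield_pred iota F.

Definition int_in x := F x /\ vge v 0 x.

Lemma int_in0 : int_in 0. Proof. by split; [apply: sf0 sF|apply: vge_0]. Qed.
Lemma int_inC c : int_in (iota c). Proof. by split; [apply: sfC sF _|apply: (vge_iota pv)]. Qed.
Lemma int_inB x y : int_in x -> int_in y -> int_in (x - y).
Proof. by case=> a b [c d]; split; [apply: sfB sF _ _ _ _|apply: (vgeB pv)]. Qed.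
Lemma int_inD x y : int_in x -> int_in y -> int_in (x + y).
Proof. by case=> a b [c d]; split; [apply: (sfD sF)|apply: (vgeD pv)]. Qed.
Lemma int_inM x y : int_in x -> int_in y -> int_in (x * y).
Proof. by case=> a b [c d]; split; [apply: sfM sF _ _ _ _|apply: (vge0M pv)]. Qed.

Lemma divide_linear (p : {poly K}) c : int_in c -> (forall i, int_in p`_i) ->
  exists2 B : {poly K}, forall i, int_in B`_i & p = B * ('X - c%:P) + p.[c]%:P /\ int_in p.[c].
Proof.
move=> hc; elim/poly_ind: p => [|p a IH] hp.
  exists 0; first by move=> i; rewrite coef0; apply: int_in0.
  by rewrite horner0 mul0r add0r; split => //; apply: int_in0.
have hp' i : int_in p`_i by have := hp i.+1; rewrite coefD coefMX coefC /= addr0.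
have ha : int_in a by have := hp 0%N; rewrite coefD coefMX coefC /= add0r.
have [B hB [E hpc]] := IH hp'.
exists (B * 'X + p.[c]%:P).
  by move=> [|i]; rewrite coefD coefMX coefC /= ?add0r ?addr0.
split; last by rewrite !hornerE; apply: int_inD => //; apply: int_inM.
rewrite {1}E !hornerE polyCD polyCM; ring.
Qed.

Variables (pi z : K) (h : {poly K}).
Hypotheses (Fpi : F pi) (pi0 : pi != 0) (vpi : 0 < v pi)
  (pi_min : forall f, F f -> vgt v f -> vge v (v pi) f).
Hypotheses (hz : vge v 0 z) (hh : forall i, int_in h`_i) (hroot : h.[z] = 0)
  (hd0 : h^`().[z] != 0) (hd : v h^`().[z] = 0).

Let int_horner (p : {poly K}) : (forall i, int_in p`_i) -> vge v 0 p.[z].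
Proof. by move=> hp; apply: (vge_horner pv) => // i; case: (hp i). Qed.

(* a nonunit value p(z) is pi times another one, up to a unit: the local ring is a DVR *)
Lemma smooth_factor (p : {poly K}) : (forall i, int_in p`_i) -> p.[z] != 0 ->
  exists (c : K) (P Q : {poly K}), [/\ F c /\ c != 0, (forall i, int_in P`_i) /\ (P.[z] != 0 /\ v P.[z] = 0),
    (forall i, int_in Q`_i) /\ (Q.[z] != 0 /\ v Q.[z] = 0) & p.[z] = c * P.[z] / Q.[z]].
Proof.
move=> hp p0.
have int1 : int_in 1 by rewrite -(rmorph1 iota); apply: int_inC.
have hone i : int_in (1 : {poly K})`_i.
  by rewrite coef1; case: eqP => _ //; apply: int_in0.
have v1 := place1 pv.
(* The recursion lowers the value of p(z) by that of pi; the integer bound m measures it. *)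
have [m lm] : exists m : nat, v p.[z] < m%:R * v pi.
  exists (Num.bound `|v p.[z] / v pi|); rewrite -ltr_pdivrMr //.
  by apply: le_lt_trans (ler_norm _) _; apply: archi_boundP; apply: normr_ge0.
elim: m p hp p0 lm => [|m IH] p hp p0 lm.
  have := vge_nz p0 (int_horner hp); move: lm; rewrite mul0r => lt ge.
  by have := lt_le_trans lt ge; rewrite ltxx.
have := vge_nz p0 (int_horner hp); rewrite le_eqVlt => /orP [/eqP vp|vp].
  exists 1, p, 1; split => //.
  - by split; [apply: sf1 sF|rewrite oner_neq0].
  - by rewrite hornerC oner_neq0.
  by rewrite hornerC divr1 mul1r.
have [c mc] := vgt_res pv hz; have ic := int_inC c.
have [B hB [Ep [Fpc ipc]]] := divide_linear ic hp.
have [Bh hBh [Eh [Fhc ihc]]] := divide_linear ic hh.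
set w := z - iota c in mc.
have Ep1 : p.[z] = B.[z] * w + p.[iota c] by rewrite {1}Ep !hornerE.
have Eh1 : Bh.[z] * w + h.[iota c] = 0 by rewrite -hroot {2}Eh !hornerE.
have Ed : h^`().[z] = Bh^`().[z] * w + Bh.[z].
  by rewrite {1}Eh derivD derivM derivC derivXsubC !hornerE.
have idB : vge v 0 Bh^`().[z].
  apply: (vge_horner pv) => // i; rewrite coef_deriv -mulr_natr -(rmorph_nat iota).
  by apply: (vge0M pv); [case: (hBh i.+1)|apply: (vge_iota pv)].
have [Bh0 vBh] : Bh.[z] != 0 /\ v Bh.[z] = 0.
  have -> : Bh.[z] = h^`().[z] - Bh^`().[z] * w by rewrite Ed addrC addKr.
  by apply: (unit_sub_max pv) => //; apply: (vgtMr pv).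
have mp : vgt v p.[iota c].
  have -> : p.[iota c] = p.[z] - B.[z] * w by rewrite Ep1 addrC addKr.
  by apply: (vgtB pv); [rewrite /vgt vp orbT|apply: (vgtMr pv) => //; apply: int_horner].
have mh : vgt v h.[iota c].
  have -> : h.[iota c] = - (Bh.[z] * w) by apply/eqP; rewrite -addr_eq0 addrC Eh1.
  by rewrite (vgtN pv); apply: (vgtMr pv) => //; apply: int_horner.
have divpi f : F f -> vgt v f -> int_in (f / pi).
  move=> Ff mf; split; first by apply: sfM sF _ _ Ff _; apply: sfV sF _ _.
  have := vgeM pv (pi_min Ff mf) (vge_refl v pi^-1).
  by rewrite (placeV pv) // subrr.
have ia := divpi _ Fpc mp; have ib := divpi _ Fhc mh.
(* Eliminating w = z - c between p(z) = B(z) w + p(c) and 0 = Bh(z) w + h(c) gives p(z) Bh(z) = p(c)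
   Bh(z) - h(c) B(z); here Bh(z) is a unit, and p(c), h(c) are divisible by pi. *)
pose p2 : {poly K} := (p.[iota c] / pi) *: Bh - (h.[iota c] / pi) *: B.
have hp2 i : int_in p2`_i.
  by rewrite coefB !coefZ; apply: int_inB; apply: int_inM.
have E2 : p.[z] * Bh.[z] = pi * p2.[z].
  have Ew : h.[iota c] = - (Bh.[z] * w) by apply/eqP; rewrite -addr_eq0 addrC Eh1.
  by rewrite Ep1 /p2 !hornerE Ew; field.
have p20 : p2.[z] != 0.
  by apply: contraNneq (mulf_neq0 p0 Bh0) => E; rewrite E2 E mulr0.
have vp2 : v p2.[z] = v p.[z] - v pi.
  have := congr1 v E2; rewrite !(placeM pv) // vBh addr0 => ->; ring.
have [|c' [P [Q [hc' hP hQ E]]]] := IH p2 hp2 p20.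
  by rewrite vp2 ltrBlDr; move: lm; rewrite -natr1 mulrDl mul1r.
have [F_c c'0] := hc'; have [iP [P0 vP]] := hP; have [iQ [Q0 vQ]] := hQ.
exists (pi * c'), P, (Q * Bh); split => //.
- by split; [apply: sfM sF _ _ _ _|rewrite mulf_neq0].
- split; first by move=> i; rewrite coefM; elim/big_ind: _ => [|x y|l _]; [apply: int_in0|apply: int_inD|apply: int_inM].
  by rewrite hornerM mulf_neq0 // (placeM pv) // vQ vBh addr0.
apply: (mulIf Bh0); rewrite E2 E hornerM; field; by rewrite Q0 Bh0.
Qed.

Lemma min_coef (p : {poly K}) : (forall i, F p`_i) -> p != 0 ->
  exists2 c, F c /\ c != 0 & forall i, int_in (p`_i / c).
Proof.
move=> hp p0.
have [i [i0 Hi]] : exists i, p`_i != 0 /\ forall l, (l < size p)%N -> vge v (v p`_i) p`_l.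
  have H n : (n <= size p)%N -> (forall l, (l < n)%N -> p`_l = 0) \/
      exists i, p`_i != 0 /\ forall l, (l < n)%N -> vge v (v p`_i) p`_l.
    elim: n => [|n IH] ln; first by left.
    have [pn|pn] := eqVneq p`_n 0.
      case: (IH (ltnW ln)) => [hyp|[i [i0 hyp]]]; [left|right; exists i; split => //] => l;
        rewrite ltnS leq_eqVlt => /orP [/eqP ->|/hyp //]; rewrite pn //; exact: vge_0.
    right; case: (IH (ltnW ln)) => [hyp|[i [i0 hyp]]].
      exists n; split => // l; rewrite ltnS leq_eqVlt => /orP [/eqP ->|/hyp ->]; last exact: vge_0.
      exact: vge_refl.
    have [le|lt] := leP (v p`_i) (v p`_n).
      exists i; split => // l; rewrite ltnS leq_eqVlt => /orP [/eqP ->|/hyp //].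
      by rewrite /vge le orbT.
    exists n; split => // l; rewrite ltnS leq_eqVlt => /orP [/eqP ->|/hyp hl]; first exact: vge_refl.
    exact: vge_le (ltW lt) hl.
  case: (H _ (leqnn _)) => // hyp; have := lead_coef_eq0 p; rewrite lead_coefE hyp ?(negPf p0) ?eqxx //.
  by rewrite prednK // size_poly_gt0.
exists p`_i => // l; split; first by apply: sfM sF _ _ _ _ => //; apply: sfV sF _ _.
have [ll|ll] := ltnP l (size p); last by rewrite nth_default // mul0r vge_0.
by have := vgeM pv (Hi l ll) (vge_refl v (p`_i)^-1); rewrite (placeV pv) // subrr.
Qed.

Lemma smooth_factor_field f : adjoin F z f -> f != 0 ->
  exists (c : K) (P Q : {poly K}), [/\ F c /\ c != 0, (forall i, int_in P`_i) /\ (P.[z] != 0 /\ v P.[z] = 0),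
    (forall i, int_in Q`_i) /\ (Q.[z] != 0 /\ v Q.[z] = 0) & f = c * P.[z] / Q.[z]].
Proof.
have one (p : {poly K}) : (forall i, F p`_i) -> p.[z] != 0 ->
  exists (c : K) (P Q : {poly K}), [/\ F c /\ c != 0, (forall i, int_in P`_i) /\ (P.[z] != 0 /\ v P.[z] = 0),
    (forall i, int_in Q`_i) /\ (Q.[z] != 0 /\ v Q.[z] = 0) & p.[z] = c * P.[z] / Q.[z]].
  move=> hp p0; have pn0 : p != 0 by apply: contraNneq p0 => ->; rewrite horner0.
  have [c [Fc c0] Hc] := min_coef hp pn0.
  have hp' i : int_in (c^-1 *: p)`_i by rewrite coefZ mulrC.
  have p'0 : (c^-1 *: p).[z] != 0 by rewrite hornerZ mulf_neq0 ?invr_eq0.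
  have [c' [P [Q [[Fc' c'0] hP hQ E]]]] := smooth_factor hp' p'0.
  exists (c * c'), P, Q; split => //.
    by split; [apply: sfM sF _ _ _ _|rewrite mulf_neq0].
  by move: E; rewrite hornerZ => E; rewrite -!mulrA [c' * _]mulrA -E mulVKf.
case=> p [q [hp hq q0 ->]] f0.
have p0 : p.[z] != 0 by apply: contraNneq f0 => ->; rewrite mul0r.
have [c [P [Q [[Fc c0] [iP [P0 vP]] [iQ [Q0 vQ]] E]]]] := one p hp p0.
have [c' [P' [Q' [[Fc' c'0] [iP' [P'0 vP']] [iQ' [Q'0 vQ']] E']]]] := one q hq q0.
have iM (a b : {poly K}) : (forall i, int_in a`_i) -> (forall i, int_in b`_i) -> forall i, int_in (a * b)`_i.
  move=> ha hb i; rewrite coefM; elim/big_ind: _ => [|x y|l _]; [apply: int_in0|apply: int_inD|apply: int_inM] => //.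
exists (c / c'), (P * Q'), (Q * P'); split.
- by split; [apply: sfM sF _ _ Fc _; apply: sfV sF _ _|rewrite mulf_neq0 ?invr_eq0].
- by split; [apply: iM|rewrite hornerM mulf_neq0 // (placeM pv) // vP vQ' addr0].
- by split; [apply: iM|rewrite hornerM mulf_neq0 // (placeM pv) // vQ vP' addr0].
by rewrite !hornerM E E'; field; rewrite c'0 P'0 Q'0 Q0.
Qed.

(** F(z) is unramified over F: f is an element of F times a unit. *)
Lemma smooth_val f : adjoin F z f -> f != 0 -> exists2 c, F c /\ c != 0 & v f = v c.
Proof.
move=> hf f0; have [c [P [Q [[Fc c0] [iP [P0 vP]] [iQ [Q0 vQ]] E]]]] := smooth_factor_field hf f0.
exists c => //; rewrite E (place_div pv) ?mulf_neq0 // (placeM pv) // vP vQ; ring.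
Qed.

Variable D : K -> K.
Hypotheses (DD : forall x y, D (x + y) = D x + D y)
  (DM : forall x y, D (x * y) = D x * y + x * D y).
Variable C : rat.
Hypothesis DF : forall f, F f -> vge v 0 f -> vge v (- C) (D f).

(** Differentiating h(z) = 0 expresses Dz as a quotient with the unit h'(z) as denominator, so D has
    no worse poles on integral polynomials in z than on integral elements of F. *)
Let Dint (P : {poly K}) : (forall i, int_in P`_i) -> vge v (- C) (D P.[z]).
Proof.
move=> iP.
have mapD (p : {poly K}) : (forall i, int_in p`_i) -> vge v (- C) (map_poly D p).[z].
  move=> ip; apply: (vge_horner pv) => // i; rewrite coef_map_id0 ?(D0 DD) //.
  by have [h1 h2] := ip i; apply: DF.
have der (p : {poly K}) : (forall i, int_in p`_i) -> vge v 0 p^`().[z].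
  move=> ip; apply: (vge_horner pv) => // i; rewrite coef_deriv -mulr_natr -(rmorph_nat iota).
  by apply: (vge0M pv); [case: (ip i.+1)|apply: (vge_iota pv)].
have Dz : vge v (- C) (D z).
  have := D_horner DD DM h z; rewrite hroot (D0 DD) => /esym /eqP.
  rewrite addrC addr_eq0 => /eqP E.
  have -> : D z = - (map_poly D h).[z] * (h^`().[z])^-1 by rewrite -E mulrC mulKf.
  have := vgeM pv (_ : vge v (- C) (- (map_poly D h).[z])) (vge_refl v (h^`().[z])^-1).
  rewrite (placeV pv) // hd oppr0 addr0; apply; rewrite (vgeN pv); exact: mapD.
rewrite (D_horner DD DM); apply: (vgeD pv); first exact: mapD.
by have := vgeM pv (der _ iP) Dz; rewrite add0r.
Qed.

Let Dunit (P Q : {poly K}) : (forall i, int_in P`_i) -> P.[z] != 0 -> v P.[z] = 0 ->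
  (forall i, int_in Q`_i) -> Q.[z] != 0 -> v Q.[z] = 0 -> vge v (- C) (D (P.[z] / Q.[z])).
Proof.
move=> iP P0 vP iQ Q0 vQ; rewrite (D_div DM) //.
have u (x : K) : x != 0 -> v x = 0 -> vge v 0 x by move=> _ <-; apply: vge_refl.
have uQ : vge v 0 (Q.[z] ^+ 2)^-1.
  by apply: u; rewrite ?invr_eq0 ?expf_neq0 // (placeV pv) ?expf_neq0 // (placeX pv) // vQ mulr0 oppr0.
rewrite -[- C]addr0; apply: (vgeM pv) => //; apply: (vgeB pv).
  by rewrite -[- C]addr0; apply: (vgeM pv); [apply: Dint|apply: u].
by rewrite -[- C]add0r; apply: (vgeM pv); [apply: u|apply: Dint].
Qed.

Lemma smooth_D_int f : 0 <= C -> adjoin F z f -> vge v 0 f -> vge v (- C) (D f).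
Proof.
move=> C0 hf vf; have [->|f0] := eqVneq f 0; first by rewrite (D0 DD) vge_0.
have [c [P [Q [[Fc c0] [iP [P0 vP]] [iQ [Q0 vQ]] E]]]] := smooth_factor_field hf f0.
have vPQ : v (P.[z] / Q.[z]) = 0 by rewrite (place_div pv) // vP vQ subrr.
have vc : vge v 0 c.
  move: vf; rewrite /vge (negPf f0) (negPf c0) /= E -mulrA (placeM pv) ?mulf_neq0 ?invr_eq0 // vPQ addr0 //.
rewrite E -mulrA DM; apply: (vgeD pv).
  by have := vgeM pv (DF Fc vc) (vge_refl v (P.[z] / Q.[z])); rewrite vPQ addr0.
by have := vgeM pv vc (Dunit iP P0 vP iQ Q0 vQ); rewrite add0r.
Qed.

Lemma smooth_D_val f (C' : rat) : C <= C' ->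
  (forall c, F c -> c != 0 -> vge v (v c - C') (D c)) ->
  adjoin F z f -> f != 0 -> vge v (v f - C') (D f).
Proof.
move=> CC' DF' hf f0.
have [c [P [Q [[Fc c0] [iP [P0 vP]] [iQ [Q0 vQ]] E]]]] := smooth_factor_field hf f0.
have vPQ : v (P.[z] / Q.[z]) = 0 by rewrite (place_div pv) // vP vQ subrr.
have vf : v f = v c by rewrite E -mulrA (placeM pv) ?mulf_neq0 ?invr_eq0 // vPQ addr0.
rewrite vf E -mulrA DM; apply: (vgeD pv).
  by have := vgeM pv (DF' _ Fc c0) (vge_refl v (P.[z] / Q.[z])); rewrite vPQ addr0.
apply: vge_le (vgeM pv (vge_refl v c) (Dunit iP P0 vP iQ Q0 vQ)).
by rewrite lerD2l lerN2.
Qed.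
End Smooth.

(** * A coordinate that is a simple root *)

Section Hensel.
Variables (k K : fieldType) (iota : {rmorphism k -> K}) (v : K -> rat).
Hypothesis pv : is_place iota v.
Variable F : K -> Prop.
Hypothesis sF : subfield_pred iota F.
Variable pi : K.
Hypotheses (Fpi : F pi) (pi0 : pi != 0) (vpi : 0 < v pi)
  (pi_gen : forall f, f != 0 -> exists l : int, v f = l%:~R * v pi).

Lemma gen_min f : vgt v f -> vge v (v pi) f.
Proof.
case/orP => [/eqP ->|h]; first exact: vge_0.
have [->|f0] := eqVneq f 0; first exact: vge_0.
have [l El] := pi_gen f0; rewrite /vge El; apply/orP; right.
move: h; rewrite El pmulr_lgt0 // ltr0z => l0.
by rewrite -[X in X <= _]mul1r ler_pM2r // ler1z -gtz0_ge1.
Qed.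

(** The residue field is [k] and F contains a uniformizer of K, so the digits of z can be removed
    one after another within F. *)
Lemma expand z (L : int) : exists2 z0, F z0 & vge v (L%:~R * v pi) (z - z0).
Proof.
have step (l : int) : (exists2 z0, F z0 & vge v (l%:~R * v pi) (z - z0)) ->
   exists2 z0, F z0 & vge v ((l + 1)%:~R * v pi) (z - z0).
  case=> z0 Fz0 h.
  have pl0 : pi ^ l != 0 by apply: expfz_neq0.
  have hw : vge v 0 ((z - z0) / pi ^ l).
    have := vgeM pv h (vge_refl v (pi ^ l)^-1).
    by rewrite (placeV pv) // (place_exprz pv) // subrr.
  have [c mc] := vgt_res pv hw.
  exists (z0 + pi ^ l * iota c).
    by apply: (sfD sF) => //; apply: sfM sF _ _ _ _; [apply: (sfXz sF)|apply: sfC sF _].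
  have -> : z - (z0 + pi ^ l * iota c) = pi ^ l * ((z - z0) / pi ^ l - iota c) by field.
  have := vgeM pv (vge_refl v (pi ^ l)) (gen_min mc).
  by rewrite (place_exprz pv) // rmorphD /= [(_ + _) * v pi]mulrDl mul1r.
have [l0 H0] : exists l0 : int, exists2 z0, F z0 & vge v (l0%:~R * v pi) (z - z0).
  have [->|z0] := eqVneq z 0.
    by exists 0, 0; [apply: sf0 sF|rewrite subrr vge_0].
  have [l El] := pi_gen z0; exists l, 0; first exact: sf0 sF.
  by rewrite subr0 -El vge_refl.
have [le|le] := leP L l0.
  case: H0 => z0 Fz0 h; exists z0 => //; apply: vge_le h.
  by rewrite ler_pM2r // ler_int.
have -> : L = l0 + `|(L - l0)%R|%N.
  by move: le; lia.
elim: `|(L - l0)%R|%N => [|n IH]; first by rewrite addr0.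
have -> : l0 + n.+1 = (l0 + n) + 1 :> int by rewrite -addrA -PoszD addn1.
exact: step.
Qed.

(** Subtracting a good approximation z0 in F and dividing by pi^L magnifies the root: once the
    linear Taylor coefficient of H at z is normalized to a unit, the higher ones become integral for
    L large. This brings every such z to the case of a simple root. *)
Lemma hensel_coordinate z (H : {poly K}) : (forall i, F H`_i) -> H.[z] = 0 -> H^`().[z] != 0 ->
  exists z0 (l : int) z1 (h : {poly K}), [/\ F z0 /\ z = z0 + pi ^ l * z1, vge v 0 z1,
    (forall i, int_in v F h`_i), h.[z1] = 0 & h^`().[z1] != 0 /\ v h^`().[z1] = 0].
Proof.
move=> FH Hz Hz'.
pose G := H \Po ('X + z%:P).
have G0 : G`_0 = 0 by rewrite -horner_coef0 horner_comp !hornerE.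
have G1 : G`_1 = H^`().[z].
  have -> : G`_1 = G^`()`_0 by rewrite coef_deriv.
  by rewrite -horner_coef0 deriv_comp derivD derivX derivC addr0 mulr1 horner_comp !hornerE.
have HG : H = G \Po ('X - z%:P).
  by rewrite -comp_polyA comp_polyD comp_polyX comp_polyC subrK comp_polyXr.
have [M EM] := pi_gen Hz'.
(* L large enough that pi^(L(i-1)) G_i / G_1 is in the maximal ideal for i >= 2 *)
have [L HL] : exists L : nat, forall i, vge v (M%:~R * v pi - L%:R * v pi + v pi) G`_i.
  have : exists L : nat, forall i, (i < size G)%N -> vge v (M%:~R * v pi - L%:R * v pi + v pi) G`_i.
    elim: (size G) => [|n [L IH]]; first by exists 0%N.
    have [Gn|Gn] := eqVneq G`_n 0.
      by exists L => i; rewrite ltnS leq_eqVlt => /orP [/eqP ->|/IH //]; rewrite Gn vge_0.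
    have [l El] := pi_gen Gn.
    exists (L + `|(M + 1 - l)%R|)%N => i; rewrite ltnS leq_eqVlt => /orP [/eqP ->|/IH h].
      rewrite /vge El; apply/orP; right.
      rewrite -mulrBl -[X in _ + X]mul1r -mulrDl ler_pM2r // natrD.
      have := ler_norm (M + 1 - l); rewrite -(ler_int rat) rmorphB rmorphD /= => h.
      have -> : (`|(M + 1 - l)%R|%N)%:R = `|M + 1 - l|%:~R :> rat by rewrite natr_absz.
      have := ler0n rat L; lra.
    apply: vge_le h; rewrite lerD2r lerD2l lerN2 ler_pM2r // ler_nat leq_addr //.
  case=> L HL; exists L => i; have [li|li] := ltnP i (size G); first exact: HL.
  by rewrite nth_default // vge_0.
have [z0 Fz0 hz0] := expand z L%:Z.
have pL0 : pi ^+ L != 0 by rewrite expf_neq0.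
pose z1 := (z - z0) / pi ^+ L.
have Ez : z = z0 + pi ^+ L * z1 by rewrite /z1; field.
have iz1 : vge v 0 z1.
  have := vgeM pv hz0 (vge_refl v (pi ^+ L)^-1).
  by rewrite (placeV pv) // (placeX pv) // subrr.
have pM0 : pi ^ M != 0 by apply: expfz_neq0.
(* M is the order of H'(z), so e pi^L H'(z), the new linear coefficient, has value 0. *)
pose e := (pi ^ M * pi ^+ L)^-1.
have e0 : e != 0 by rewrite invr_eq0 mulf_neq0.
pose h := e *: (H \Po (pi ^+ L *: 'X + z0%:P)).
have hE : h = \sum_(i < size G) (e * G`_i * pi ^+ (L * i)) *: ('X - z1%:P) ^+ i.
  rewrite /h HG -comp_polyA comp_polyB comp_polyX comp_polyC.
  have -> : pi ^+ L *: 'X + z0%:P - z%:P = pi ^+ L *: ('X - z1%:P).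
    have Ez' : z%:P = z0%:P + (pi ^+ L)%:P * z1%:P by rewrite -polyCM -polyCD -Ez.
    by rewrite Ez' -!mul_polyC; ring.
  rewrite comp_polyE scaler_sumr; apply: eq_bigr => i _.
  by rewrite exprZn !scalerA exprM.
have dh : h^`().[z1] = e * pi ^+ L * H^`().[z].
  rewrite /h derivZ hornerZ deriv_comp hornerM horner_comp derivD derivZ derivX derivC addr0.
  by rewrite !(hornerD, hornerZ, hornerX, hornerC) [_ + z0]addrC -Ez; ring.
exists z0, L%:Z, z1, h; split => //.
- move=> i; split.
    rewrite /h coefZ; apply: sfM sF _ _ _ _.
      by apply: sfV sF _ _; apply: sfM sF _ _ _ _; [apply: (sfXz sF)|apply: (sfX sF)].
    rewrite comp_polyE coef_sum; apply: (sf_sum sF) => l _; rewrite coefZ.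
    apply: sfM sF _ _ _ _ => //.
    elim: (l : nat) i => [|n IH] i; first by rewrite expr0 coef1; case: eqP => _; [apply: sf1 sF|apply: sf0 sF].
    rewrite exprS; apply: (coefM_F sF) => // {}i; rewrite coefD coefZ coefX coefC.
    apply: (sfD sF); last by case: eqP => _ //; apply: sf0 sF.
    by apply: sfM sF _ _ _ _; [apply: (sfX sF)|case: eqP => _; [apply: sf1 sF|apply: sf0 sF]].
  rewrite hE coef_sum; apply: (vge_sum pv) => l _; rewrite coefZ.
  have iX n : vge v 0 (('X - z1%:P) ^+ n)`_i.
    elim: n i => [|n IH] i.
      by rewrite expr0 coef1; case: eqP => _; [rewrite -(rmorph1 iota); apply: (vge_iota pv)|apply: vge_0].
    rewrite exprS coefM; apply: (vge_sum pv) => m _; apply: (vge0M pv) => //.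
    rewrite coefB coefX coefC; apply: (vgeB pv).
      by case: eqP => _; [rewrite -(rmorph1 iota); apply: (vge_iota pv)|apply: vge_0].
    by case: eqP => _ //; apply: vge_0.
  rewrite -[0](addr0 0); apply: (vgeM pv) => //.
  case: (l : nat) => [|[|n]]; first by rewrite G0 mulr0 mul0r vge_0.
    rewrite G1 muln1 -mulrA [_ * pi ^+ L]mulrC mulrA /vge; apply/orP; right.
    rewrite !(placeM pv) ?mulf_neq0 // EM /e (placeV pv) ?mulf_neq0 // (placeM pv) // (place_exprz pv) //.
    lra.
  have pLn : pi ^+ (L * n.+2) != 0 by rewrite expf_neq0.
  have := vgeM pv (vgeM pv (vge_refl v e) (HL n.+2)) (vge_refl v (pi ^+ (L * n.+2))).
  apply: vge_le; rewrite /e (placeV pv) ?mulf_neq0 // (placeM pv) // (place_exprz pv) // !(placeX pv) //.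
  rewrite natrM -[n.+2]addn2 natrD.
  have : 0 <= L%:R * n%:R * v pi by rewrite !mulr_ge0 ?ler0n // ltW.
  by move=> ge0; have := vpi; rewrite mulrDr mulrDl; lra.
- by rewrite /h hornerZ horner_comp !(hornerD, hornerZ, hornerX, hornerC) [_ + z0]addrC -Ez Hz mulr0.
rewrite dh !mulf_neq0 //; split => //.
by rewrite !(placeM pv) ?mulf_neq0 // EM /e (placeV pv) ?mulf_neq0 // (placeM pv) // (place_exprz pv) //; ring.
Qed.
End Hensel.

(** * The rational function field of a uniformizer *)

Section Base.
Variables (k K : fieldType) (iota : {rmorphism k -> K}) (v : K -> rat).
Hypothesis pv : is_place iota v.
Variable pi : K.
Hypotheses (pi0 : pi != 0) (vpi : 0 < v pi).
Local Notation "p .[pi]" := ((map_poly iota p).[pi]) (at level 2, left associativity, format "p .[pi]").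

Definition base_field x := exists p q : {poly k}, q.[pi] != 0 /\ x = p.[pi] / q.[pi].

Lemma base_C c : base_field (iota c).
Proof. by exists c%:P, 1; rewrite rmorph1 map_polyC !hornerC oner_neq0 divr1. Qed.
Lemma base_pi : base_field pi.
Proof. by exists 'X, 1; rewrite map_polyX rmorph1 hornerX hornerC oner_neq0 divr1. Qed.
Lemma base_subfield : subfield_pred iota base_field.
Proof.
split; first exact: base_C.
- move=> _ _ [p [q [q0 ->]]] [p' [q' [q'0 ->]]]; exists (p * q' - p' * q), (q * q').
  rewrite rmorphB !rmorphM /= hornerD hornerN !hornerM mulf_neq0 //; split => //.
  by field; rewrite q0 q'0.
- move=> _ _ [p [q [q0 ->]]] [p' [q' [q'0 ->]]]; exists (p * p'), (q * q').
  rewrite !rmorphM /= !hornerM mulf_neq0 //; split => //.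
  by field; rewrite q0 q'0.
move=> _ [p [q [q0 ->]]]; have [p0|p0] := eqVneq p.[pi] 0.
  by rewrite p0 mul0r invr0 -(rmorph0 iota); apply: base_C.
by exists q, p; rewrite invfM invrK mulrC.
Qed.

Let int_poly (p : {poly k}) : vge v 0 p.[pi].
Proof.
apply: (vge_horner pv) => [i|]; first by rewrite coef_map; apply: (vge_iota pv).
by rewrite /vge ltW ?orbT.
Qed.

Lemma base_poly (p : {poly k}) : p != 0 -> exists (n : nat) (u : {poly k}),
  [/\ u.[pi] != 0, v u.[pi] = 0 & p.[pi] = pi ^+ n * u.[pi]].
Proof.
move=> p0; have [m] := ubnP (size p); elim: m => // m IH in p p0 *.
have [c0|c0] := eqVneq p.[0] 0 => sp.
  have /factor_theorem [q Eq] : root p 0 by apply/rootP.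
  rewrite subr0 in Eq; have q0 : q != 0 by apply: contraNneq p0 => q0; rewrite Eq q0 mul0r.
  have [|n [u [u0 vu E]]] := IH _ q0; first by move: sp; rewrite Eq size_mulX.
  exists n.+1, u; split => //; rewrite Eq rmorphM /= map_polyX hornerMX E exprS.
  by rewrite mulrC mulrA.
exists 0%N, p; rewrite mul1r.
have /factor_theorem [q Eq] : root (p - p.[0]%:P) 0 by rewrite rootE !hornerE subrr.
rewrite subr0 in Eq.
have -> : p.[pi] = iota p.[0] - (- q.[pi] * pi).
  rewrite -[in LHS](subrK p.[0]%:P p) Eq rmorphD rmorphM /= map_polyX map_polyC.
  by rewrite hornerD hornerMX hornerC; ring.
have [|||h1 h2] := @unit_sub_max _ _ _ _ pv (iota p.[0]) (- q.[pi] * pi).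
- by rewrite fmorph_eq0.
- exact: (placeC pv).
- by apply: (vgtMr pv); [rewrite (vgeN pv)|rewrite /vgt vpi orbT].
by [].
Qed.

Lemma base_factor f : base_field f -> f != 0 -> exists (l : int) (P Q : {poly k}),
  [/\ P.[pi] != 0 /\ v P.[pi] = 0, Q.[pi] != 0 /\ v Q.[pi] = 0 & f = pi ^ l * (P.[pi] / Q.[pi])].
Proof.
case=> p [q [q0 ->]] f0.
have p0 : p != 0 by apply: contraNneq f0 => ->; rewrite rmorph0 horner0 mul0r.
have q0' : q != 0 by apply: contraNneq q0 => ->; rewrite rmorph0 horner0.
have [n [P [P0 vP EP]]] := base_poly p0; have [m [Q [Q0 vQ EQ]]] := base_poly q0'.
exists (n%:Z - m%:Z), P, Q; split => //.
rewrite EP EQ expfzDr // -exprnP -invr_expz -exprnP; field.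
by rewrite Q0 expf_neq0.
Qed.

Lemma base_val f : base_field f -> f != 0 -> exists l : int, v f = l%:~R * v pi.
Proof.
move=> hf f0; have [l [P [Q [[P0 vP] [Q0 vQ] ->]]]] := base_factor hf f0.
exists l; rewrite (placeM pv) ?mulf_neq0 ?invr_eq0 ?expfz_neq0 // (place_div pv) //.
by rewrite (place_exprz pv) // vP vQ subrr addr0.
Qed.

Variable D : K -> K.
Hypotheses (DD : forall x y, D (x + y) = D x + D y)
  (DM : forall x y, D (x * y) = D x * y + x * D y) (DC : forall c, D (iota c) = 0).

Lemma D_poly (p : {poly k}) x : D (map_poly iota p).[x] = (map_poly iota p^`()).[x] * D x.
Proof.
rewrite (D_horner DD DM) deriv_map; suff -> : map_poly D (map_poly iota p) = 0.
  by rewrite horner0 add0r.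
by apply/polyP => i; rewrite coef_map_id0 ?(D0 DD) // coef_map /= DC coef0.
Qed.

Let Dunit P Q : P.[pi] != 0 -> v P.[pi] = 0 -> Q.[pi] != 0 -> v Q.[pi] = 0 ->
  vge v (v (D pi)) (D (P.[pi] / Q.[pi])).
Proof.
move=> P0 vP Q0 vQ; rewrite (D_div DM) // !D_poly.
have -> : (P^`().[pi] * D pi * Q.[pi] - P.[pi] * (Q^`().[pi] * D pi)) / Q.[pi] ^+ 2 =
  (P^`().[pi] * Q.[pi] - P.[pi] * Q^`().[pi]) / Q.[pi] ^+ 2 * D pi by field.
rewrite -[v (D pi)]add0r; apply: (vgeM pv); last exact: vge_refl.
rewrite -[0]addr0; apply: (vgeM pv).
  by apply: (vgeB pv); apply: (vge0M pv).
by rewrite /vge (placeV pv) ?expf_neq0 // (placeX pv) // vQ mulr0 oppr0 lexx orbT.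
Qed.

(** Write f as pi^l times a unit: the power contributes l f (D pi / pi), and the unit is
    differentiated at no greater cost than pi itself. *)
Lemma base_D f : base_field f -> f != 0 -> vge v (v f - (v pi - v (D pi))) (D f).
Proof.
move=> hf f0; have [l [P [Q [[P0 vP] [Q0 vQ] E]]]] := base_factor hf f0.
have PQ0 : P.[pi] / Q.[pi] != 0 by rewrite mulf_neq0 ?invr_eq0.
have vPQ : v (P.[pi] / Q.[pi]) = 0 by rewrite (place_div pv) // vP vQ subrr.
have pl0 : pi ^ l != 0 by apply: expfz_neq0.
have vf : v f = l%:~R * v pi by rewrite E (placeM pv) // vPQ addr0 (place_exprz pv).
rewrite E DM D_exprz // -E; apply: (vgeD pv).
  have -> : l%:~R * pi ^ l * (D pi / pi) * (P.[pi] / Q.[pi]) = l%:~R * f * (pi^-1 * D pi).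
    by rewrite E; ring.
  have -> : v f - (v pi - v (D pi)) = (0 + v f) + (v pi^-1 + v (D pi)) by rewrite (placeV pv) //; ring.
  apply: (vgeM pv); last by apply: (vgeM pv); apply: vge_refl.
  apply: (vgeM pv); last exact: vge_refl.
  by rewrite -(rmorph_int iota); apply: (vge_iota pv).
have := vgeM pv (vge_refl v (pi ^ l)) (Dunit P0 vP Q0 vQ).
by apply: vge_le; rewrite vf (place_exprz pv) // lerD2l opprB gerBl ltW.
Qed.

Lemma base_D_int f : vge v 0 (D pi) -> base_field f -> vge v 0 f -> vge v 0 (D f).
Proof.
move=> vD hf if0; have [->|f0] := eqVneq f 0; first by rewrite (D0 DD) vge_0.
have [l [P [Q [[P0 vP] [Q0 vQ] E]]]] := base_factor hf f0.
have PQ0 : P.[pi] / Q.[pi] != 0 by rewrite mulf_neq0 ?invr_eq0.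
have vPQ : v (P.[pi] / Q.[pi]) = 0 by rewrite (place_div pv) // vP vQ subrr.
have pl0 : pi ^ l != 0 by apply: expfz_neq0.
have vf : v f = l%:~R * v pi by rewrite E (placeM pv) // vPQ addr0 (place_exprz pv).
have l0 : 0 <= l by move: if0; rewrite /vge (negPf f0) vf /= pmulr_lge0 // ler0z.
have [Dpi0|Dpi0] := eqVneq (D pi) 0.
  by case: hf f0 {if0 vf E} => p [q [q0 ->]] f0; rewrite (D_div DM) // !D_poly Dpi0 !mulr0 mul0r subrr mul0r vge_0.
have vD' := vge_nz Dpi0 vD.
case: l l0 E {pl0 vf} => // n _; rewrite -exprnP => ->.
have ipi : vge v 0 pi by rewrite /vge ltW ?orbT.
rewrite DM (DXn DM); apply: (vgeD pv).
  apply: (vge0M pv); last by rewrite /vge vPQ lexx orbT.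
  apply: (vge0M pv) => //; apply: (vge0M pv); last exact: (vge0X pv).
  by rewrite -(rmorph_nat iota); apply: (vge_iota pv).
apply: (vge0M pv); first exact: (vge0X pv).
exact: vge_le vD' (Dunit P0 vP Q0 vQ).
Qed.
End Base.

(** * Bounded poles of the derivation at an arbitrary place *)

Section SpecialBound.
Variables (k K : fieldType) (iota : {rmorphism k -> K}) (v : K -> rat).
Hypotheses (charK : [pchar K] =i pred0) (pv : is_place iota v).
Variable e : nat.
Hypotheses (e0 : (0 < e)%N) (disc : forall x, x != 0 -> exists m : int, v x = m%:~R / e%:R)
  (npos : exists x, x != 0 /\ 0 < v x).
Variables (t z : K).
Hypothesis gen : forall F, subfield_pred iota F -> F t -> F z -> forall x, F x.
Hypothesis alg : forall y, exists2 P : {poly {poly k}}, P != 0 & ev2 iota t y P = 0.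
Hypothesis t_tr : forall p : {poly k}, p != 0 -> (map_poly iota p).[t] != 0.
Variable D : K -> K.
Hypotheses (DD : forall x y, D (x + y) = D x + D y)
  (DM : forall x y, D (x * y) = D x * y + x * D y) (DC : forall c, D (iota c) = 0).

(** The values have the common denominator e, so a least positive one exists; division with
    remainder shows that it generates all of them. *)
Lemma uniformizer : exists pi, [/\ pi != 0, 0 < v pi &
  forall f, f != 0 -> exists l : int, v f = l%:~R * v pi].
Proof.
have eQ : (0 < e%:R :> rat) by rewrite ltr0n.
pose Q (n : nat) := boolp.asbool ((0 < n)%N /\ exists x, x != 0 /\ v x = n%:R / e%:R).
have exQ : exists n, Q n.
  have [x [x0 vx]] := npos; have [m Em] := disc x0.
  have m0 : 0 < m by move: vx; rewrite Em pmulr_lgt0 ?invr_gt0 // ltr0z.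
  exists `|m|%N; apply/boolp.asboolP; split; first by rewrite absz_gt0 gt_eqF.
  by exists x; split => //; rewrite Em natr_absz gtr0_norm.
have [n /boolp.asboolP [n0 [x [x0 vx]]] minn] := ex_minnP exQ.
have vx0 : 0 < v x by rewrite vx divr_gt0 // ltr0n.
exists x; split => // f f0; have [m Em] := disc f0.
have nZ : n%:Z != 0 by rewrite eqz_nat -lt0n.
exists (m %/ n%:Z)%Z.
have Er : v (f / x ^ (m %/ n%:Z)%Z) = (m %% n%:Z)%Z%:~R / e%:R.
  rewrite (place_div pv) ?expfz_neq0 // (place_exprz pv) // Em vx.
  rewrite {1}(divz_eq m n%:Z) rmorphD rmorphM /=; field.
  by rewrite pnatr_eq0 -lt0n.
have := modz_ge0 m nZ; rewrite le_eqVlt => /orP [/eqP r0|r0].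
  by rewrite Em {1}(divz_eq m n%:Z) -r0 addr0 rmorphM /= vx mulrA.
have lt : (`|(m %% n%:Z)%Z|%N < n)%N by rewrite -ltz_nat gez0_abs ?(ltW r0) // ltz_pmod.
have nQ : ~ Q `|(m %% n%:Z)%Z|%N by move=> /minn; rewrite leqNgt lt.
case: nQ; apply/boolp.asboolP; split.
  by rewrite absz_gt0 gt_eqF.
exists (f / x ^ (m %/ n%:Z)%Z); split; first by rewrite mulf_neq0 ?invr_eq0 ?expfz_neq0.
by rewrite Er natr_absz gtr0_norm.
Qed.

(** In characteristic zero p can be differentiated until its derivative no longer vanishes at x. *)
Lemma separable_relation F x (p : {poly K}) : subfield_pred iota F -> (forall i, F p`_i) ->
  p != 0 -> p.[x] = 0 -> exists H : {poly K}, [/\ forall i, F H`_i, H.[x] = 0 & H^`().[x] != 0].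
Proof.
move=> sF; have [m] := ubnP (size p); elim: m => // m IH in p *.
move=> sp Fp p0 px; have [d0|d0] := eqVneq p^`().[x] 0; last by exists p.
have sp1 : (1 < size p)%N.
  rewrite ltnNge; apply/negP => s1; move: px p0; rewrite (size1_polyC s1) hornerC => ->.
  by rewrite eqxx.
apply: (IH p^`()) => //.
- have dlt : (size p^`() < size p)%N by apply: lt_size_deriv.
  by apply: leq_trans dlt _; rewrite -ltnS.
- move=> i; rewrite coef_deriv -mulr_natr; apply: (sfM sF) => //.
  by rewrite -(rmorph_nat iota); apply: (sfC sF).
by apply: contraTneq sp1 => /(char0_poly charK); rewrite leqNgt.
Qed.

Let bounded F (C : rat) := 0 <= C /\ forall f, F f -> f != 0 -> vge v (v f - C) (D f).

(** [hensel_coordinate] trades x for a simple root z1 over the local ring, and there the bound for F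
    persists with the same constant. *)
Let step pi F C x (p : {poly K}) : pi != 0 -> 0 < v pi ->
  (forall f, f != 0 -> exists l : int, v f = l%:~R * v pi) ->
  subfield_pred iota F -> F pi -> bounded F C ->
  (forall i, F p`_i) -> p != 0 -> p.[x] = 0 ->
  exists F', [/\ subfield_pred iota F', forall y, F y -> F' y, F' x & bounded F' C].
Proof.
move=> pi0 vpi pg sF Fpi [C0 bF] Fp p0 px.
have [H [FH Hx Hx']] := separable_relation sF Fp p0 px.
have [z0 [l [z1 [h [[Fz0 Ex] iz1 ih hz1 [hd0 hd]]]]]] := hensel_coordinate pv sF Fpi pi0 vpi pg FH Hx Hx'.
have sA := adjoin_subfield sF z1; have subA := adjoin_sub sF z1.
exists (adjoin F z1); split => //.
- rewrite Ex; apply: (sfD sA); first exact: subA.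
  apply: (sfM sA); last exact: (adjoin_gen sF).
  by apply: (sfXz sA); apply: subA.
split => // f Af f0.
have min f' : F f' -> vgt v f' -> vge v (v pi) f' by move=> _; apply: gen_min.
have DFi f' : F f' -> vge v 0 f' -> vge v (- C) (D f').
  move=> Ff' vf'; have [->|f'0] := eqVneq f' 0; first by rewrite (D0 DD) vge_0.
  apply: vge_le (bF _ Ff' f'0); rewrite -[X in X <= _]add0r lerD2r.
  exact: vge_nz vf'.
exact: (smooth_D_val pv sF Fpi pi0 vpi min iz1 ih hz1 hd0 hd DD DM DFi (lexx C) bF Af f0).
Qed.

(** The bound holds on k(pi) and survives the adjunction of t and then of z, which generate K. *)
Lemma special_bound : exists C, forall x, x != 0 -> vge v (v x - C) (D x).
Proof.
have [pi [pi0 vpi pg]] := uniformizer.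
pose C := Num.max 0 (v pi - v (D pi)).
have sF := base_subfield iota pi.
have b0 : bounded (base_field iota pi) C.
  split; first by rewrite /C le_max lexx.
  move=> f hf f0; apply: vge_le (base_D pv pi0 vpi DD DM DC hf f0).
  by rewrite lerD2l lerN2 /C le_max lexx orbT.
have pi_tr (p : {poly k}) : p != 0 -> (map_poly iota p).[pi] != 0.
  move=> p0; have [n [u [u0 _ ->]]] := base_poly pv vpi p0.
  by rewrite mulf_neq0 ?expf_neq0.
have Fpi := base_pi iota pi.
(* t is algebraic over k(pi): read the relation P(t, pi) = 0 as a polynomial in t *)
have [p [Fp p0 pt]] : exists p : {poly K}, [/\ forall i, base_field iota pi p`_i, p != 0 & p.[t] = 0].
  have [P P0 EP] := alg pi.
  pose n := \max_(i < size P) size (P`_i)%R.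
  have sn i : (size (P`_i)%R <= n)%N.
    have [li|li] := ltnP i (size P); last by rewrite nth_default // size_poly0.
    exact: (leq_bigmax (Ordinal li)).
  pose q (l : nat) : {poly k} := \poly_(i < size P) (P`_i)`_l.
  exists (\poly_(l < n) (map_poly iota (q l)).[pi]); split.
  - move=> i; rewrite coef_poly; case: ifP => _; last exact: (sf0 sF).
    exists (q i), 1; rewrite rmorph1 hornerC oner_neq0 divr1; by [].
  - have lc0 : lead_coef P != 0 by rewrite lead_coef_eq0.
    pose l := (size (lead_coef P)).-1.
    have ql0 : q l != 0.
      apply/eqP => /polyP /(_ (size P).-1); rewrite coef_poly coef0 prednK ?size_poly_gt0 // leqnn.
      by rewrite -lead_coefE -lead_coefE => /eqP; rewrite lead_coef_eq0 (negPf lc0).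
    apply/eqP => /polyP /(_ l); rewrite coef_poly coef0.
    have -> : (l < n)%N.
      apply: leq_trans (sn (size P).-1); rewrite -lead_coefE /l prednK ?size_poly_gt0 //.
    by move/eqP; apply/negP; apply: pi_tr.
  rewrite horner_poly -[RHS]EP (ev2E _ _ _ (leqnn _)).
  under eq_bigr => l _ do rewrite (horner_coef_wide (n := size P)) ?(leq_trans (size_poly _ _)) ?size_poly // mulr_suml.
  rewrite exchange_big; apply: eq_bigr => i _ /=.
  rewrite (horner_coef_wide (n := n)); last by apply: leq_trans (size_poly _ _) _.
  rewrite mulr_suml; apply: eq_bigr => l _; rewrite !coef_map coef_poly ltn_ord /=; ring.
have [F1 [sF1 subF1 F1t b1]] := step pi0 vpi pg sF Fpi b0 Fp p0 pt.
have [P P0 EP] := alg z.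
pose p' := map_poly (fun c => (map_poly iota c).[t]) P.
have cp' i : p'`_i = (map_poly iota P`_i).[t] by rewrite coef_map_id0 // rmorph0 horner0.
have [||||F2 [sF2 subF2 F2z b2]] := @step pi F1 C z p' pi0 vpi pg sF1 _ b1.
- exact: subF1.
- move=> i; rewrite cp'; apply: (sf_horner sF1) => // l; rewrite coef_map; exact: (sfC sF1).
- apply: contraNneq (t_tr (_ : lead_coef P != 0)) => [E|]; last by rewrite lead_coef_eq0.
  by rewrite lead_coefE -cp' E coef0.
- by rewrite -EP ev2_horner.
exists C => x; case: b2 => _; apply.
by exact: (gen sF2 (subF2 _ F1t) F2z).
Qed.
End SpecialBound.

(** What the later estimates use about places. In [ff_prod] any finite list containing the support
    may be summed over. D costs a bounded amount at each place, and at most 1 outside finitely many,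
    where moreover the values are integers. *)
Record is_ff (k K : fieldType) (iota : {rmorphism k -> K}) (D : K -> K)
    (Pl : eqType) (vv : Pl -> K -> rat) : Prop := IsFF {
  ffDD : forall x y, D (x + y) = D x + D y;
  ffDM : forall x y, D (x * y) = D x * y + x * D y;
  ffDC : forall c, D (iota c) = 0;
  ff_const : forall x, D x = 0 -> exists c, x = iota c;
  ff_ne : exists p : Pl, True;
  ff_place : forall p, is_place iota (vv p);
  ff_supp : forall x, x != 0 -> exists s : seq Pl, forall p, p \notin s -> vv p x = 0;
  ff_prod : forall x, x != 0 -> forall s : seq Pl, uniq s ->
    (forall p, p \notin s -> vv p x = 0) -> \sum_(p <- s) vv p x = 0;
  ff_bound : forall p, exists C, forall x, x != 0 -> vge (vv p) (vv p x - C) (D x);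
  ff_good : exists s : seq Pl, forall p, p \notin s ->
    [/\ forall x, x != 0 -> exists l : int, vv p x = l%:~R,
        forall x, vge (vv p) 0 x -> vge (vv p) 0 (D x) &
        forall x, x != 0 -> vge (vv p) (vv p x - 1) (D x)]
}.

(* a filtration V_s of K by k-spaces of dimension g * s, nearly stable under multiplication *)
Definition has_growth (k K : fieldType) (iota : {rmorphism k -> K}) (g : nat)
    (bas : nat -> 'I_g -> K) : Prop :=
  [/\ (0 < g)%N,
      forall s (c : 'I_s -> 'I_g -> k), \sum_(a < s) \sum_j iota (c a j) * bas a j = 0 ->
        forall a j, c a j = 0 &
      forall ys : seq K, exists (r : K) (m : nat), r != 0 /\
        forall y, y \in ys -> forall a j, exists c : 'I_(a + m) -> 'I_g -> k,
          r * y * bas a j = \sum_b \sum_l iota (c b l) * bas b l].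

(** * Constants of the derivation *)

Section Constants.
Variables (k : closedFieldType) (hchar : [pchar k] =i pred0) (K : fieldType) (iota : {rmorphism k -> K}) (t : K).
Hypothesis alg : forall y, exists2 P : {poly {poly k}}, P != 0 & ev2 iota t y P = 0.
Variable D : K -> K.
Hypotheses (DD : forall x y, D (x + y) = D x + D y)
  (DM : forall x y, D (x * y) = D x * y + x * D y) (DC : forall c, D (iota c) = 0) (Dt : D t = 1).

(** Since Dx = 0, applying D to P(t, x) = 0 differentiates only the coefficients in t. Descending on
    their total size leaves a relation over [k], which is algebraically closed. *)
Lemma constants_algebraic x : D x = 0 -> exists c, x = iota c.
Proof.
move=> Dx; have [P P0 EP] := alg x.
pose w (P : {poly {poly k}}) := (\sum_(i < size P) size (P`_i)%R)%N.
have [m] := ubnP (w P); elim: m => // m IH in P P0 EP *; rewrite ltnS => wP.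
pose P' := map_poly (@deriv k) P.
have cP' i : P'`_i = (P`_i)^`() by rewrite coef_map_id0 ?deriv0.
have EP' : ev2 iota t x P' = 0.
  have sP' : (size P' <= size P)%N by apply: size_poly.
  rewrite (ev2E _ _ _ sP'); have := congr1 D EP; rewrite (D0 DD) (ev2E _ _ _ (leqnn _)) (D_sum DD) => E.
  rewrite -[RHS]E; apply: eq_bigr => i _.
  rewrite DM (DXn DM) Dx mulr0 mulr0 addr0 (D_poly DD DM DC) Dt mulr1 cP'; by [].
have [P'0|P'0] := eqVneq P' 0; last first.
  apply: (IH P') => //; apply: leq_trans wP.
  have sP' : (size P' <= size P)%N by apply: size_poly.
  have dl (p : {poly k}) : (size p^`() <= size p)%N.
    by have [->|p0] := eqVneq p 0; [rewrite deriv0|apply: ltnW; apply: lt_size_deriv].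
  apply: (@leq_trans (\sum_(i < size P) size (P'`_i)%R).+1).
    rewrite ltnS /w (big_ord_widen _ (fun i => size P'`_i) sP') big_mkcond; apply: leq_sum => i _.
    by case: ifP.
  have lP : ((size P).-1 < size P)%N by rewrite prednK // size_poly_gt0.
  rewrite /w (bigD1 (Ordinal lP)) //= [X in (_ <= X)%N](bigD1 (Ordinal lP)) //= -addSn leq_add //.
    rewrite cP'; apply: lt_size_deriv; by rewrite -lead_coefE lead_coef_eq0.
  by apply: leq_sum => i _; rewrite cP'.
pose Q : {poly k} := map_poly (fun c : {poly k} => c`_0) P.
have cQ i : Q`_i = (P`_i)`_0 by rewrite coef_map_id0 ?coef0.
have PC i : P`_i = (Q`_i)%:P.
  rewrite cQ; apply: size1_polyC; apply: (char0_poly hchar).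
  by rewrite -cP' P'0 coef0.
have Q0 : Q != 0.
  apply: contraNneq P0 => E; apply/eqP/polyP => i; by rewrite PC E !coef0.
have EQ : (map_poly iota Q).[x] = 0.
  rewrite -EP (ev2E _ _ _ (leqnn _)) (horner_coef_wide (n := size P)); last first.
    by apply: leq_trans (size_poly _ _) _; apply: size_poly.
  by apply: eq_bigr => i _; rewrite coef_map /= PC map_polyC hornerC.
have [rs Ers] := closed_field_poly_normal Q.
move: EQ; rewrite Ers map_polyZ hornerZ => /eqP; rewrite mulf_eq0 fmorph_eq0 lead_coef_eq0 (negPf Q0) /=.
rewrite rmorph_prod horner_prod; elim: rs {Ers} => [|c rs IHr]; first by rewrite big_nil oner_eq0.
rewrite big_cons mulf_eq0 => /orP [|/IHr //].
rewrite rmorphB /= map_polyX map_polyC hornerD hornerN hornerX hornerC subr_eq0 => /eqP ->.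
by exists c.
Qed.
End Constants.

(** * Local parameters on the projective line *)

Section ChangeOfVariable.
Variables (k K : fieldType) (iota : {rmorphism k -> K}) (t : K).
Hypothesis t_tr : forall p : {poly k}, p != 0 -> (map_poly iota p).[t] != 0.

(** [None] stands for the point at infinity. *)
Definition loc_par (a : option k) : K := if a is Some c then t - iota c else t^-1.

Let t0 : t != 0.
Proof. by have := t_tr (negbT (polyX_eq0 k)); rewrite map_polyX hornerX. Qed.

(** The reversal X^(M-1) p(1/X), with M independent of p so that all coefficients of a relation are
    scaled by the same power of t. *)
Definition rev_poly (M : nat) (p : {poly k}) : {poly k} := \poly_(l < M) p`_(M.-1 - l).

Lemma rev_polyE M (p : {poly k}) : (size p <= M)%N ->
  (map_poly iota (rev_poly M p)).[t^-1] * t ^+ M.-1 = (map_poly iota p).[t].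
Proof.
move=> sp; rewrite (horner_coef_wide (n := M)); last first.
  by apply: leq_trans (size_poly _ _) _; apply: size_poly.
rewrite [RHS](horner_coef_wide (n := M)); last by apply: leq_trans (size_poly _ _) _.
rewrite mulr_suml (reindex_inj rev_ord_inj); apply: eq_bigr => l _.
rewrite !coef_map coef_poly /=.
have lM := ltn_ord l; have -> : (M - l.+1 < M)%N by lia.
have -> : (M.-1 - (M - l.+1) = l)%N by lia.
rewrite -mulrA; congr (_ * _); rewrite exprVn.
have -> : M.-1 = (l + (M - l.+1))%N by lia.
by rewrite exprD mulrCA mulVf ?expf_neq0 // mulr1.
Qed.

Lemma rev_poly_neq0 M (p : {poly k}) : (size p <= M)%N -> p != 0 -> rev_poly M p != 0.
Proof.
move=> sp p0; apply: contraNneq (t_tr p0) => E.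
by rewrite -(rev_polyE sp) E rmorph0 horner0 mul0r.
Qed.

Lemma loc_par_tr a (p : {poly k}) : p != 0 -> (map_poly iota p).[loc_par a] != 0.
Proof.
case: a => [a|] p0 /=.
  have -> : t - iota a = (map_poly iota ('X - a%:P)).[t].
    by rewrite rmorphB /= map_polyX map_polyC hornerD hornerN hornerX hornerC.
  rewrite -horner_comp -map_comp_poly; apply: t_tr.
  by rewrite -size_poly_eq0 size_comp_poly2 ?size_XsubC // size_poly_eq0.
have := rev_polyE (leqnn (size p)); set q := rev_poly _ _ => E.
apply/eqP => E0.
(* p(1/t) = 0 would give rev p (t) = 0 *)
have rr : (map_poly iota q).[t] = (map_poly iota p).[t^-1] * t ^+ (size p).-1.
  rewrite -(@rev_polyE (size p)); last exact: size_poly.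
  congr ((map_poly iota _).[_] * _); apply/polyP => i; rewrite /rev_poly coef_poly.
  case: ltnP => li; last by rewrite nth_default.
  rewrite coef_poly; have -> : ((size p).-1 - i < size p)%N by lia.
  by congr (_`_ _); lia.
have : (map_poly iota q).[t] != 0 by apply: t_tr; apply: rev_poly_neq0.
by rewrite rr E0 mul0r eqxx.
Qed.

Lemma relation_loc_par a y (P : {poly {poly k}}) : P != 0 -> ev2 iota t y P = 0 ->
  exists P' : {poly {poly k}}, [/\ P' != 0, (size P' <= size P)%N & ev2 iota (loc_par a) y P' = 0].
Proof.
move=> P0 EP; have lc0 : lead_coef P != 0 by rewrite lead_coef_eq0.
have conv (f : {poly k} -> {poly k}) (e : K) : f 0 = 0 -> (f (lead_coef P) != 0) ->
    (forall i, (map_poly iota (f P`_i)).[loc_par a] * e = (map_poly iota P`_i).[t]) -> e != 0 ->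
    exists P' : {poly {poly k}}, [/\ P' != 0, (size P' <= size P)%N & ev2 iota (loc_par a) y P' = 0].
  move=> f0 fl fE e0; exists (map_poly f P); split; last 2 first.
  - exact: size_poly.
  - apply: (mulIf e0); rewrite mul0r -[RHS]EP (ev2E _ _ _ (size_poly _ _)) (ev2E _ _ _ (leqnn _)) mulr_suml.
    by apply: eq_bigr => i _; rewrite coef_map_id0 // mulrAC fE.
  apply: contraNneq fl => E; have := congr1 (fun q : {poly {poly k}} => q`_(size P).-1) E.
  by rewrite coef_map_id0 // coef0 -lead_coefE => ->.
case: a conv => [a|] conv /=.
  apply: (conv (fun c => c \Po ('X + a%:P)) 1); rewrite ?comp_poly0 ?oner_neq0 //.
    by rewrite -size_poly_eq0 size_comp_poly2 ?size_XaddC // size_poly_eq0.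
  move=> i; rewrite mulr1 map_comp_poly horner_comp rmorphD /= map_polyX map_polyC.
  by rewrite hornerD hornerX hornerC subrK.
pose M := \max_(i < size P) size (P`_i)%R.
have sM i : (size (P`_i)%R <= M)%N.
  have [li|li] := ltnP i (size P); last by rewrite nth_default // size_poly0.
  exact: (leq_bigmax (Ordinal li)).
apply: (conv (rev_poly M) (t ^+ M.-1)); last exact: expf_neq0.
- by apply/polyP => i; rewrite coef_poly !coef0; case: ifP.
- by apply: rev_poly_neq0 => //; rewrite lead_coefE.
by move=> i; apply: rev_polyE.
Qed.
End ChangeOfVariable.

(** If x had a pole, dividing the equation by its top power would write the leading coefficient, a
    unit, as an integral combination of positive powers of 1/x. *)
Lemma integral_place (k K : fieldType) (iota : {rmorphism k -> K}) (v : K -> rat) (p : {poly K}) x :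
  is_place iota v -> (forall i, vge v 0 p`_i) -> lead_coef p != 0 -> v (lead_coef p) = 0 -> p.[x] = 0 ->
  vge v 0 x.
Proof.
move=> pv hp l0 vl px; have [->|x0] := eqVneq x 0; first exact: vge_0.
rewrite /vge (negPf x0) /= leNgt; apply/negP => vx.
have sp : (0 < size p)%N by rewrite size_poly_gt0 -lead_coef_eq0.
pose m := (size p).-1.
have E : lead_coef p = - \sum_(i < m) p`_i * x^-1 ^+ (m - i).
  apply/eqP; rewrite -addr_eq0 addrC; apply/eqP.
  have := px; rewrite horner_coef -(prednK sp) big_ord_recr /= -lead_coefE => Ep.
  have xm : x ^+ m != 0 by rewrite expf_neq0.
  apply: (mulIf xm); rewrite mul0r -[RHS]Ep mulrDl mulr_suml; congr (_ + _).
  apply: eq_bigr => i _; rewrite -mulrA exprVn; congr (_ * _).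
  have im : (i <= m)%N by apply: ltnW; apply: ltn_ord.
  have -> : x ^+ m = x ^+ (m - i) * x ^+ i by rewrite -exprD subnK.
  by rewrite mulKf ?expf_neq0.
have mV : vgt v x^-1 by rewrite /vgt (placeV pv) // oppr_gt0 vx orbT.
have mS : vgt v (\sum_(i < m) p`_i * x^-1 ^+ (m - i)).
  elim/big_ind: _ => [|a b|i _]; [by rewrite /vgt eqxx|exact: (vgtD pv)|].
  apply: (vgtMr pv) => //.
  have -> : (m - i = (m - i).-1.+1)%N by rewrite prednK // subn_gt0 ltn_ord.
  by rewrite exprSr; apply: (vgtMr pv) => //; apply: (vge0X pv); apply: vgt_ge.
by move: mS; rewrite -(vgtN pv) -E /vgt (negPf l0) vl ltxx.
Qed.

(** * The places of K and the product formula *)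

Section Assembly.
Variables (k : closedFieldType) (hchar : [pchar k] =i pred0)
  (K : fieldType) (iota : {rmorphism k -> K}) (L : closedFieldType) (j : {rmorphism K -> L}).
Variables (t z : K) (n : nat).
Hypotheses (t_tr : forall p : {poly k}, p != 0 -> (map_poly iota p).[t] != 0)
  (rep : forall y, exists (P : {poly {poly k}}) (c : {poly k}),
        c != 0 /\ y * (map_poly iota c).[t] = ev2 iota t z P)
  (rel : forall y, exists P : {poly {poly k}}, [/\ P != 0, (size P <= n.+1)%N & ev2 iota t y P = 0]).
Variable H : {poly {poly k}}.
Hypotheses (H0 : H != 0) (EH : ev2 iota t z H = 0)
  (minH : forall P, P != 0 -> ev2 iota t z P = 0 -> (size H <= size P)%N).
Let N := (size H).-1.
Variable D : K -> K.
Hypotheses (DD : forall x y, D (x + y) = D x + D y)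
  (DM : forall x y, D (x * y) = D x * y + x * D y) (DC : forall c, D (iota c) = 0) (Dt : D t = 1).
Local Notation evt c := ((map_poly iota c).[t]).
Local Notation kap := (j \o iota : {rmorphism k -> L}).

Variable sigma : 'I_N -> {rmorphism K -> L}.
Hypotheses (sc : forall i c, sigma i (iota c) = kap c) (st : forall i, sigma i t = j t)
  (sz : injective (fun i => sigma i z)).

Let charK : [pchar K] =i pred0.
Proof. by move=> p; rewrite (fmorph_pchar iota); apply: hchar. Qed.

Let alg y : exists2 P : {poly {poly k}}, P != 0 & ev2 iota t y P = 0.
Proof. by have [P [P0 _ E]] := rel y; exists P. Qed.

Let N0 : (0 < N)%N.
Proof. by rewrite /N -subn1 subn_gt0; apply: (size_H_gt1 t_tr H0 EH). Qed.

Let gen F : subfield_pred iota F -> F t -> F z -> forall x, F x.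
Proof.
move=> sF Ft Fz x; have [P [c [c0 E]]] := rep x.
have Fe (p : {poly k}) : F (evt p).
  by apply: (sf_horner sF) => // i; rewrite coef_map; apply: (sfC sF).
have -> : x = ev2 iota t z P / evt c by rewrite -E mulfK // t_tr.
apply: (sfM sF); last by apply: (sfV sF).
rewrite (ev2E _ _ _ (leqnn _)); apply: (sf_sum sF) => i _; apply: (sfM sF) => //.
exact: (sfX sF).
Qed.

Let spar (a : option k) := loc_par iota t a.

Let sigma_spar i a : sigma i (spar a) = j (spar a).
Proof. by case: a => [a|] /=; rewrite ?rmorphB ?fmorphV st ?sc. Qed.

Variables (v : option k -> L -> rat) (hv : option k -> L -> Prop).
Hypothesis Hv : forall a, [/\ forall x (P : {poly {poly k}}), x != 0 -> P != 0 ->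
        poly2_eval kap (j (spar a)) P x = 0 ->
        hv a x /\ exists (b : nat) (l : int), (0 < b < size P)%N /\ v a x = l%:~R / b%:R,
      forall x y, hv a x -> hv a y -> hv a (x * y) /\ v a (x * y) = v a x + v a y,
      forall x y, hv a x -> hv a y -> hv a (x - y) -> Num.min (v a x) (v a y) <= v a (x - y),
      (forall c, c != 0 -> hv a (kap c) /\ v a (kap c) = 0) /\ (hv a (j (spar a)) /\ v a (j (spar a)) = 1) &
      forall x, alg_over kap (j (spar a)) x -> hv a x -> 0 <= v a x ->
        exists c, hv a (x - kap c) -> 0 < v a (x - kap c)].

(* A place is a point of P^1 with one of the N embeddings of K over k(t); conjugate
   embeddings repeat a place, which accounts for its multiplicity in the product formula. *)
Definition vplace (p : option k * 'I_N) (x : K) : rat := v p.1 (sigma p.2 x).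

Let relL a i x : x != 0 -> exists P : {poly {poly k}},
  [/\ P != 0, (size P <= n.+1)%N & poly2_eval kap (j (spar a)) P (sigma i x) = 0].
Proof.
move=> x0; have [P [P0 sP EP]] := rel x.
have [P' [P'0 sP' EP']] := relation_loc_par t_tr a P0 EP.
exists P'; split => //; first exact: leq_trans sP' sP.
rewrite -[RHS](rmorph0 (sigma i)) -EP' -[LHS](ev2_horner kap (j (spar a)) (sigma i x)).
rewrite !(ev2E _ _ _ (leqnn _)) rmorph_sum; apply: eq_bigr => l _.
rewrite rmorphM rmorphXn /= -horner_map sigma_spar -map_poly_comp /=; congr (_.[_] * _).
by apply: eq_map_poly => c /=; rewrite sc.
Qed.

Let hvs a i x : x != 0 -> hv a (sigma i x).
Proof.
move=> x0; have [P [P0 _ EP]] := relL a i x0; have [h _ _ _ _] := Hv a.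
by have [] := h (sigma i x) P _ P0 EP; rewrite ?fmorph_eq0.
Qed.

Lemma vplace_place p : is_place iota (vplace p).
Proof.
case: p => a i; have [h1 h2 h3 [h4 _] h5] := Hv a; rewrite /vplace /=; split.
- move=> x y x0 y0; rewrite rmorphM.
  by have [_ ->] := h2 _ _ (hvs a i x0) (hvs a i y0).
- by move=> x y x0 y0 xy0; rewrite rmorphB; apply: h3; rewrite -?rmorphB; apply: hvs.
- by move=> c c0; rewrite sc; have [_ ->] := h4 c c0.
move=> x x0 vx; have [P [P0 _ EP]] := relL a i x0.
have [|c hc] := h5 (sigma i x) _ (hvs a i x0) vx; first by exists P.
exists c; have [E|xc] := eqVneq (x - iota c) 0.
  by left; apply/eqP; rewrite -subr_eq0 E.
by right; rewrite rmorphB sc; apply: hc; rewrite -(sc i) -rmorphB; apply: hvs.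
Qed.

Lemma vplace_spar a i : vplace (a, i) (spar a) = 1.
Proof. by rewrite /vplace /= sigma_spar; have [_ _ _ [_ [_ ->]] _] := Hv a. Qed.

Let spar0 a : spar a != 0.
Proof. by have := loc_par_tr t_tr a (negbT (polyX_eq0 k)); rewrite map_polyX hornerX. Qed.

(** A value is l / b with b at most n, the degree bound of the relations, so b divides n!. *)
Lemma vplace_disc p x : x != 0 -> exists m : int, vplace p x = m%:~R / (n`!)%:R.
Proof.
case: p => a i x0; have [P [P0 sP EP]] := relL a i x0; have [h _ _ _ _] := Hv a.
have sx0 : sigma i x != 0 by rewrite fmorph_eq0.
have [_ [b [l [/andP [b0 bs] E]]]] := h _ P sx0 P0 EP.
have bn : (b %| n`!)%N by apply: dvdn_fact; rewrite b0 -ltnS (leq_trans bs).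
have Ef : (n`!)%:R = (n`! %/ b)%N%:R * b%:R :> rat by rewrite -natrM divnK.
exists (l * (n`! %/ b)%N%:Z); rewrite /vplace /= E Ef rmorphM /= -pmulrn.
have fb : (n`! %/ b)%N%:R != 0 :> rat by rewrite pnatr_eq0 -lt0n divn_gt0 // dvdn_leq // fact_gt0.
by field; rewrite ?fb ?andbT ?pnatr_eq0 -?lt0n ?b0 ?fb.
Qed.

Lemma vplace_bound p : exists C, forall x, x != 0 -> vge (vplace p) (vplace p x - C) (D x).
Proof.
have pv := vplace_place p; have dv := @vplace_disc p.
apply: (special_bound charK pv (fact_gt0 n) dv _ gen alg t_tr DD DM DC).
by exists (spar p.1); rewrite spar0; case: p {pv dv} => a i; rewrite vplace_spar.
Qed.

Lemma vplace_t a i c : vplace (Some a, i) (t - iota c) = (a == c)%:R.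
Proof.
have pv := vplace_place (Some a, i); have v1 := vplace_spar (Some a) i.
have [<-|ac] := eqVneq a c; first exact: v1.
have -> : t - iota c = iota (a - c) - - (t - iota a) by rewrite rmorphB /=; ring.
have [|||_ ->] // := @unit_sub_max _ _ _ _ pv (iota (a - c)) (- (t - iota a)).
- by rewrite fmorph_eq0 subr_eq0.
- by apply: (placeC pv); rewrite subr_eq0.
by rewrite (vgtN pv) /vgt v1 ltr01 orbT.
Qed.

Lemma vplace_tinf i c : vplace (None, i) (t - iota c) = -1.
Proof.
have pv := vplace_place (None, i); have v1 := vplace_spar None i.
have t0 : t != 0 by have := t_tr (negbT (polyX_eq0 k)); rewrite map_polyX hornerX.
have vt : vplace (None, i) t = -1.
  by rewrite -[t]invrK (placeV pv) ?invr_eq0 // v1.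
have [|||u0 u1] := @unit_sub_max _ _ _ _ pv 1 (iota c * t^-1); rewrite ?oner_neq0 ?(place1 pv) //.
  by apply: (vgtMr pv); [apply: (vge_iota pv)|rewrite /vgt v1 ltr01 orbT].
have -> : t - iota c = t * (1 - iota c * t^-1) by field.
by rewrite (placeM pv) // vt u1 addr0.
Qed.

Lemma evt_factor (p : {poly k}) : p != 0 -> exists (c : k) (rs : seq k),
  [/\ c != 0, evt p = iota c * \prod_(r <- rs) (t - iota r) & forall a, root p a = (a \in rs)].
Proof.
move=> p0; have [rs Ers] := closed_field_poly_normal p.
exists (lead_coef p), rs; rewrite lead_coef_eq0; split => //.
  rewrite {1}Ers map_polyZ hornerZ rmorph_prod horner_prod; congr (_ * _).
  apply: eq_bigr => r _; rewrite rmorphB /= map_polyX map_polyC.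
  by rewrite hornerD hornerN hornerX hornerC.
by move=> a; rewrite Ers rootZ ?lead_coef_eq0 // root_prod_XsubC.
Qed.

Let tr r : t - iota r != 0.
Proof.
have := t_tr (negbT (polyXsubC_eq0 r)).
by rewrite rmorphB /= map_polyX map_polyC hornerD hornerN hornerX hornerC.
Qed.

Lemma vplace_evt p (q : {poly k}) c rs : c != 0 -> evt q = iota c * \prod_(r <- rs) (t - iota r) ->
  vplace p (evt q) = \sum_(r <- rs) vplace p (t - iota r).
Proof.
move=> c0 ->; have pv := vplace_place p.
rewrite (placeM pv) ?fmorph_eq0 // ?(placeC pv) // ?add0r ?(place_prod pv) //.
by rewrite prodf_seq_neq0; apply/allP => r _; apply: tr.
Qed.

Lemma vplace_evt_unit a i (q : {poly k}) : q != 0 -> ~~ root q a -> vplace (Some a, i) (evt q) = 0.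
Proof.
move=> q0 ra; have [c [rs [c0 E rr]]] := evt_factor q0.
rewrite (vplace_evt _ c0 E) big_seq big1 // => r rin; rewrite vplace_t.
by case: eqP => // ar; move: ra; rewrite rr ar rin.
Qed.

Lemma vplace_t_int a i : vge (vplace (Some a, i)) 0 t.
Proof.
have pv := vplace_place (Some a, i); have v1 := vplace_spar (Some a) i.
rewrite -[t](subrK (iota a)); apply: (vgeD pv); last exact: (vge_iota pv).
by rewrite /vge v1 ler01 orbT.
Qed.

Lemma vplace_evt_int a i (q : {poly k}) : vge (vplace (Some a, i)) 0 (evt q).
Proof.
have pv := vplace_place (Some a, i); apply: (vge_horner pv) => [l|].
  by rewrite coef_map; apply: (vge_iota pv).
exact: vplace_t_int.
Qed.

(** The relation P(t, x) = 0 makes x integral wherever its leading coefficient does not vanish. *)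
Lemma vplace_int x : exists B : seq k, forall a i, a \notin B -> vge (vplace (Some a, i)) 0 x.
Proof.
have [P [P0 _ EP]] := rel x; have l0 : lead_coef P != 0 by rewrite lead_coef_eq0.
have [c [rs [c0 E rr]]] := evt_factor l0; exists rs => a i aB.
pose p := map_poly (horner_eval t \o map_poly iota) P.
have cp l : p`_l = evt P`_l by rewrite coef_map.
have lp : lead_coef p = evt (lead_coef P).
  by rewrite lead_coef_map_eq //= horner_evalE t_tr.
apply: (@integral_place _ _ iota _ p _ (vplace_place _)).
- by move=> l; rewrite cp; apply: vplace_evt_int.
- by rewrite lp t_tr.
- by rewrite lp vplace_evt_unit // rr.
by rewrite -ev2_horner.
Qed.

Lemma vplace_supp x : x != 0 -> exists s : seq (option k * 'I_N), forall p, p \notin s -> vplace p x = 0.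
Proof.
move=> x0; have [B HB] := vplace_int x; have [B' HB'] := vplace_int x^-1.
exists [seq (a, i) | a <- None :: map Some (B ++ B'), i <- enum 'I_N] => -[a i].
move=> nin; have na : a \notin None :: map Some (B ++ B').
  apply: contra nin => ain; apply/allpairsP; exists (a, i); split => //.
  by rewrite mem_enum.
case: a na {nin} => [a|]; last by rewrite inE eqxx.
rewrite inE /= mem_map; last by move=> ? ? [].
rewrite mem_cat negb_or => /andP [/(HB a i) h /(HB' a i) h'].
have pv := vplace_place (Some a, i).
have := vge_nz x0 h; have := vge_nz (_ : x^-1 != 0) h'; rewrite invr_eq0 => /(_ x0).
by rewrite (placeV pv) // oppr_ge0 => h1 h2; apply/eqP; rewrite eq_le h1 h2.
Qed.

Let i0 : 'I_N := Ordinal N0.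

Let hv_prod a (x : K) (s : seq 'I_N) : x != 0 -> 
  hv a (\prod_(i <- s) sigma i x) /\ v a (\prod_(i <- s) sigma i x) = \sum_(i <- s) vplace (a, i) x.
Proof.
move=> x0; have [_ h2 _ [h4 _] _] := Hv a.
elim: s => [|i s [IH1 IH2]].
  by rewrite !big_nil; have := h4 1 (oner_neq0 _); rewrite rmorph1.
rewrite !big_cons; have [h h'] := h2 _ _ (hvs a i x0) IH1.
by rewrite h' IH2.
Qed.

(** The product of the conjugates of x is q(t) / r(t), on which all embeddings agree, so the single
    index [i0] computes its value. *)
Lemma vplace_norm x : x != 0 -> exists (q r : {poly k}), [/\ q != 0, r != 0 & forall a,
  \sum_i vplace (a, i) x = vplace (a, i0) (evt q) - vplace (a, i0) (evt r)].
Proof.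
move=> x0; have [q [r [q0 r0 E]]] := norm_ratfun t_tr rep H0 EH sc st sz x0.
exists q, r; split => // a.
have [_ h2 _ _ _] := Hv a.
have [hp vp] := hv_prod a (index_enum 'I_N) x0.
have ej (p : {poly k}) : (map_poly kap p).[j t] = sigma i0 (evt p).
  by rewrite -horner_map st -map_poly_comp; congr (_.[_]); apply: eq_map_poly => c /=; rewrite sc.
move: E; rewrite !ej => E; have := h2 _ _ hp (hvs a i0 (t_tr r0)).
rewrite E => -[_ E']; apply/eqP; rewrite eq_sym subr_eq -vp; apply/eqP; exact: E'.
Qed.

(** Through the norm this reduces to the projective line, where the zero of t - b at b is balanced
    by its pole at infinity. *)
Lemma vplace_prod x : x != 0 -> forall s : seq (option k * 'I_N), uniq s ->
  (forall p, p \notin s -> vplace p x = 0) -> \sum_(p <- s) vplace p x = 0.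
Proof.
move=> x0 s us hs; have [q [r [q0 r0 En]]] := vplace_norm x0.
have [c [rs [c0 Eq _]]] := evt_factor q0; have [c' [rs' [c'0 Er _]]] := evt_factor r0.
pose T := undup (pmap fst s ++ rs ++ rs').
pose A := None :: map Some T.
have uA : uniq A.
  rewrite /= map_inj_uniq ?undup_uniq ?andbT; last by move=> ? ? [].
  by apply/negP => /mapP [].
pose s' := [seq (a, i) | a <- A, i <- enum 'I_N].
have us' : uniq s' by apply: allpairs_uniq; rewrite ?enum_uniq // => -[? ?] [? ?] _ _.
have sub p : p \in s -> p \in s'.
  case: p => a i ps; apply/allpairsP; exists (a, i); rewrite mem_enum /=; split => //.
  case: a ps => [a|] ps; rewrite inE //=; rewrite mem_map; last by move=> ? ? [].
  rewrite mem_undup mem_cat; apply/orP; left; rewrite mem_pmap; apply/mapP.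
  by exists (Some a, i).
have -> : \sum_(p <- s) vplace p x = \sum_(p <- s') vplace p x.
  rewrite [RHS](bigID (mem s)) /= [X in _ + X]big1 => [|p /hs //]; rewrite addr0.
  rewrite -[RHS]big_filter; apply: perm_big; apply: uniq_perm => //; first by apply: filter_uniq.
  move=> p; rewrite mem_filter; case: (boolP (p \in s)) => // /sub ->; by [].
rewrite big_allpairs /=; under eq_bigr => a _ do rewrite big_enum /= En.
rewrite sumrB.
have zero (p : {poly k}) e ps : e != 0 -> evt p = iota e * \prod_(b <- ps) (t - iota b) ->
    {subset ps <= T} -> \sum_(a <- A) vplace (a, i0) (evt p) = 0.
  move=> e0 Ep sT; under eq_bigr => a _ do rewrite (vplace_evt _ e0 Ep).
  rewrite exchange_big /= big_seq big1 // => b bps.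
  rewrite big_cons vplace_tinf big_map; under eq_bigr => a _ do rewrite vplace_t.
  rewrite (bigD1_seq b) ?undup_uniq //=; last exact: sT.
  rewrite eqxx big1 => [|a /negPf -> //]; by rewrite addr0 addNr.
rewrite (zero _ _ _ c0 Eq) ?(zero _ _ _ c'0 Er) ?subrr // => b bin.
  by rewrite mem_undup !mem_cat bin !orbT.
by rewrite mem_undup !mem_cat bin !orbT.
Qed.

(** Away from infinity, the poles of z and the zeros and poles of H'(z), the element t - a is a
    uniformizer of k(t) with derivative 1 and z is a simple root over the local ring, so K is
    unramified over k(t) there. *)
Lemma vplace_good : exists s : seq (option k * 'I_N), forall p, p \notin s ->
    [/\ forall x, x != 0 -> exists l : int, vplace p x = l%:~R,
        forall x, vge (vplace p) 0 x -> vge (vplace p) 0 (D x) &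
        forall x, x != 0 -> vge (vplace p) (vplace p x - 1) (D x)].
Proof.
have [s0 Hs0] := vplace_supp (ev_dH hchar t_tr H0 EH minH).
have [B HB] := vplace_int z.
exists (s0 ++ [seq (a, i) | a <- None :: map Some B, i <- enum 'I_N]) => -[a i].
rewrite mem_cat negb_or => /andP [/Hs0 vdH nin].
have na : a \notin None :: map Some B.
  apply: contra nin => ain; apply/allpairsP; exists (a, i); split => //.
  by rewrite mem_enum.
case: a na vdH {nin} => [a|]; last by rewrite inE eqxx.
rewrite inE /= mem_map; last by move=> ? ? [].
move=> /(HB a i) iz vdH.
have pv := vplace_place (Some a, i); have vpi := vplace_spar (Some a) i.
set w := vplace (Some a, i) in pv vpi iz vdH *.
pose pi := t - iota a; rewrite -[spar _]/pi in vpi.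
have pi0 : pi != 0 by apply: tr.
have vpi0 : 0 < w pi by rewrite vpi.
have sF := base_subfield iota pi; have Fpi := base_pi iota pi.
have Ft : base_field iota pi t.
  by rewrite -[t](subrK (iota a)); apply: (sfD sF) => //; apply: (sfC sF).
have pmin f : base_field iota pi f -> vgt w f -> vge w (w pi) f.
  move=> Ff mf; have [->|f0] := eqVneq f 0; first exact: vge_0.
  have [l El] := base_val pv pi0 vpi0 Ff f0.
  move: mf; rewrite /vgt /vge (negPf f0) El vpi mulr1 /= ltr0z => l0.
  by rewrite ler1z -gtz0_ge1.
pose h := map_poly (horner_eval t \o map_poly iota) H.
have ih l : int_in w (base_field iota pi) h`_l.
  rewrite coef_map /= horner_evalE; split; last exact: vplace_evt_int.
  by apply: (sf_horner sF) => // m; rewrite coef_map; apply: (sfC sF).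
have hz : h.[z] = 0 by rewrite -ev2_horner.
have hd : h^`().[z] = ev2 iota t z H^`() by rewrite ev2_horner deriv_map.
have hd0 : h^`().[z] != 0 by rewrite hd (ev_dH hchar t_tr H0 EH minH).
have hdv : w h^`().[z] = 0 by rewrite hd.
have Dpi : D pi = 1 by rewrite (DB DD) Dt DC subr0.
have w1 := place1 pv.
have adj x : adjoin (base_field iota pi) z x.
  apply: (gen (adjoin_subfield sF z)); [exact: (adjoin_sub sF)|exact: (adjoin_gen sF)].
have DFi f : base_field iota pi f -> vge w 0 f -> vge w (- 0) (D f).
  by rewrite oppr0; apply: (base_D_int pv pi0 vpi0 DD DM DC); rewrite Dpi /vge w1 lexx orbT.
split.
- move=> x x0; have [c [Fc c0] ->] := smooth_val pv sF Fpi pi0 vpi0 pmin iz ih hz hd0 hdv (adj x) x0.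
  by have [l ->] := base_val pv pi0 vpi0 Fc c0; exists l; rewrite vpi mulr1.
- move=> x ix; rewrite -oppr0.
  exact: (smooth_D_int pv sF Fpi pi0 vpi0 pmin iz ih hz hd0 hdv DD DM DFi (lexx 0) (adj x) ix).
move=> x x0; apply: (smooth_D_val pv sF Fpi pi0 vpi0 pmin iz ih hz hd0 hdv DD DM DFi ler01 _ (adj x) x0).
move=> c Fc c0; have := base_D pv pi0 vpi0 DD DM DC Fc c0.
by rewrite Dpi w1 vpi subr0.
Qed.

Lemma vplace_ff : is_ff iota D vplace.
Proof.
split => //.
- exact: (constants_algebraic hchar alg DD DM DC Dt).
- by exists (None, i0).
- exact: vplace_place.
- exact: vplace_supp.
- exact: vplace_prod.
- exact: vplace_bound.
exact: vplace_good.
Qed.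
End Assembly.

(** * A k-basis with controlled multiplication *)

Section Growth.
Variables (k : closedFieldType) (K : fieldType) (iota : {rmorphism k -> K}) (t z : K).
Hypotheses (t_tr : forall p : {poly k}, p != 0 -> (map_poly iota p).[t] != 0)
  (rep : forall y, exists (P : {poly {poly k}}) (c : {poly k}),
        c != 0 /\ y * (map_poly iota c).[t] = ev2 iota t z P).
Variable H : {poly {poly k}}.
Hypotheses (H0 : H != 0) (EH : ev2 iota t z H = 0)
  (minH : forall P, P != 0 -> ev2 iota t z P = 0 -> (size H <= size P)%N).
Let N := (size H).-1.
Local Notation evt c := ((map_poly iota c).[t]).

Definition tz_basis (a : nat) (i : 'I_N) : K := t ^+ a * z ^+ i.

Let ev_expand (P : {poly {poly k}}) s : (size P <= N)%N -> (forall i, (size (P`_i)%R <= s)%N) ->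
  ev2 iota t z P = \sum_(a < s) \sum_(i < N) iota (P`_i)`_a * tz_basis a i.
Proof.
move=> sP ss; rewrite (ev2E _ _ _ sP) exchange_big; apply: eq_bigr => i _ /=.
rewrite (horner_coef_wide (n := s)); last by apply: leq_trans (size_poly _ _) (ss i).
by rewrite mulr_suml; apply: eq_bigr => a _; rewrite coef_map /tz_basis mulrA.
Qed.

(** A relation among the t^a z^i would be shorter than H. After multiplication by a common
    denominator, y z^l reduces modulo H to coefficients of bounded degree in t, and the factor t^a
    only shifts degrees. *)
Lemma tz_growth : has_growth iota tz_basis.
Proof.
split.
- by rewrite /N -subn1 subn_gt0; apply: (size_H_gt1 t_tr H0 EH).
- move=> s c E a i.
  pose P : {poly {poly k}} := \poly_(i < N) \poly_(a < s)
    (if insub a is Some a' then if insub i is Some i' then c a' i' else 0 else 0).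
  have cP (a' : 'I_s) (i' : 'I_N) : (P`_i')`_a' = c a' i'.
    by rewrite coef_poly ltn_ord coef_poly ltn_ord !valK.
  have sP : (size P <= N)%N by apply: size_poly.
  have E0 : ev2 iota t z P = 0.
    rewrite (@ev_expand P s sP); last first.
      by move=> l; rewrite coef_poly; case: ifP => _; [apply: size_poly|rewrite size_poly0].
    by rewrite -[RHS]E; apply: eq_bigr => a' _; apply: eq_bigr => i' _; rewrite cP.
  have [P0|P0] := eqVneq P 0; first by rewrite -cP P0 !coef0.
  by have := ev_small t_tr H0 EH minH P0 sP; rewrite E0 eqxx.
have one y : exists (e : {poly k}) (m : nat), e != 0 /\ forall a (l : 'I_N), exists P' : {poly {poly k}},
    [/\ (size P' <= N)%N, forall i, (size (P'`_i)%R <= a + m)%N & evt e * y * tz_basis a l = ev2 iota t z P'].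
  have [P [c0 [c00 E]]] := rep y.
  have red (l : 'I_N) : exists (R : {poly {poly k}}) (c : {poly k}), [/\ c != 0, (size R <= N)%N &
      z ^+ l * ev2 iota t z P * evt c = ev2 iota t z R].
    have [Q [R [c [cn0 ER sR]]]] := pseudo_div t_tr H0 EH ('X^l * P).
    exists R, c; split => //; have := congr1 (ev2 iota t z) ER.
    rewrite rmorphD !rmorphM EH mulr0 add0r rmorphXn ev2X ev2C => <-; by rewrite mulrC.
  have [R HR] := fin_all_exists red; have [c Hc] := fin_all_exists HR.
  pose C := \prod_l c l.
  have C0 : C != 0 by apply/prodf_neq0 => l _; have [] := Hc l.
  pose R' (l : 'I_N) : {poly {poly k}} := (\prod_(l' | l' != l) c l')%:P * R l.
  have sR' l : (size (R' l) <= N)%N.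
    have [_ sR _] := Hc l; rewrite /R' mul_polyC; apply: leq_trans (size_scale_leq _ _) sR.
  have ER' (l : 'I_N) : z ^+ l * ev2 iota t z P * evt C = ev2 iota t z (R' l).
    have [_ _ El] := Hc l; rewrite /C (bigD1 l) //= rmorphM hornerM mulrA El.
    by rewrite /R' rmorphM ev2C mulrC.
  pose m := (\max_(l < N) \max_(i < N) size ((R' l)`_i)%R)%N.
  exists (c0 * C), m; split; first by rewrite mulf_neq0.
  move=> a l; pose P' : {poly {poly k}} := ('X^a)%:P * R' l; exists P'; split.
  - by rewrite /P' mul_polyC; apply: leq_trans (size_scale_leq _ _) (sR' l).
  - move=> i; rewrite coefCM; have [Ri0|Ri0] := eqVneq (R' l)`_i 0.
      by rewrite Ri0 mulr0 size_poly0.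
    rewrite mulrC size_mulXn // leq_add2l.
    have [li|li] := ltnP i N; last by move: Ri0; rewrite nth_default ?eqxx //; apply: leq_trans (sR' l) li.
    apply: leq_trans (leq_bigmax (F := fun l => \max_(i < N) size ((R' l)`_i)%R) l).
    exact: (leq_bigmax (F := fun i : 'I_N => size ((R' l)`_i)%R) (Ordinal li)).
  rewrite /P' rmorphM (rmorphM (ev2 iota t z)) hornerM ev2C map_polyXn hornerXn -ER' -E /tz_basis; ring.
move=> ys; suff [e [m [e0 He]]] : exists (e : {poly k}) (m : nat), e != 0 /\ forall y, y \in ys ->
    forall a (l : 'I_N), exists P' : {poly {poly k}},
    [/\ (size P' <= N)%N, forall i, (size (P'`_i)%R <= a + m)%N & evt e * y * tz_basis a l = ev2 iota t z P'].
  exists (evt e), m; split; first exact: t_tr.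
  move=> y /He h a l; have [P' [sP' sP'i ->]] := h a l.
  by exists (fun b i => (P'`_i)`_b); apply: ev_expand.
elim: ys => [|y ys [e [m [e0 IH]]]]; first by exists 1, 0%N; rewrite oner_neq0.
have [e' [m' [e'0 H']]] := one y.
exists (e * e'), (m + m' + size e + size e')%N; split; first by rewrite mulf_neq0.
have scale (f : {poly k}) (P' : {poly {poly k}}) (s s' : nat) : (size P' <= N)%N ->
    (forall i, (size (P'`_i)%R <= s)%N) -> (s + size f <= s')%N ->
    [/\ (size (f%:P * P')%R <= N)%N, forall i, (size ((f%:P * P')`_i)%R <= s')%N &
      evt f * ev2 iota t z P' = ev2 iota t z (f%:P * P')].
  move=> sP sPi ss; split; first by rewrite mul_polyC; apply: leq_trans (size_scale_leq _ _) sP.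
    move=> i; rewrite coefCM; apply: leq_trans (size_polyMleq _ _) _.
    by apply: leq_trans ss; apply: leq_trans (leq_pred _) _; rewrite addnC leq_add2r.
  by rewrite rmorphM ev2C.
move=> x; rewrite inE => /orP [/eqP ->|xys] a l.
  have [P' [sP' sP'i E']] := H' a l.
  have [|h1 h2 h3] := scale e P' _ (a + (m + m' + size e + size e'))%N sP' sP'i; first lia.
  exists (e%:P * P'); split => //; rewrite -h3 -E' rmorphM hornerM; ring.
have [P' [sP' sP'i E']] := IH _ xys a l.
have [|h1 h2 h3] := scale e' P' _ (a + (m + m' + size e + size e'))%N sP' sP'i; first lia.
exists (e'%:P * P'); split => //; rewrite -h3 -E' rmorphM hornerM; ring.
Qed.
End Growth.

Theorem ff_exists (k : closedFieldType) (hchar : [pchar k] =i pred0)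
  (K : fieldType) (iota : {rmorphism k -> K}) (hK : function_field_of_curve iota)
  (L : closedFieldType) (j : {rmorphism K -> L}) :
  exists (D : K -> K) (Pl : eqType) (vv : Pl -> K -> rat) (g : nat) (bas : nat -> 'I_g -> K),
    is_ff iota D vv /\ has_growth iota bas.
Proof.
have [t [z [n [t_tr rep rel]]]] := function_field_model hchar hK.
have {}rep y : exists (P : {poly {poly k}}) (c : {poly k}),
    c != 0 /\ y * (map_poly iota c).[t] = ev2 iota t z P.
  by have [P [c h]] := rep y; exists P, c; rewrite ev2_horner.
have {}rel y : exists P : {poly {poly k}}, [/\ P != 0, (size P <= n.+1)%N & ev2 iota t y P = 0].
  by have [P h] := rel y; exists P; rewrite ev2_horner.
have z_alg : exists2 P : {poly {poly k}}, P != 0 & ev2 iota t z P = 0.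
  by have [P [P0 _ E]] := rel z; exists P.
have [H [H0 EH minH]] := minimal_relation z_alg.
have [s [sc st sz]] := embeddings hchar t_tr rep H0 EH minH j.
have [D [DD DM DC Dt]] := derivation_exists hchar t_tr rep H0 EH minH.
pose kap : {rmorphism k -> L} := j \o iota.
have Ev a : exists vh : (L -> rat) * (L -> Prop), let: (v, hv) := vh in
    [/\ forall x (P : {poly {poly k}}), x != 0 -> P != 0 ->
        poly2_eval kap (j (loc_par iota t a)) P x = 0 ->
        hv x /\ exists (b : nat) (l : int), (0 < b < size P)%N /\ v x = l%:~R / b%:R,
      forall x y, hv x -> hv y -> hv (x * y) /\ v (x * y) = v x + v y,
      forall x y, hv x -> hv y -> hv (x - y) -> Num.min (v x) (v y) <= v (x - y),
      (forall c, c != 0 -> hv (kap c) /\ v (kap c) = 0) /\ (hv (j (loc_par iota t a)) /\ v (j (loc_par iota t a)) = 1) &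
      forall x, alg_over kap (j (loc_par iota t a)) x -> hv x -> 0 <= v x ->
        exists c, hv (x - kap c) -> 0 < v (x - kap c)].
  have tr (p : {poly k}) : p != 0 -> (map_poly kap p).[j (loc_par iota t a)] != 0.
    by move=> p0; rewrite map_poly_comp horner_map fmorph_eq0; apply: loc_par_tr.
  by have [v [hv h]] := exists_valuation tr; exists (v, hv).
have [vh Hvh] := boolp.choice Ev.
exists D, _, (vplace s (fun a => (vh a).1)), _, (@tz_basis k K t z H); split; last exact: tz_growth.
apply: (@vplace_ff k hchar K iota L j t z n t_tr rep rel H H0 EH minH D DD DM DC Dt s sc st sz
  (fun a => (vh a).1) (fun a => (vh a).2)).
by move=> a; have := Hvh a; case: (vh a).
Qed.

(** * Wronskians and the subspace bound *)

Section Wronskian.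
Variables (k K : fieldType) (iota : {rmorphism k -> K}) (D : K -> K).
Hypotheses (DD : forall x y, D (x + y) = D x + D y)
  (DM : forall x y, D (x * y) = D x * y + x * D y) (DC : forall c, D (iota c) = 0)
  (Dconst : forall x, D x = 0 -> exists c, x = iota c).

Definition wronskian q (f : 'I_q -> K) : 'M[K]_q := \matrix_(i, s) iter s D (f i).

Definition indep (I : finType) (f : I -> K) :=
  forall c : I -> k, \sum_i iota (c i) * f i = 0 -> forall i, c i = 0.

(** A kernel vector, scaled to have an entry 1, is differentiated: the result has a zero there and
    is killed by the smaller Wronskian. By induction it vanishes, so the entries are constants and
    form a relation over [k]. *)
Lemma wronskian_indep q (f : 'I_q -> K) : indep f -> \det (wronskian f) != 0.
Proof.
elim: q f => [|q IH] f fi; first by rewrite det_mx00 oner_neq0.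
apply/eqP => /eqP /det0P [v v0 vW].
have [i0 vi0] : exists i0, v 0 i0 != 0.
  apply/existsP; rewrite -negb_forall; apply: contra v0 => /forallP h.
  by apply/eqP/rowP => i; rewrite mxE; apply/eqP/negPn/negP => /negP; rewrite h.
pose a i := v 0 i / v 0 i0.
have aE s : (s < q.+1)%N -> \sum_i a i * iter s D (f i) = 0.
  move=> sq; have /rowP /(_ (Ordinal sq)) := vW; rewrite !mxE => E.
  rewrite -[RHS](mul0r (v 0 i0)^-1) -[X in X * _]E mulr_suml; apply: eq_bigr => i _.
  by rewrite mxE /a mulrAC.
have daE s : (s < q)%N -> \sum_i D (a i) * iter s D (f i) = 0.
  move=> sq; have := congr1 D (aE s (leqW sq)); rewrite (D0 DD) (D_sum DD).
  under eq_bigr => i _ do rewrite DM.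
  by rewrite big_split /= (aE s.+1 sq) addr0.
pose f' l := f (lift i0 l).
have f'i : indep f'.
  move=> c E l.
  have := fi (fun i => if unlift i0 i is Some l' then c l' else 0) _ (lift i0 l).
  rewrite liftK; apply; rewrite (bigD1_ord i0) //= unlift_none rmorph0 mul0r add0r.
  by rewrite -[RHS]E; apply: eq_bigr => l' _; rewrite liftK.
have da0 l : D (a (lift i0 l)) = 0.
  have : (\row_l D (a (lift i0 l))) *m wronskian f' = 0.
    apply/rowP => s; rewrite !mxE; have := daE s (ltn_ord s).
    rewrite (bigD1_ord i0) //= /a mulfV // (D1 DM) mul0r add0r => E.
    by rewrite -[RHS]E; apply: eq_bigr => l' _; rewrite !mxE.
  move=> E; have U : wronskian f' \in unitmx by rewrite unitmxE unitfE IH.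
  have := congr1 (mulmx^~ (invmx (wronskian f'))) E; rewrite mulmxK // mul0mx.
  by move=> /rowP /(_ l); rewrite !mxE.
have ac i : exists c, a i = iota c.
  apply: Dconst; case: (unliftP i0 i) => [l ->|->] //.
  by rewrite /a mulfV // (D1 DM).
have [c Hc] := fin_all_exists ac.
have := fi c _ i0; rewrite (_ : c i0 = 1); last first.
  by apply: (fmorph_inj iota); rewrite -Hc rmorph1 /a mulfV.
have Ec : \sum_i iota (c i) * f i = 0.
  by rewrite -[RHS](aE 0%N (ltn0Sn _)); apply: eq_bigr => i _; rewrite Hc.
by move=> /(_ Ec) /eqP; rewrite oner_eq0.
Qed.

(* D^s (g f) = sum_m leib g s m D^m f, a triangular change of rows with diagonal g *)
Fixpoint leib (g : K) (s m : nat) : K :=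
  if s is s'.+1 then D (leib g s' m) + (if m is m'.+1 then leib g s' m' else 0)
  else if m == 0%N then g else 0.

Lemma leib_gt g s m : (s < m)%N -> leib g s m = 0.
Proof.
elim: s m => [|s IH] m; first by case: m.
by case: m => // m; rewrite ltnS /= => lt; rewrite !IH ?(D0 DD) ?addr0 //; apply: ltnW.
Qed.

Lemma leib_diag g s : leib g s s = g.
Proof. by elim: s => //= s ->; rewrite leib_gt // (D0 DD) add0r. Qed.

Lemma iter_leibniz g f s n : (s < n)%N ->
  iter s D (g * f) = \sum_(m < n) leib g s m * iter m D f.
Proof.
elim: s n => [|s IH] n.
  case: n => // n _; rewrite big_ord_recl /= big1 ?addr0 // => i _.
  by rewrite mul0r.
case: n => // n sn; rewrite iterS (IH n.+1 (leqW sn)) (D_sum DD).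
under eq_bigr => m _ do rewrite DM -iterS.
rewrite big_split /= [X in _ + X]big_ord_recr /= (leib_gt g (sn : (s < n)%N)) mul0r addr0.
rewrite [RHS](eq_bigr (fun m : 'I_n.+1 => D (leib g s m) * iter m D f +
   (if (m : nat) is m'.+1 then leib g s m' else 0) * iter m D f)); last first.
  by move=> m _; rewrite /= mulrDl.
rewrite big_split /=; congr (_ + _); rewrite big_ord_recl /= mul0r add0r.
by apply: eq_bigr => m _; rewrite /bump.
Qed.

Lemma wronskian_scale q (f : 'I_q -> K) g :
  \det (wronskian (fun i => g * f i)) = g ^+ q * \det (wronskian f).
Proof.
pose U : 'M[K]_q := \matrix_(m, s) leib g s m.
have -> : wronskian (fun i => g * f i) = wronskian f *m U.
  apply/matrixP => i s; rewrite !mxE (iter_leibniz g (f i) (ltn_ord s)).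
  by apply: eq_bigr => m _; rewrite !mxE mulrC.
rewrite det_mulmx mulrC; congr (_ * _); rewrite -det_tr det_trig.
  under eq_bigr => i _ do rewrite !mxE leib_diag.
  by rewrite prodr_const card_ord.
by apply/is_trig_mxP => i l lt; rewrite !mxE leib_gt.
Qed.
End Wronskian.

(** * Values of determinants *)

Section DetBound.
Variables (k K : fieldType) (iota : {rmorphism k -> K}) (v : K -> rat).
Hypothesis pv : is_place iota v.

Lemma vge_prod (I : Type) (r : seq I) (F : I -> K) (w : I -> rat) :
  (forall i, vge v (w i) (F i)) -> vge v (\sum_(i <- r) w i) (\prod_(i <- r) F i).
Proof.
move=> h; elim: r => [|i r IH]; last by rewrite !big_cons; apply: (vgeM pv).
by rewrite !big_nil -(rmorph1 iota); apply: (vge_iota pv).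
Qed.

Lemma vge_det q (A : 'M[K]_q) (w : 'I_q -> rat) :
  (forall i s, vge v (w i) (A i s)) -> vge v (\sum_i w i) (\det A).
Proof.
move=> h; apply: (vge_sum pv) => s _.
rewrite -[X in vge v X _]add0r; apply: (vgeM pv).
  by rewrite -(rmorph_sign iota); apply: (vge_iota pv).
exact: vge_prod.
Qed.

(* Cauchy-Binet: the minors are indexed by injections *)
Lemma vge_det_mul q (I : finType) (A : 'I_q -> I -> K) (B : I -> 'I_q -> K) (w : I -> rat) (b : rat) :
  (forall i l, vge v 0 (A i l)) -> (forall l s, vge v (w l) (B l s)) ->
  (forall phi : {ffun 'I_q -> I}, injective phi -> b <= \sum_i w (phi i)) ->
  vge v b (\det (\matrix_(i, s) \sum_l A i l * B l s)).
Proof.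
move=> hA hB hb.
have -> : \det (\matrix_(i, s) \sum_l A i l * B l s) =
    \sum_(phi : {ffun 'I_q -> I}) (\prod_i A i (phi i)) * \det (\matrix_(i, s) B (phi i) s).
  rewrite /determinant; under eq_bigr => s _.
    under eq_bigr => i _ do rewrite mxE.
    rewrite bigA_distr_bigA mulr_sumr; over.
  rewrite exchange_big /=; apply: eq_bigr => phi _; rewrite mulr_sumr.
  apply: eq_bigr => s _; rewrite big_split /= mulrCA; congr (_ * (_ * _)).
  by apply: eq_bigr => i _; rewrite mxE.
apply: (vge_sum pv) => phi _.
case: (boolP (injectiveb phi)) => [/injectiveP inj|/injectivePn [i [i' ii' E]]]; last first.
  rewrite (determinant_alternate ii') ?mulr0 ?vge_0 // => s.
  by rewrite !mxE E.
apply: vge_le (hb _ inj) _; rewrite -[X in vge v X _]add0r; apply: (vgeM pv).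
  have := vge_prod (index_enum 'I_q) (w := fun=> 0) (fun i => hA i (phi i)).
  by rewrite big1.
by apply: vge_det => i s; rewrite mxE.
Qed.
End DetBound.

Lemma fin_max_bound (I : finType) (Q : I -> rat -> Prop) :
  (forall i C C', C <= C' -> Q i C -> Q i C') -> (forall i, exists C, Q i C) ->
  exists C, 0 <= C /\ forall i, Q i C.
Proof.
move=> mono ex; have [f Hf] := fin_all_exists ex.
exists (\sum_i `|f i|); split; first by apply: sumr_ge0.
move=> i; apply: mono (Hf i); apply: le_trans (ler_norm _) _.
by rewrite (bigD1 i) //= lerDl sumr_ge0.
Qed.

Lemma seq_max_bound (T : eqType) (s : seq T) (Q : T -> rat -> Prop) :
  (forall i C C', C <= C' -> Q i C -> Q i C') -> (forall i, i \in s -> exists C, Q i C) ->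
  exists C, 0 <= C /\ forall i, i \in s -> Q i C.
Proof.
move=> mono; elim: s => [|x s IH] ex; first by exists 0.
have [C [C0 HC]] := IH (fun i h => ex i (mem_behead (s := x :: s) h)).
have [C' HC'] := ex x (mem_head _ _).
exists (Num.max C C'); split; first by rewrite le_max C0.
move=> i; rewrite inE => /orP [/eqP ->|/HC h]; first by apply: mono HC'; rewrite le_max lexx orbT.
by apply: mono h; rewrite le_max lexx.
Qed.

(** * Spans over k *)

Section Span.
Variables (k K : fieldType) (iota : {rmorphism k -> K}).

(** The span as the intersection of all k-subspaces containing l; to use a membership is to choose
    the subspace [F]. *)
Definition in_span (l : seq K) (x : K) := forall F : K -> Prop, F 0 ->
  (forall x y, F x -> F y -> F (x + y)) -> (forall c x, F x -> F (iota c * x)) ->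
  (forall y, y \in l -> F y) -> F x.

Lemma span0 l : in_span l 0. Proof. by move=> F h0 _ _ _. Qed.
Lemma spanD l x y : in_span l x -> in_span l y -> in_span l (x + y).
Proof. by move=> hx hy F h0 hD hZ hl; apply: (hD _ _ (hx _ _ _ _ _) (hy _ _ _ _ _)). Qed.
Lemma spanZ l c x : in_span l x -> in_span l (iota c * x).
Proof. by move=> hx F h0 hD hZ hl; apply: (hZ _ _ (hx _ _ _ _ _)). Qed.
Lemma span_mem l x : x \in l -> in_span l x.
Proof. by move=> xl F h0 hD hZ hl; apply: hl. Qed.
Lemma span_sum l I (r : seq I) (P : pred I) (G : I -> K) :
  (forall i, P i -> in_span l (G i)) -> in_span l (\sum_(i <- r | P i) G i).
Proof. by move=> h; elim/big_ind: _; [exact: span0|exact: spanD|exact: h]. Qed.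
Lemma span_sub l l' x : {subset l <= l'} -> in_span l x -> in_span l' x.
Proof. by move=> s hx F h0 hD hZ hl; apply: hx => // y /s /hl. Qed.
(** Integers are in [k], so p(n) stays in one finite-dimensional k-space for all n; this is the
    source of uniformity in n. *)
Lemma span_horner l (p : {poly K}) n : {subset (p : seq K) <= l} -> in_span l p.[n%:R].
Proof.
move=> s; rewrite horner_coef; apply: span_sum => i _.
rewrite mulrC -natrX -(rmorph_nat iota); apply: spanZ; apply: span_mem.
by apply: s; apply: mem_nth.
Qed.

Lemma span_vge (v : K -> rat) (pv : is_place iota v) l q x :
  (forall y, y \in l -> vge v q y) -> in_span l x -> vge v q x.
Proof.
move=> hl hx; apply: (hx (fun x => vge v q x)) => //; first exact: vge_0.
  by move=> x' y; apply: (vgeD pv).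
by move=> c x' h; have := vgeM pv (vge_iota pv c) h; rewrite add0r.
Qed.

Lemma span_bound (v : K -> rat) (pv : is_place iota v) l :
  exists C, 0 <= C /\ forall x, in_span l x -> vge v (- C) x.
Proof.
have [||C [C0 HC]] := @seq_max_bound _ l (fun y C => vge v (- C) y).
- by move=> y C C' le; apply: vge_le; rewrite lerN2.
- by move=> y _; exists (- v y); rewrite opprK; apply: vge_refl.
by exists C; split => // x; apply: (span_vge pv).
Qed.
End Span.

(** * Consequences of the product formula *)

Section ProductFormula.
Variables (k K : fieldType) (iota : {rmorphism k -> K}) (D : K -> K)
  (Pl : eqType) (vv : Pl -> K -> rat).
Hypothesis hff : is_ff iota D vv.

Lemma product_formula_le x (S T : seq Pl) : x != 0 -> uniq S -> uniq T ->
  (forall p, p \in T -> p \notin S) -> (forall p, p \notin S -> vge (vv p) 0 x) ->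
  \sum_(p <- S) vv p x + \sum_(p <- T) vv p x <= 0.
Proof.
move=> x0 uS uT dST h; have [s hs] := ff_supp hff x0.
pose U := undup [seq p <- s | (p \notin S) && (p \notin T)].
have uL : uniq (S ++ T ++ U).
  rewrite !cat_uniq uS uT undup_uniq /= !andbT -!all_predC; apply/andP; split.
    apply/allP => p; rewrite mem_cat mem_undup mem_filter => /orP [/dST //|].
    by case/andP => /andP [].
  by apply/allP => p; rewrite mem_undup mem_filter => /andP [/andP []].
have := ff_prod hff x0 uL; rewrite !big_cat /= => E.
have: \sum_(p <- S) vv p x + (\sum_(p <- T) vv p x + \sum_(p <- U) vv p x) = 0.
  apply: E => p; rewrite !mem_cat mem_undup mem_filter !negb_or.
  by case/and3P => -> -> /= /hs.
have : 0 <= \sum_(p <- U) vv p x.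
  rewrite big_seq; apply: sumr_ge0 => p; rewrite mem_undup mem_filter => /andP [/andP [pS _] _].
  exact: vge_nz (h _ pS).
lra.
Qed.

Lemma product_formula_unit x (S : seq Pl) : x != 0 -> uniq S ->
  (forall p, p \notin S -> vv p x = 0) -> \sum_(p <- S) vv p x = 0.
Proof. by move=> x0 uS; apply: (ff_prod hff). Qed.

(** Without poles, subtracting the residue at one place would create a zero and still no pole,
    against the product formula. *)
Lemma nonconstant_pole x : (forall c, x <> iota c) -> exists p, vv p x < 0.
Proof.
move=> xc; apply: boolp.contrapT => /boolp.forallNP np.
have x0 : x != 0 by apply/eqP => E; apply: (xc 0); rewrite E rmorph0.
have vx p : 0 <= vv p x by rewrite leNgt; apply/negP/np.
have [p _] := ff_ne hff.
have [c [/xc //|vc]] := place_res (ff_place hff p) x0 (vx p).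
have y0 : x - iota c != 0 by rewrite subr_eq0; apply/eqP/xc.
have := @product_formula_le _ [::] [:: p] y0 isT isT; rewrite big_nil big_seq1 add0r leNgt vc /=.
move=> h; suff // : false by []; apply: h => // q _.
apply: (vgeB (ff_place hff q)); last exact: vge_iota (ff_place hff q) c.
by rewrite /vge vx orbT.
Qed.
End ProductFormula.

(** * The subspace bound *)

Section Subspace.
Variables (k K : fieldType) (iota : {rmorphism k -> K}) (D : K -> K)
  (Pl : eqType) (vv : Pl -> K -> rat).
Hypothesis hff : is_ff iota D vv.
Let DD := ffDD hff.
Let DM := ffDM hff.
Let DC := ffDC hff.
Let pv p := ff_place hff p.

(** Outside S the elements of [us] are units, those of [l] are integral, and D preserves integrality
    and lowers values by at most 1. *)
Record admissible (us l : seq K) (S : seq Pl) : Prop := Admissible {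
  adm_uniq : uniq S;
  adm_int : forall p, p \notin S -> forall x, x != 0 -> exists a : int, vv p x = a%:~R;
  adm_D0 : forall p, p \notin S -> forall x, vge (vv p) 0 x -> vge (vv p) 0 (D x);
  adm_D1 : forall p, p \notin S -> forall x, x != 0 -> vge (vv p) (vv p x - 1) (D x);
  adm_unit : forall p, p \notin S -> forall x, x \in us -> vv p x = 0;
  adm_ge0 : forall p, p \notin S -> forall x, x \in l -> vge (vv p) 0 x
}.

Lemma admissible_sub us us' l l' S : {subset us' <= us} -> {subset l' <= l} ->
  admissible us l S -> admissible us' l' S.
Proof.
move=> hu hl [h1 h2 h3 h4 h5 h6]; split => // p pS x.
  by move/hu; apply: h5.
by move/hl; apply: h6.
Qed.

Lemma common_support (xs : seq K) : exists s : seq Pl, forall p, p \notin s ->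
  forall x, x \in xs -> x != 0 -> vv p x = 0.
Proof.
elim: xs => [|x xs [s hs]]; first by exists [::].
have [x0|x0] := eqVneq x 0.
  exists s => p ps y; rewrite inE => /orP [/eqP -> |]; first by rewrite x0 eqxx.
  exact: hs.
have [s' hs'] := ff_supp hff x0.
exists (s' ++ s) => p; rewrite mem_cat negb_or => /andP [p1 p2] y; rewrite inE => /orP [/eqP -> _|].
  exact: hs'.
exact: hs.
Qed.

Lemma admissible_exists us l (S0 : seq Pl) : (forall x, x \in us -> x != 0) ->
  exists S, {subset S0 <= S} /\ admissible us l S.
Proof.
move=> us0; have [s hs] := ff_good hff; have [s' hs'] := common_support (us ++ l).
exists (undup (S0 ++ s ++ s')); split; first by move=> p h; rewrite mem_undup mem_cat h.
have out p : p \notin undup (S0 ++ s ++ s') -> p \notin s /\ p \notin s'.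
  by rewrite mem_undup !mem_cat !negb_or => /and3P [].
split; first exact: undup_uniq.
- by move=> p /out [/hs []].
- by move=> p /out [/hs []].
- by move=> p /out [/hs []].
- by move=> p /out [_ /hs' h] x xu; apply: h; rewrite ?mem_cat ?xu ?us0.
move=> p /out [_ /hs' h] x xl; have [->|x0] := eqVneq x 0; first exact: vge_0.
by rewrite /vge h ?mem_cat ?xl ?orbT ?lexx.
Qed.

Lemma iter_lin s (I : finType) (a : I -> k) (x : I -> K) :
  iter s D (\sum_i iota (a i) * x i) = \sum_i iota (a i) * iter s D (x i).
Proof.
elim: s => //= s ->; rewrite (D_sum DD); apply: eq_bigr => i _.
by rewrite DM DC mul0r add0r.
Qed.

Lemma span_D l x : in_span iota l x -> in_span iota (map D l) (D x).
Proof.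
move=> h; apply: (h (fun x => in_span iota (map D l) (D x))).
- by rewrite (D0 DD); apply: span0.
- by move=> a b; rewrite DD; apply: spanD.
- by move=> c a ha; rewrite DM DC mul0r add0r; apply: spanZ.
by move=> y yl; apply: span_mem; apply: map_f.
Qed.

Lemma span_mulr l w x : in_span iota l x -> in_span iota (map ( *%R w) l) (w * x).
Proof.
move=> h; apply: (h (fun x => in_span iota (map ( *%R w) l) (w * x))).
- by rewrite mulr0; apply: span0.
- by move=> a b; rewrite mulrDr; apply: spanD.
- by move=> c a ha; rewrite mulrCA; apply: spanZ.
by move=> y yl; apply: span_mem; apply: map_f.
Qed.

(** D(c g^n) = (Dc + n c Dg/g) g^n, and the factor n is a constant, so the list spanning the new
    coefficients depends neither on n nor on c. *)
Lemma iter_D_term l g s : g != 0 -> exists l', forall (n : nat) c, in_span iota l c ->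
  exists c', in_span iota l' c' /\ iter s D (c * g ^+ n) = c' * g ^+ n.
Proof.
move=> g0; elim: s => [|s [l' IH]]; first by exists l => n c hc; exists c.
exists (map D l' ++ map ( *%R (D g / g)) l') => n c /(IH n) [c' [hc' E]].
exists (D c' + iota n%:R * (D g / g * c')); split.
  apply: spanD; first by apply: (span_sub _ (span_D hc')) => y; rewrite mem_cat => ->.
  by apply: spanZ; apply: (span_sub _ (span_mulr hc')) => y; rewrite mem_cat orbC => ->.
rewrite iterS E DM (DXn DM) rmorph_nat.
case: n {IH E} => [|n]; first by rewrite /= !expr0; ring.
by rewrite /= exprS; field.
Qed.

Lemma iter_D_term_bound w l g s : g != 0 -> exists C, 0 <= C /\
  forall (n : nat) c, in_span iota l c ->
  vge (vv w) (n%:R * vv w g - C) (iter s D (c * g ^+ n)).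
Proof.
move=> g0; have [l' hl'] := iter_D_term l s g0.
have [C [C0 hC]] := span_bound (pv w) l'; exists C; split => // n c /(hl' n) [c' [/hC h ->]].
rewrite addrC; apply: (vgeM (pv w)) => //.
by rewrite -(placeX (pv w)) // vge_refl.
Qed.

Lemma iter_D_bound w s : exists C, 0 <= C /\
  forall x, vge (vv w) (vv w x - C) (iter s D x).
Proof.
elim: s => [|s [C [C0 IH]]].
  by exists 0; split => // x; rewrite subr0 /= vge_refl.
have [C' hC'] := ff_bound hff w.
exists (C + `|C'|); split; first exact: addr_ge0.
move=> x; rewrite iterS; have := IH x; set y := iter s D x => hy.
have [->|y0] := eqVneq y 0; first by rewrite (D0 DD) vge_0.
apply: vge_le (hC' y y0); move: (vge_nz y0 hy) (ler_norm C'); lra.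
Qed.

Lemma iter_D_good us l S p s x : admissible us l S -> p \notin S ->
  vge (vv p) 0 x -> vge (vv p) 0 (iter s D x).
Proof. by move=> ad pS hx; elim: s => //= s IH; apply: (adm_D0 ad). Qed.

Lemma admissible_span us l S p x : admissible us l S -> p \notin S -> in_span iota l x ->
  vge (vv p) 0 x.
Proof. by move=> ad pS; apply: (span_vge (pv p)); apply: (adm_ge0 ad). Qed.

Lemma unit_vgeX (g : K) p (n : nat) : g != 0 -> vv p g = 0 -> vge (vv p) 0 (g ^+ n).
Proof. by move=> g0 gp; apply: (vge0X (pv p)); rewrite -gp vge_refl. Qed.

(** The substitution is linear with coefficients in [k], and the determinant of its matrix is
    nonzero. *)
Lemma wronskian_replace q (x : 'I_q -> K) i0 : exists2 c : k, c != 0 &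
  \det (wronskian D (fun i => if i == i0 then \sum_l x l else x i)) =
    iota c * \det (wronskian D x).
Proof.
pose e : 'M[k]_q := \matrix_(i, l) if i == i0 then 1 else (i == l)%:R.
exists (\det e).
  apply/det0P => -[v v0 ve]; case/eqP: v0.
  have vE l : v 0 i0 + (if l == i0 then 0 else v 0 l) = 0.
    have /rowP /(_ l) := ve; rewrite !mxE (bigD1 i0) //= mxE eqxx mulr1 => E; rewrite -[RHS]E.
    congr (_ + _); case: (eqVneq l i0) => [->|ne].
      by rewrite big1 // => i ii; rewrite mxE (negPf ii) mulr0.
    rewrite (bigD1 l) //= mxE (negPf ne) eqxx mulr1 big1 ?addr0 // => i /andP [i1 i2].
    by rewrite mxE (negPf i1) (negPf i2) mulr0.
  have v0 : v 0 i0 = 0 by have := vE i0; rewrite eqxx addr0.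
  apply/rowP => l; rewrite mxE; have := vE l; rewrite v0 add0r.
  by case: eqP => // ->.
rewrite -det_map_mx -det_mulmx; congr (\det _); apply/matrixP => i s; rewrite !mxE.
have -> : (if i == i0 then \sum_l x l else x i) = \sum_l iota (e i l) * x l.
  case: eqP => [->|/eqP ne].
    by apply: eq_bigr => l _; rewrite mxE eqxx rmorph1 mul1r.
  rewrite (bigD1 i) //= mxE (negPf ne) eqxx rmorph1 mul1r big1 ?addr0 // => l li.
  by rewrite mxE (negPf ne) eq_sym (negPf li) rmorph0 mul0r.
by rewrite iter_lin; apply: eq_bigr => l _; rewrite !mxE.
Qed.

(** The product formula is applied to the Wronskian of the terms c_i g_i^n, integral outside S. At a
    place w of [Q] the term of index [m w] may first be replaced by the whole sum. The contributions
    of all g_i cancel over S, leaving the gain from the replacement. *)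
Lemma subspace_bound q (g : 'I_q -> K) l S (Q : pred Pl) (m : Pl -> 'I_q) :
  (forall i, g i != 0) -> admissible (codom g) l S ->
  exists C, forall (n : nat) (c : 'I_q -> K), (forall i, in_span iota l (c i)) ->
    indep iota (fun i => c i * g i ^+ n) ->
    \sum_(w <- S | Q w) (vv w (\sum_i c i * g i ^+ n) - n%:R * vv w (g (m w))) <= C.
Proof.
move=> g0 ad.
have Hw w : exists C, 0 <= C /\ ((forall (n : nat) c (i : 'I_q) (s : 'I_q), in_span iota l c ->
     vge (vv w) (n%:R * vv w (g i) - C) (iter s D (c * g i ^+ n))) /\
     forall (s : 'I_q) x, vge (vv w) (vv w x - C) (iter s D x)).
  have [||C [C0 HC]] := @fin_max_bound ('I_q * 'I_q)%type (fun is_ C =>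
     (forall (n : nat) c, in_span iota l c ->
     vge (vv w) (n%:R * vv w (g is_.1) - C) (iter is_.2 D (c * g is_.1 ^+ n))) /\
     forall x, vge (vv w) (vv w x - C) (iter is_.2 D x)).
  - move=> [i s] C C' le [h1 h2]; split => [n c hc|x].
      by apply: vge_le (h1 n c hc); rewrite lerD2l lerN2.
    by apply: vge_le (h2 x); rewrite lerD2l lerN2.
  - move=> [i s] /=; have [C1 [C10 h1]] := iter_D_term_bound w l s (g0 i).
    have [C2 [C20 h2]] := iter_D_bound w s.
    exists (C1 + C2); split => [n c hc|x].
      by apply: vge_le (h1 n c hc); lra.
    by apply: vge_le (h2 x); lra.
  exists C; split => //; split => [n c i s hc|s x].
    by have [h _] := HC (i, s); apply: h.
  by have [_ h] := HC (m w, s); apply: h.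
have [Cw HC] := boolp.choice Hw.
exists (\sum_(w <- S) q%:R * Cw w) => n c hc xi.
set x := fun i => c i * g i ^+ n; rewrite -/x in xi; set X := \sum_i _.
have W0 := wronskian_indep DD DM (ff_const hff) xi; set W := \det _ in W0.
have hout p : p \notin S -> vge (vv p) 0 W.
  move=> pS; have := @vge_det _ _ _ _ (pv p) q (wronskian D x) (fun=> 0); rewrite big1 //; apply => i s.
  rewrite mxE; apply: (iter_D_good _ ad pS).
  apply: (vge0M (pv p)); first exact: admissible_span ad pS _.
  by apply: unit_vgeX => //; apply: (adm_unit ad pS); apply: codom_f.
(* In every row, derivatives cost at most Cw, whence q Cw. At the places of [Q] the row [m w]
   contributes the value of the sum X in place of n v(g). *)
have hin w : \sum_i n%:R * vv w (g i) - q%:R * Cw w +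
    (if Q w then vv w X - n%:R * vv w (g (m w)) else 0) <= vv w W.
  have [C0 [h1 h2]] := HC w.
  have sumC : \sum_(i < q) - Cw w = - (q%:R * Cw w).
    by rewrite sumr_const card_ord mulNrn mulr_natl.
  case: ifP => _.
    have [e e0 E] := wronskian_replace x (m w).
    have -> : vv w W = vv w (iota e * W).
      by rewrite (placeM (pv w)) ?fmorph_eq0 // (placeC (pv w)) // add0r.
    apply: vge_nz; first by rewrite mulf_neq0 ?fmorph_eq0.
    rewrite -E.
    have := @vge_det _ _ _ _ (pv w) q (wronskian D (fun i => if i == m w then \sum_l x l else x i))
      (fun i => (if i == m w then vv w X else n%:R * vv w (g i)) - Cw w).
    have -> : \sum_i ((if i == m w then vv w X else n%:R * vv w (g i)) - Cw w) =
      \sum_i n%:R * vv w (g i) - q%:R * Cw w + (vv w X - n%:R * vv w (g (m w))).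
      rewrite big_split /= sumC (bigD1 (m w)) //= eqxx.
      under eq_bigr => i /negPf -> do [].
      rewrite [in RHS](bigD1 (m w)) //=; ring.
    apply => i s; rewrite mxE; case: eqP => [_|_]; [exact: h2|exact: h1].
  rewrite addr0 -sumC -big_split /=; apply: vge_nz => //.
  by apply: (vge_det (pv w)) => i s; rewrite mxE; apply: h1.
have := @product_formula_le _ _ _ _ _ _ hff W S [::] W0 (adm_uniq ad) isT (fun _ h => False_ind _ (notF h)) hout.
rewrite big_nil addr0 => PF.
have : \sum_(w <- S) (\sum_i n%:R * vv w (g i) - q%:R * Cw w +
    (if Q w then vv w X - n%:R * vv w (g (m w)) else 0)) <= 0.
  by apply: le_trans PF; apply: ler_sum => w _; apply: hin.

rewrite big_split /= -big_mkcond big_split /= sumrN exchange_big /= [X in X - _ + _]big1 ?add0r.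
  by rewrite addrC subr_le0.
move=> i _; rewrite -mulr_sumr (product_formula_unit hff) ?mulr0 ?(adm_uniq ad) //.
by move=> p pS; apply: (adm_unit ad pS); apply: codom_f.
Qed.
End Subspace.

Lemma natr_mul_large (e C : rat) : 0 < e -> exists n0 : nat, forall n : nat, (n0 <= n)%N -> C < n%:R * e.
Proof.
move=> e0; exists (Num.truncn (`|C| / e)).+1 => n hn.
have : `|C| / e < n%:R by apply: lt_le_trans (truncnS_gt _) _; rewrite ler_nat.
by rewrite ltr_pdivrMr //; apply: le_lt_trans (ler_norm _).
Qed.

(** * Exponential sums with non-proportional bases *)

Section LargeExponents.
Variables (k K : fieldType) (iota : {rmorphism k -> K}) (D : K -> K)
  (Pl : eqType) (vv : Pl -> K -> rat).
Hypothesis hff : is_ff iota D vv.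
Let pv p := ff_place hff p.

Definition non_proportional q (g : 'I_q -> K) :=
  forall i i', i != i' -> forall c, g i <> iota c * g i'.

Lemma separating_place q (g : 'I_q -> K) i i' : (forall i, g i != 0) -> non_proportional g ->
  i != i' -> exists w, vv w (g i') < vv w (g i).
Proof.
move=> g0 np ii; have [|w] := nonconstant_pole hff (x := g i' / g i).
  move=> c E; apply: (np i' i _ c); first by rewrite eq_sym.
  by rewrite -E divfK.
by rewrite (place_div (pv w)) // subr_lt0; exists w.
Qed.

Lemma non_proportional_lift q (g : 'I_q.+1 -> K) i0 :
  non_proportional g -> non_proportional (fun i => g (lift i0 i)).
Proof. by move=> np i i' ii; apply: np; rewrite (inj_eq lift_inj). Qed.

(** If no coefficient vanishes, c_0 g_0^n is minus the sum of the other terms, which are independent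
    over [k] by induction. At a place where g_0 has a larger value than g_1, the subspace bound
    fails for n large. *)
Lemma large_exponent_indep q (g : 'I_q -> K) l : (forall i, g i != 0) -> non_proportional g ->
  exists n0, forall n, (n0 <= n)%N -> forall c : 'I_q -> K, (forall i, in_span iota l (c i)) ->
    \sum_i c i * g i ^+ n = 0 -> forall i, c i = 0.
Proof.
elim: q g => [|q IH] g g0 np; first by exists 0%N => n _ c _ _ [].
have [N HN] := fin_all_exists (fun i0 : 'I_q.+1 => IH _ (fun i => g0 (lift i0 i)) (@non_proportional_lift _ g i0 np)).
have Nmax i : (N i <= \max_i N i)%N by apply: leq_bigmax.
have zero n c i0 : (N i0 <= n)%N -> (forall i, in_span iota l (c i)) ->
    \sum_i c i * g i ^+ n = 0 -> c i0 = 0 -> forall i, c i = 0.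
  move=> hn hc; rewrite (bigD1_ord i0) //= => E ci i; move: E; rewrite ci mul0r add0r => E.
  by case: (unliftP i0 i) => [l' ->|->] //; apply: (HN i0 n hn (fun i => c (lift i0 i))).
case: q g g0 np N HN Nmax zero {IH} => [|q] g g0 np N HN Nmax zero.
  exists 0%N => n _ c _; rewrite big_ord1 => /eqP; rewrite mulf_eq0 expf_eq0 (negPf (g0 _)) andbF orbF.
  by move=> /eqP E i; rewrite ord1.
have [w0 hw0] := @separating_place _ g ord0 (lift ord0 ord0) g0 np isT.
pose g' i := g (lift ord0 i).
have [|S [S0 ad]] := @admissible_exists _ _ _ _ _ _ hff (codom g) l [:: w0].
  by move=> x /codomP [i ->].
have ad' : admissible D vv (codom g') l S.
  by apply: admissible_sub ad => // x /codomP [i ->]; apply: codom_f.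
have [C hC] := subspace_bound hff (pred1 w0) (fun=> ord0) (fun i => g0 (lift ord0 i)) ad'.
have [C1 [C10 hC1]] := span_bound (pv w0) l.
have [n1 hn1] := @natr_mul_large (vv w0 (g ord0) - vv w0 (g' ord0)) (C + C1) ltac:(by rewrite subr_gt0).
exists (maxn (\max_i N i) n1) => n; rewrite geq_max => /andP [hn hn'] c hc E.
have zn i0 := zero n c i0 (leq_trans (Nmax i0) hn) hc E.
case: (boolp.EM (exists i0, c i0 = 0)) => [[i0 /zn] //|/boolp.forallNP nz].
have nz' i : c i != 0 by apply/eqP/nz.
exfalso; move: E; rewrite big_ord_recl => /eqP; rewrite addrC addr_eq0 => /eqP E.
have xi : indep iota (fun i => c (lift ord0 i) * g' i ^+ n).
  move=> a Ea i.
  have := HN ord0 n (leq_trans (Nmax _) hn) (fun i => iota (a i) * c (lift ord0 i))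
    (fun i => spanZ (a i) (hc (lift ord0 i))).
  rewrite -[X in _ = X]Ea => H; have := H (eq_bigr _ (fun i _ => esym (mulrA _ _ _))) i.
  by move/eqP; rewrite mulf_eq0 fmorph_eq0 (negPf (nz' _)) orbF => /eqP.
have := hC n (fun i => c (lift ord0 i)) (fun i => hc _) xi.
rewrite -big_filter (_ : [seq w <- S | _] = [:: w0]); last first.
  by apply: filter_pred1_uniq; [exact: adm_uniq ad|apply: S0; rewrite inE].
rewrite big_seq1 E (placeN (pv _)) (placeM (pv _)) ?expf_neq0 // (placeX (pv _)) //.
have := vge_nz (nz' ord0) (hC1 _ (hc ord0)); move: (hn1 n hn'); rewrite /g'; lra.
Qed.

(** By the product formula this says that the sum has about n e zeros outside S. The place w0 and
    the rate e are fixed before S, so that S may later be enlarged without affecting the rate. *)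
Lemma sum_valuations_upper q (g : 'I_q -> K) l (i0 i1 : 'I_q) : (forall i, g i != 0) -> non_proportional g ->
  i0 != i1 -> exists w0 (e : rat), 0 < e /\ forall S, w0 \in S -> admissible D vv (codom g) l S ->
    exists C n0, forall (n : nat) (c : 'I_q -> K), (n0 <= n)%N -> (forall i, in_span iota l (c i)) ->
      (forall i, c i != 0) -> \sum_(w <- S) vv w (\sum_i c i * g i ^+ n) <= C - n%:R * e.
Proof.
move=> g0 np ii; have [w0 hw0] := separating_place g0 np ii.
exists w0, (vv w0 (g i0) - vv w0 (g i1)); split; first by rewrite subr_gt0.
move=> S wS ad; set e := _ - _ in hw0 *.
(* The one of the two bases with the smaller value at w. Summed over S these minima are at most - e,
   since g_i0 sums to 0 and g_i1 is smaller by e at w0. *)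
pose m w := if vv w (g i0) <= vv w (g i1) then i0 else i1.
have [C hC] := subspace_bound hff predT m g0 ad.
have [n0 hn0] := large_exponent_indep l g0 np.
exists C, n0 => n c hn hc nz.
have xi : indep iota (fun i => c i * g i ^+ n).
  move=> a Ea i; have := hn0 n hn (fun i => iota (a i) * c i) (fun i => spanZ (a i) (hc i)).
  rewrite -[X in _ = X]Ea => H; have := H (eq_bigr _ (fun i _ => esym (mulrA _ _ _))) i.
  by move/eqP; rewrite mulf_eq0 fmorph_eq0 (negPf (nz _)) orbF => /eqP.
have := hC n c hc xi; rewrite big_split /= sumrN -mulr_sumr.
have : \sum_(w <- S) vv w (g (m w)) <= - e.
  have -> : - e = \sum_(w <- S) (vv w (g i0) - if w == w0 then e else 0).
    rewrite big_split /= sumrN (product_formula_unit hff) ?(adm_uniq ad) //; last first.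
      by move=> p pS; apply: (adm_unit ad pS); apply: codom_f.
    rewrite -big_mkcond -big_filter (_ : [seq w <- S | _] = [:: w0]) ?big_seq1 ?add0r //.
    by apply: filter_pred1_uniq => //; exact: adm_uniq ad.
  apply: ler_sum => w _; rewrite /m; case: eqP => [->|_].
    by rewrite (leNgt (vv w0 (g i0))) hw0 /= /e; lra.
  by rewrite subr0; case: ifP => // /negbT; rewrite -ltNge => /ltW.
move=> h; have := ler_wpM2l (ler0n _ n) h; lra.
Qed.
End LargeExponents.

Lemma horner_large (K : fieldType) (p : {poly K}) : [pchar K] =i pred0 -> p != 0 ->
  exists n0, forall n, (n0 <= n)%N -> p.[n%:R] != 0.
Proof.
move=> hK; have [m] := ubnP (size p); elim: m => // m IH in p * => sp p0.
case: (boolp.EM (exists a : nat, root p a%:R)) => [[a /factor_theorem [q E]]|h]; last first.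
  by exists 0%N => n _; apply/negP => pn; apply: h; exists n.
have q0 : q != 0 by apply: contraNneq p0 => q0; rewrite E q0 mul0r.
have [|n0 hn0] := IH q _ q0.
  by move: sp; rewrite E size_Mmonic ?monicXsubC // size_XsubC addn2.
exists (maxn n0 a.+1) => n; rewrite geq_max => /andP [h1 h2].
rewrite E hornerM mulf_neq0 ?hn0 // !(hornerD, hornerN, hornerX, hornerC) subr_eq0.
rewrite -subr_eq0 -natrB 1?ltnW // (proj1 (pcharf0P _) hK).
by rewrite subn_eq0 -ltnNge.
Qed.

(** * Specialization at (n, u^n) and the gcd estimate *)

Section Specialization.
Variables (k K : fieldType) (iota : {rmorphism k -> K}) (D : K -> K)
  (Pl : eqType) (vv : Pl -> K -> rat).
Hypothesis hff : is_ff iota D vv.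
Hypothesis hK : [pchar K] =i pred0.
Variables (r : nat) (u : 'I_r -> K).
Hypothesis u0 : forall i, u i != 0.

Definition spec (n : nat) : {rmorphism {mpoly {poly K}[r]} -> K} :=
  mmap (horner_eval n%:R) (fun i => u i ^+ n).

Lemma umono_exp n m : mmap1 (fun i => u i ^+ n) m = mmap1 u m ^+ n.
Proof. by rewrite /mmap1 -prodrXl; apply: eq_bigr => i _; rewrite exprAC. Qed.

Lemma umono_neq0 m : mmap1 u m != 0.
Proof. by apply/prodf_neq0 => i _; rewrite expf_neq0. Qed.

Lemma specE n F : spec n F = \sum_(m <- msupp F) (F@_m).[n%:R] * mmap1 u m ^+ n.
Proof. by rewrite /spec /= /mmap; apply: eq_bigr => m _; rewrite umono_exp. Qed.

Lemma specEb b n F : (msize F <= b)%N ->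
  spec n F = \sum_(m : 'X_{1..r < b}) (F@_m).[n%:R] * mmap1 u m ^+ n.
Proof. by move=> h; rewrite /spec /= (mmapE b) //; apply: eq_bigr => m _; rewrite umono_exp. Qed.

Lemma specX n m : spec n 'X_[m] = mmap1 u m ^+ n.
Proof. by rewrite /spec /= mmapX umono_exp. Qed.

Lemma specC n c : spec n c%:MP = c.[n%:R].
Proof. by rewrite /spec /= mmapC. Qed.

Hypothesis indep_u : forall m m' c, mmap1 u m = iota c * mmap1 u m' -> m = m'.

(** All elements of K occurring in F: every coefficient F_m(n) lies in their k-span, whatever n. *)
Definition coef_list (F : {mpoly {poly K}[r]}) : seq K := flatten [seq (@polyseq K F@_m) | m <- msupp F].

Lemma mem_coef_list (F : {mpoly {poly K}[r]}) m x : m \in msupp F -> x \in (@polyseq K F@_m) -> x \in coef_list F.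
Proof. by move=> mF xm; apply/flattenP; exists (@polyseq K F@_m) => //; apply: map_f. Qed.

Lemma umono_non_proportional q (I : 'I_q -> 'X_{1..r}) : injective I ->
  non_proportional iota (fun i => mmap1 u (I i)).
Proof. by move=> inj i i' ii c /indep_u /inj E; rewrite E eqxx in ii. Qed.

Lemma box_indep b l : exists n0, forall n, (n0 <= n)%N -> forall c : 'X_{1..r < b} -> K,
  (forall m, in_span iota l (c m)) -> \sum_m c m * mmap1 u m ^+ n = 0 -> forall m, c m = 0.
Proof.
pose I (i : 'I_#|{: 'X_{1..r < b}}|) : 'X_{1..r} := (enum_val i : 'X_{1..r < b}).
have inj : injective I by move=> i i' /val_inj /enum_val_inj.
have [n0 hn0] := large_exponent_indep hff l (fun i => umono_neq0 (I i)) (umono_non_proportional inj).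
exists n0 => n hn c hc E m; have := hn0 n hn (fun i => c (enum_val i)) (fun i => hc _).
rewrite -[X in _ = X]E (reindex (fun i : 'I_#|{: 'X_{1..r < b}}| => enum_val i)) /=; last first.
  by apply: onW_bij; apply: enum_val_bij.
by move=> /(_ erefl (enum_rank m)); rewrite enum_rankK.
Qed.

Lemma spec_term_span F n m : in_span iota (coef_list F) (F@_m).[n%:R].
Proof.
have [mF|mF] := boolP (m \in msupp F).
  by apply: span_horner => x; apply: mem_coef_list.
by rewrite memN_msupp_eq0 // horner0; apply: span0.
Qed.

Arguments spec_term_span : clear implicits.

Lemma spec_large F : F != 0 -> exists n0, forall n, (n0 <= n)%N -> spec n F != 0.
Proof.
move=> F0; have [n1 hn1] := box_indep (msize F) (coef_list F).
have m0F : mlead F \in msupp F by apply: mlead_supp.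
have [|n2 hn2] := @horner_large _ F@_(mlead F) hK; first by rewrite -mcoeff_msupp.
exists (maxn n1 n2) => n; rewrite geq_max => /andP [h1 h2].
apply/eqP; rewrite (specEb _ (leqnn _)) => E.
have lt : (mdeg (mlead F) < msize F)%N by apply: msize_mdeg_lt.
have := hn1 n h1 (fun m => (F@_m).[n%:R]) (fun m => spec_term_span _ _ _) E (BMultinom lt).
by apply/eqP; apply: hn2.
Qed.

(** Two monomials suffice for a linear number of zeros outside S, because u^m and u^m' are not
    proportional over [k]. *)
Lemma spec_sum_upper F : (1 < size (msupp F))%N -> exists w0 (e : rat), 0 < e /\
  forall S, w0 \in S -> admissible D vv (codom u) (coef_list F) S ->
    exists C n0, forall (n : nat), (n0 <= n)%N -> \sum_(w <- S) vv w (spec n F) <= C - n%:R * e.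
Proof.
move=> sF; pose q := size (msupp F).
pose I (i : 'I_q) := tnth (in_tuple (msupp F)) i.
have inj : injective I by apply/tuple_uniqP; exact: msupp_uniq.
have IF i : I i \in msupp F by apply: mem_tnth.
have [w0 [e [e0 he]]] := @sum_valuations_upper _ _ _ _ _ _ hff q _ (coef_list F)
  (Ordinal (ltnW sF)) (Ordinal sF) (fun i => umono_neq0 (I i)) (umono_non_proportional inj) isT.
exists w0, e; split => // S wS ad.
have [|C [n0 hn0]] := he S wS.
  case: ad => h1 h2 h3 h4 h5 h6; split => // p pS x /codomP [i ->].
  rewrite /mmap1 (place_prod (ff_place hff p)); last by move=> j _; rewrite expf_neq0.
  rewrite big1 // => j _; rewrite (placeX (ff_place hff p)) // h5 ?mulr0 //.
  exact: codom_f.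
have [n1 hn1] : exists n1, forall i n, (n1 <= n)%N -> (F@_(I i)).[n%:R] != 0.
  have [N HN] := fin_all_exists (fun i : 'I_q =>
    @horner_large _ F@_(I i) hK (etrans (esym (mcoeff_msupp _ _)) (IF i))).
  exists (\max_i N i) => i n hn; apply: HN; apply: leq_trans hn; exact: leq_bigmax.
exists C, (maxn n0 n1) => n; rewrite geq_max => /andP [h1 h2].
have := hn0 n (fun i => (F@_(I i)).[n%:R]) h1 (fun i => spec_term_span _ _ _) (fun i => hn1 i n h2).
congr (_ <= _); apply: eq_bigr => w _; congr (vv w _).
by rewrite specE -[msupp F in RHS]/(tval (in_tuple (msupp F))) big_tuple.
Qed.
End Specialization.

(** Each of the omitted terms changes the full sum by at most B. *)
Lemma injection_sum_lower (J : finType) q (F : J -> rat) (B : rat) (phi : 'I_q -> J) :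
  injective phi -> (forall j, `|F j| <= B) ->
  \sum_j F j - (#|J| - q)%:R * B <= \sum_i F (phi i).
Proof.
move=> inj hB; pose A := [set phi i | i in 'I_q].
have cA : #|A| = q by rewrite card_imset // card_ord.
have -> : \sum_i F (phi i) = \sum_(j in A) F j by rewrite big_imset //= => i i' _ _ /inj.
rewrite (bigID (mem A)) /= -addrA gerDl subr_le0.
have -> : (#|J| - q)%:R * B = \sum_(j | j \notin A) B.
  rewrite sumr_const mulr_natl; congr (_ *+ _).
  by rewrite -cA -(cardC (mem A)) addKn.
by apply: ler_sum => j _; apply: le_trans (hB j); apply: ler_norm.
Qed.

Section Span2.
Variables (k K : fieldType) (iota : {rmorphism k -> K}).
Lemma span_mul l l' x y : in_span iota l x -> in_span iota l' y ->
  in_span iota [seq a * b | a <- l, b <- l'] (x * y).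
Proof.
move=> hx hy; apply: (hx (fun x => in_span iota [seq a * b | a <- l, b <- l'] (x * y))).
- by rewrite mul0r; apply: span0.
- by move=> a b; rewrite mulrDl; apply: spanD.
- by move=> c a ha; rewrite -mulrA; apply: spanZ.
move=> a al; apply: (hy (fun y => in_span iota [seq a * b | a <- l, b <- l'] (a * y))).
- by rewrite mulr0; apply: span0.
- by move=> b b'; rewrite mulrDr; apply: spanD.
- by move=> c b hb; rewrite mulrCA; apply: spanZ.
by move=> b bl; apply: span_mem; apply: allpairs_f.
Qed.
End Span2.

Section Growth.
Variables (k K : fieldType) (iota : {rmorphism k -> K}) (g : nat) (bas : nat -> 'I_g -> K).
Hypothesis hg : has_growth iota bas.

Lemma growth_span (ys : seq K) : exists (rho : K) (m : nat), rho != 0 /\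
  forall s y (a : 'I_s) j, in_span iota ys y -> exists c : 'I_(s + m) -> 'I_g -> k,
    rho * y * bas a j = \sum_b \sum_l iota (c b l) * bas b l.
Proof.
have [_ _ /(_ ys) [rho [m [r0 H]]]] := hg; exists rho, m; split => // s y a j hy.
apply: (hy (fun y => exists c : 'I_(s + m) -> 'I_g -> k,
    rho * y * bas a j = \sum_b \sum_l iota (c b l) * bas b l)).
- exists (fun _ _ => 0); rewrite mulr0 mul0r big1 // => b _; rewrite big1 // => l _.
  by rewrite rmorph0 mul0r.
- move=> x x' [c E] [c' E']; exists (fun b l => c b l + c' b l).
  rewrite mulrDr mulrDl E E' -big_split; apply: eq_bigr => b _.
  by rewrite -big_split; apply: eq_bigr => l _; rewrite rmorphD mulrDl.
- move=> e x [c E]; exists (fun b l => e * c b l).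
  rewrite [rho * _]mulrCA -mulrA E mulr_sumr; apply: eq_bigr => b _.
  by rewrite mulr_sumr; apply: eq_bigr => l _; rewrite rmorphM mulrA.
move=> x /H /(_ a j) [c ->].
pose c' (b : nat) l := if insub b : option 'I_(a + m) is Some b' then c b' l else 0.
exists (fun b l => c' b l).
have le : (a + m <= s + m)%N by rewrite leq_add2r ltnW.
transitivity (\sum_(b < a + m) \sum_l iota (c' b l) * bas b l).
  by apply: eq_bigr => b _; apply: eq_bigr => l _; rewrite /c' valK.
rewrite (big_ord_widen _ (fun b => \sum_l iota (c' b l) * bas b l) le) big_mkcond.
apply: eq_bigr => b _; case: ifP => // /negbT nb.
by rewrite big1 // => l _; rewrite /c' insubF ?rmorph0 ?mul0r //; apply/negbTE.
Qed.
End Growth.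

(** * Common zeros of P(n, u^n) and Q(n, u^n) *)

Section Gcd.
Variables (k K : fieldType) (iota : {rmorphism k -> K}) (D : K -> K)
  (Pl : eqType) (vv : Pl -> K -> rat).
Hypothesis hff : is_ff iota D vv.
Hypothesis hK : [pchar K] =i pred0.
Variables (g : nat) (bas : nat -> 'I_g -> K).
Hypothesis hg : has_growth iota bas.
Variables (r : nat) (u : 'I_r -> K).
Hypothesis u0 : forall i, u i != 0.
Hypothesis indep_u : forall m m' c, mmap1 u m = iota c * mmap1 u m' -> m = m'.
Let pv p := ff_place hff p.
Let DD := ffDD hff.
Let DM := ffDM hff.

Definition height (S : seq Pl) : rat := \sum_(w <- S) \sum_i `|vv w (u i)|.

Lemma place_umono p m : vv p (mmap1 u m) = \sum_i (m i)%:R * vv p (u i).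
Proof.
rewrite /mmap1 (place_prod (pv p)); last by move=> i _; rewrite expf_neq0.
by apply: eq_bigr => i _; rewrite (placeX (pv p)).
Qed.

Lemma place_umono_le b p (m : 'X_{1..r < b}) :
  `|vv p (mmap1 u m)| <= b%:R * \sum_i `|vv p (u i)|.
Proof.
rewrite place_umono mulr_sumr; apply: le_trans (ler_norm_sum _ _ _) _.
apply: ler_sum => i _; rewrite normrM normr_nat ler_wpM2r // ler_nat.
apply: leq_trans (ltnW (bmdeg m)); by rewrite mdegE (bigD1 i) //= leq_addr.
Qed.

Lemma place_umono_unit p m : (forall x, x \in codom u -> vv p x = 0) -> vv p (mmap1 u m) = 0.
Proof. by move=> h; rewrite place_umono big1 // => i _; rewrite h ?mulr0 // codom_f. Qed.

Lemma spec_vge S l n F p : {subset coef_list F <= l} -> admissible D vv (codom u) l S -> p \notin S ->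
  vge (vv p) 0 (spec u n F).
Proof.
move=> sl ad pS; rewrite specE; apply: (vge_sum (pv p)) => m _.
apply: (vge0M (pv p)).
  apply: (admissible_span hff ad pS); apply: (span_sub sl); exact: spec_term_span.
apply: (unit_vgeX hff); first exact: umono_neq0.
exact: place_umono_unit (adm_unit ad pS).
Qed.

Lemma height_sub (S0 S : seq Pl) : uniq S0 -> uniq S -> {subset S0 <= S} ->
  (forall p, p \notin S0 -> forall i, vv p (u i) = 0) -> height S = height S0.
Proof.
move=> uS0 uS sub h; rewrite /height [RHS](perm_big [seq w <- S | w \in S0]) /=; last first.
  apply: uniq_perm => //; first exact: filter_uniq.
  by move=> w; rewrite mem_filter; case: (boolP (w \in S0)) => // /sub ->.
rewrite big_filter [LHS](bigID (mem S0)) /= [X in _ + X]big1 ?addr0 // => w wS.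
by rewrite big1 // => i _; rewrite h ?normr0.
Qed.

Section Main.
Variables (P Q : {mpoly {poly K}[r]}) (b q : nat) (f : 'I_q -> {mpoly {poly K}[r]})
  (cf : 'I_q -> 'X_{1..r < b}).
Hypotheses (P0 : P != 0) (Q0 : Q != 0)
  (fPQ : forall i, exists m, f i = 'X_[m] * P \/ f i = 'X_[m] * Q)
  (fb : forall i, (msize (f i) <= b)%N)
  (minor : \det (\matrix_(i, j) (f i)@_(cf j)) != 0).
Let N := nmon r b.
Hypothesis qN : (q <= N)%N.
Let ys := flatten [seq coef_list (f i) | i <- enum 'I_q].

Let in_ys i n m : in_span iota ys ((f i)@_m).[n%:R].
Proof.
apply: (span_sub _ (@spec_term_span _ _ iota _ (f i) n m)) => x xf.
by apply/flattenP; exists (coef_list (f i)) => //; apply: map_f; rewrite mem_enum.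
Qed.

Variables (rho : K) (mu s : nat).
Hypotheses (rho0 : rho != 0) (s0 : (0 < s)%N)
  (growth : forall y (a : 'I_s) j, in_span iota ys y -> exists c : 'I_(s + mu) -> 'I_g -> k,
    rho * y * bas a j = \sum_b \sum_l iota (c b l) * bas b l).

(** X indexes the functions [y], elements of the ideal (P, Q) specialized at n and multiplied by
    basis elements of K. They are k-combinations of the functions [wt] indexed by J, each a basis
    element times a monomial. The cardinals s g q and (s + mu) g N are to be nearly equal. *)
Let X := ('I_s * 'I_g * 'I_q)%type.
Let J := ('I_(s + mu) * 'I_g * 'X_{1..r < b})%type.
Let y (n : nat) (x : X) : K := rho * bas x.1.1 x.1.2 * spec u n (f x.2).
Let wt (n : nat) (l : J) : K := bas l.1.1 l.1.2 * mmap1 u l.2 ^+ n.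
Let M := #|{: X}|.
Let yM (n : nat) (i : 'I_M) : K := y n (enum_val i).

Let cardX : M = (s * g * q)%N. Proof. by rewrite /M !card_prod !card_ord. Qed.
Let cardJ : #|{: J}| = ((s + mu) * g * N)%N. Proof. by rewrite !card_prod !card_ord. Qed.

Let y_comb n (x : X) : exists A : J -> k, y n x = \sum_l iota (A l) * wt n l.
Proof.
have H (m : 'X_{1..r < b}) := growth x.1.1 x.1.2 (@in_ys x.2 n m).
have [c Hc] := fin_all_exists H.
exists (fun l => c l.2 l.1.1 l.1.2).
rewrite /y (specEb u n (fb _)) mulr_sumr.
rewrite (eq_bigr (fun m : 'X_{1..r < b} => \sum_b0 \sum_l iota (c m b0 l) * (bas b0 l * mmap1 u m ^+ n))).
  rewrite pair_big /= [LHS](eq_bigr (fun bl : 'X_{1..r < b} * 'I_(s + mu) =>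
    \sum_l iota (c bl.1 bl.2 l) * (bas bl.2 l * mmap1 u bl.1 ^+ n))) //.
  rewrite pair_big /=.
  rewrite (reindex (fun l : J => ((l.2, l.1.1), l.1.2))) //=.
  by exists (fun z => ((z.1.2, z.2), z.1.1)) => [[[? ?] ?]|[[? ?] ?]].
move=> m _; rewrite mulrA [X in X * _]mulrAC Hc mulr_suml; apply: eq_bigr => b0 _.
by rewrite mulr_suml; apply: eq_bigr => l _; rewrite mulrA.
Qed.

Let y_indep : exists n0, forall n, (n0 <= n)%N -> indep iota (yM n).
Proof.
have [_ binj _] := hg.
pose lb := [seq bas (nat_of_ord x.1) x.2 | x <- enum {: 'I_s * 'I_g}].
have [n1 hn1] := box_indep hff u0 indep_u b [seq a * c | a <- lb, c <- ys].
have [n2 hn2] := horner_large hK minor.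
exists (maxn n1 n2) => n; rewrite geq_max => /andP [h1 h2] c E.
pose kap (x : X) := c (enum_rank x).
pose z i := \sum_a \sum_j iota (kap (a, j, i)) * bas a j.
have Ez : \sum_i z i * spec u n (f i) = 0.
  apply: (mulfI rho0); rewrite mulr0 -[RHS]E.
  rewrite (reindex (fun x : X => enum_rank x)) /=; last by apply: onW_bij; apply: enum_rank_bij.
  rewrite [in RHS](eq_bigr (fun p : ('I_s * 'I_g) * 'I_q =>
    iota (c (enum_rank (p.1, p.2))) * yM n (enum_rank (p.1, p.2)))); last by case.
  rewrite mulr_sumr -(pair_bigA _ (fun (aj : 'I_s * 'I_g) i => iota (c (enum_rank (aj, i))) * yM n (enum_rank (aj, i)))) /=.
  rewrite exchange_big /=; apply: eq_bigr => i _.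
  rewrite /z pair_big /= mulr_suml mulr_sumr; apply: eq_bigr => -[a j] _ /=.
  by rewrite /yM /y enum_rankK /= /kap; ring.
have zs i : in_span iota lb (z i).
  apply: span_sum => a _; apply: span_sum => j _; apply: spanZ; apply: span_mem.
  by apply/mapP; exists (a, j); rewrite ?mem_enum.
have zc j : \sum_i z i * ((f i)@_(cf j)).[n%:R] = 0.
  apply: (hn1 n h1 (fun m => \sum_i z i * ((f i)@_m).[n%:R])).
    by move=> m; apply: span_sum => i _; apply: span_mul => //; apply: in_ys.
  rewrite -[RHS]Ez.
  under [in RHS]eq_bigr => i _ do rewrite (specEb u n (fb _)) mulr_sumr.
  rewrite exchange_big /=; apply: eq_bigr => m _; rewrite mulr_suml.
  by apply: eq_bigr => i _; rewrite mulrA.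
have z0 i : z i = 0.
  pose Mn := map_mx (horner_eval n%:R) (\matrix_(i, j) (f i)@_(cf j)).
  have U : Mn \in unitmx by rewrite unitmxE unitfE det_map_mx /= hn2.
  have Ezm : (\row_i z i) *m Mn = 0.
    by apply/rowP => j; rewrite !mxE -[RHS](zc j); apply: eq_bigr => i' _; rewrite !mxE.
  have := congr1 (mulmx^~ (invmx Mn)) Ezm; rewrite mulmxK // mul0mx.
  by move=> /rowP /(_ i); rewrite !mxE.
move=> i; rewrite -[i]enum_valK; case: (enum_val i) => [[a j] i'].
exact: (binj s (fun a j => kap (a, j, i')) (z0 i')).
Qed.

Variables (S : seq Pl) (l0 : seq K).
Hypothesis ad : admissible D vv (codom u)
  (rho :: [seq bas (nat_of_ord x.1) x.2 | x <- enum {: 'I_s * 'I_g}] ++ coef_list P ++ coef_list Q ++ l0) S.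

(** Every [y] is an integral multiple at p of P(n, u^n) or Q(n, u^n), hence of the one with smaller
    value; dividing all M functions by it divides the Wronskian by its M-th power. *)
Let outside n p : p \notin S -> spec u n P != 0 -> spec u n Q != 0 ->
  vge (vv p) (M%:R * Num.min (vv p (spec u n P)) (vv p (spec u n Q))) (\det (wronskian D (yM n))).
Proof.
move=> pS Pn Qn; set e := Num.min _ _.
pose gp := if vv p (spec u n P) <= vv p (spec u n Q) then spec u n P else spec u n Q.
have gp0 : gp != 0 by rewrite /gp; case: ifP.
have ve : vv p gp = e by rewrite /gp /e; case: leP => //.
have -> : \det (wronskian D (yM n)) = \det (wronskian D (fun i => gp * (yM n i / gp))).
  by congr (\det _); apply/matrixP => i t; rewrite !mxE mulrC divfK.
rewrite (wronskian_scale DD DM) -ve -(placeX (pv p)) // -[X in vge _ X]addr0.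
apply: (vgeM (pv p)); first exact: vge_refl.
have := @vge_det _ _ _ _ (pv p) M (wronskian D (fun i => yM n i / gp)) (fun=> 0).
rewrite big1 //; apply => i t; rewrite mxE; apply: (iter_D_good _ ad pS).
rewrite /yM /y; case: (enum_val i) => [[a j] i'] /=.
have h1 : vge (vv p) 0 rho by apply: (adm_ge0 ad pS); rewrite mem_head.
have h2 : vge (vv p) 0 (bas a j).
  apply: (adm_ge0 ad pS); rewrite inE mem_cat; apply/orP; right; apply/orP; left.
  by apply/mapP; exists (a, j); rewrite ?mem_enum.
rewrite -mulrA; apply: (vge0M (pv p)); first exact: (vge0M (pv p)).
have [m Em] := fPQ i'.
have hu : vge (vv p) 0 (mmap1 u m ^+ n).
  apply: (unit_vgeX hff); first exact: umono_neq0.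
  exact: place_umono_unit (adm_unit ad pS).
have vP : vge (vv p) 0 (spec u n P / gp).
  by rewrite /vge (place_div (pv p)) // ve subr_ge0 ge_min lexx orbT.
have vQ : vge (vv p) 0 (spec u n Q / gp).
  by rewrite /vge (place_div (pv p)) // ve subr_ge0 ge_min lexx !orbT.
by case: Em => ->; rewrite rmorphM /= -[mmap _ _ 'X_[m]]/(spec u n 'X_[m]) specX -mulrA; apply: (vge0M (pv p)).
Qed.

(** A minor in the Cauchy-Binet expansion selects M terms of J. The monomials of all terms cancel
    over S by the product formula, so only the s g (N - q) + mu g N omitted ones cost, each at most
    n b times the height; derivatives and basis elements go into C. *)
Let inside : exists C, 0 <= C /\ forall n, indep iota (yM n) -> spec u n P != 0 -> spec u n Q != 0 ->
  - (n%:R * ((s * g * (N - q) + mu * g * N) * b)%:R * height S) - C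
   <= \sum_(w <- S) vv w (\det (wronskian D (yM n))).
Proof.
have Hw w : exists C, 0 <= C /\ forall (n : nat) (l : J) (t : 'I_M),
    vge (vv w) (n%:R * vv w (mmap1 u l.2) - C) (iter t D (wt n l)).
  have [||C [C0 HC]] := @fin_max_bound (J * 'I_M)%type (fun lt C => forall n : nat,
     vge (vv w) (n%:R * vv w (mmap1 u lt.1.2) - C) (iter lt.2 D (wt n lt.1))).
  - by move=> lt C C' le h n; apply: vge_le (h n); rewrite lerD2l lerN2.
  - move=> [l t] /=.
    have [C [C0 HC]] := iter_D_term_bound hff w [:: bas l.1.1 l.1.2] t (umono_neq0 u0 l.2).
    by exists C => n; apply: HC; apply: span_mem; rewrite inE.
  by exists C; split => // n l t; apply: (HC (l, t)).
have [Cw HC] := boolp.choice Hw.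
exists (\sum_(w <- S) M%:R * Cw w); split.
  by apply: sumr_ge0 => w _; rewrite mulr_ge0 //; case: (HC w).
move=> n yi Pn Qn; have W0 := wronskian_indep DD DM (ff_const hff) yi.
pose H w := \sum_i `|vv w (u i)|.
have bnd w : n%:R * (((s + mu) * g)%:R * \sum_(m : 'X_{1..r < b}) vv w (mmap1 u m))
    - n%:R * ((s * g * (N - q) + mu * g * N) * b)%:R * H w - M%:R * Cw w
   <= vv w (\det (wronskian D (yM n))).
  have [A HA] := fin_all_exists (fun i : 'I_M => @y_comb n (enum_val i)).
  have [C0 hC] := HC w.
  apply: vge_nz => //.
  have -> : wronskian D (yM n) = \matrix_(i, t) \sum_l iota (A i l) * iter t D (wt n l).
    by apply/matrixP => i t; rewrite !mxE /yM HA (iter_lin hff).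
  apply: (vge_det_mul (pv w) (w := fun l : J => n%:R * vv w (mmap1 u l.2) - Cw w)).
  - by move=> i l; apply: (vge_iota (pv w)).
  - by move=> l t; apply: hC.
  move=> phi inj; rewrite sumrB sumr_const card_ord -[Cw w *+ M]mulr_natl lerD2r -mulr_sumr -[X in _ - X]mulrA -mulrBr.
  apply: ler_wpM2l => //.
  have := @injection_sum_lower J M (fun l => vv w (mmap1 u l.2)) (b%:R * H w) phi inj
     (fun l => place_umono_le w l.2).
  congr (_ <= _); congr (_ - _).
    rewrite -(pair_bigA _ (fun (x : 'I_(s + mu) * 'I_g) (m : 'X_{1..r < b}) => vv w (mmap1 u m))) /=.
    by rewrite sumr_const card_prod !card_ord mulr_natl.
  rewrite cardJ cardX natrM -mulrA; congr (_%:R * _).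
  by have := leq_mul (leqnn (s * g)) qN; rewrite !mulnDl mulnBr; lia.
have : \sum_(w <- S) (n%:R * (((s + mu) * g)%:R * \sum_(m : 'X_{1..r < b}) vv w (mmap1 u m))
    - n%:R * ((s * g * (N - q) + mu * g * N) * b)%:R * H w - M%:R * Cw w)
   <= \sum_(w <- S) vv w (\det (wronskian D (yM n))).
  by apply: ler_sum => w _; apply: bnd.
rewrite sumrB; rewrite sumrB -!mulr_sumr exchange_big /=.
rewrite [X in n%:R * (_ * X)]big1 ?mulr0 ?sub0r; last first.
  move=> m _; apply: (product_formula_unit hff); rewrite ?(umono_neq0 u0) ?(adm_uniq ad) //.
  by move=> p pS; apply: place_umono_unit (adm_unit ad pS).
by apply.
Qed.

Lemma gcd_bound_raw : exists (C : rat) n0, forall n T, (n0 <= n)%N -> uniq T -> (forall p, p \in T -> p \notin S) ->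
  M%:R * \sum_(p <- T) Num.min (vv p (spec u n P)) (vv p (spec u n Q)) <=
  n%:R * ((s * g * (N - q) + mu * g * N) * b)%:R * height S + C.
Proof.
have [n1 hn1] := y_indep.
have [n2 hn2] := spec_large hff hK u0 indep_u P0.
have [n3 hn3] := spec_large hff hK u0 indep_u Q0.
have [C [C0 hC]] := inside.
exists C, (maxn n1 (maxn n2 n3)) => n T; rewrite !geq_max => /and3P [h1 h2 h3] uT dT.
have yi := hn1 n h1; have Pn := hn2 n h2; have Qn := hn3 n h3.
have W0 := wronskian_indep DD DM (ff_const hff) yi.
have lo := hC n yi Pn Qn.
have min0 p : p \notin S -> 0 <= Num.min (vv p (spec u n P)) (vv p (spec u n Q)).
  move=> pS; rewrite le_min; apply/andP; split; apply: vge_nz => //.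
    by apply: (spec_vge _ _ ad pS) => x xP; rewrite inE !mem_cat xP !orbT.
  by apply: (spec_vge _ _ ad pS) => x xP; rewrite inE !mem_cat xP !orbT.
have := product_formula_le hff W0 (adm_uniq ad) uT dT.
have hT : M%:R * \sum_(p <- T) Num.min (vv p (spec u n P)) (vv p (spec u n Q)) <=
    \sum_(p <- T) vv p (\det (wronskian D (yM n))).
  rewrite mulr_sumr big_seq [X in _ <= X]big_seq; apply: ler_sum => p pT.
  by apply: vge_nz => //; apply: outside => //; apply: dT.
move=> PF; have := PF (fun p pS => vge_le (mulr_ge0 (ler0n _ _) (min0 p pS)) (outside pS Pn Qn)).
move: lo hT; lra.
Qed.
End Main.
End Gcd.

(** * The multiplicity of a prime factor with several monomials *)

Section Multiplicity.
Variables (k K : fieldType) (iota : {rmorphism k -> K}) (D : K -> K)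
  (Pl : eqType) (vv : Pl -> K -> rat).
Hypothesis hff : is_ff iota D vv.
Hypothesis hK : [pchar K] =i pred0.
Variables (g : nat) (bas : nat -> 'I_g -> K).
Hypothesis hg : has_growth iota bas.
Variables (r : nat) (u : 'I_r -> K).
Hypothesis u0 : forall i, u i != 0.
Hypothesis indep_u : forall m m' c, mmap1 u m = iota c * mmap1 u m' -> m = m'.
Let pv p := ff_place hff p.
Let DD := ffDD hff.
Let DM := ffDM hff.

(** The factor A can be prescribed because the lost part of the ambient space is small compared with
    1 / b. The height is that of [S0], so it is independent of the larger set S, which depends on
    A. *)
Lemma gcd_bound (P Q : {mpoly {poly K}[r]}) (A : nat) (S0 : seq Pl) (l0 : seq K) :
  prime_el P -> ~ divides P Q -> (1 < A)%N -> uniq S0 ->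
  (forall p, p \notin S0 -> forall i, vv p (u i) = 0) ->
  exists S (C : rat) n0, [/\ {subset S0 <= S},
    admissible D vv (codom u) (coef_list P ++ coef_list Q ++ l0) S &
    forall n T, (n0 <= n)%N -> uniq T -> (forall p, p \in T -> p \notin S) ->
    A%:R * \sum_(p <- T) Num.min (vv p (spec u n P)) (vv p (spec u n Q)) <=
    n%:R * 4 * height vv u S0 + C].
Proof.
move=> Pp nPQ A1 uS0 unit0; have [P0 _ _] := Pp.
have Q0 : Q != 0 by apply/eqP => E; apply: nPQ; rewrite E; apply: divides0.
have [b [q [f [cf [[qN b0] AbN fPQ fb minor]]]]] := ideal_minor A Pp nPQ.
have [rho [mu [rho0 gr]]] := growth_span hg (flatten [seq coef_list (f i) | i <- enum 'I_q]).
(* Large enough for the overflow mu of the filtration to be a fraction at most 1 / (A b) of s. *)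
pose s := (A * b * mu.+1)%N.
have s0 : (0 < s)%N by rewrite !muln_gt0 b0 !andbT; apply: ltnW.
have [|S [S0S ad]] := @admissible_exists _ _ _ _ _ _ hff (codom u)
  (rho :: [seq bas (nat_of_ord x.1) x.2 | x <- enum {: 'I_s * 'I_g}] ++ coef_list P ++ coef_list Q ++ l0) S0.
  by move=> x /codomP [i ->].
have [C [n0 H]] := gcd_bound_raw hff hK hg u0 indep_u P0 Q0 fPQ fb minor qN rho0 s0 (gr s) ad.
have [g0 _ _] := hg.
pose N := nmon r b; rewrite -/N in qN AbN H.
have N0 : (0 < N)%N.
  have lt0 : (mdeg (0%MM : 'X_{1..r}) < b)%N by rewrite mdeg0.
  by apply/card_gt0P; exists (BMultinom lt0).
have N2q : (N <= 2 * q)%N.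
  have : (2 * (N - q) <= N)%N.
    apply: leq_trans AbN; rewrite leq_mul2r; apply/orP; right.
    by rewrite -[2%N]muln1; apply: leq_mul.
  lia.
have q0 : (0 < q)%N by lia.
have M0 : (0 < s * g * q)%N by rewrite muln_gt0 q0 andbT muln_gt0 g0 andbT.
(* Both A b s g (N - q) and A b mu g N are at most s g N, and N <= 2 q; hence the factor 4. *)
have key : (A * ((s * g * (N - q) + mu * g * N) * b) <= 4 * (s * g * q))%N.
  apply: (@leq_trans (s * g * N + s * g * N)).
    have -> : (A * ((s * g * (N - q) + mu * g * N) * b) =
      s * g * (A * b * (N - q)) + (A * b * mu) * g * N)%N by ring.
    apply: leq_add; first by rewrite leq_mul2l AbN orbT.
    by rewrite !leq_mul2r; apply/orP; right; apply/orP; right; rewrite /s leq_mul2l leqnSn orbT.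
  have := leq_mul (leqnn (s * g)) N2q; lia.
exists S, (A%:R * `|C|), n0; split => //.
  by apply: admissible_sub ad => // x h; rewrite inE mem_cat h !orbT.
move=> n T hn uT dT; have := H n T hn uT dT; rewrite !card_prod !card_ord.
set Sg := \sum_(p <- T) _.
rewrite (height_sub uS0 (adm_uniq ad) S0S unit0).
set h := height _ _ _; have h0 : 0 <= h by apply: sumr_ge0 => w _; apply: sumr_ge0.
move=> H1; have M0' : 0 < (s * g * q)%:R :> rat by rewrite ltr0n.
rewrite -(ler_pM2l M0') mulrCA.
apply: le_trans (ler_wpM2l (ler0n _ A) H1) _.
have key' : A%:R * ((s * g * (N - q) + mu * g * N) * b)%:R <= 4 * (s * g * q)%:R :> rat.
  by rewrite -!natrM ler_nat.
have M1 : 1 <= (s * g * q)%:R :> rat by rewrite ler1n.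
have nh : 0 <= n%:R * h by rewrite mulr_ge0.
have h1 := ler_wpM2r nh key'.
have h2 : A%:R * C <= (s * g * q)%:R * (A%:R * `|C|).
  apply: le_trans (_ : A%:R * `|C| <= _); first by rewrite ler_wpM2l // ler_norm.
  by rewrite ler_peMl // mulr_ge0.
rewrite !mulrDr; apply: lerD => //.
apply: le_trans (le_trans h1 _); rewrite ?le_eqVlt; last by apply/orP; left; apply/eqP; ring.
by apply/orP; left; apply/eqP; ring.
Qed.

Definition mono_dlog (m : 'X_{1..r}) : K := D (mmap1 u m) / mmap1 u m.
(* the derivation lifting D, with D T = 0 and D X^m = T dlog(u^m) X^m *)
Definition lift_der (P : {mpoly {poly K}[r]}) : {mpoly {poly K}[r]} :=
  \sum_(m <- msupp P) (map_poly D P@_m + (mono_dlog m)%:P * 'X * P@_m) *: 'X_[m].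

Lemma lift_derE P m : (lift_der P)@_m = map_poly D P@_m + (mono_dlog m)%:P * 'X * P@_m.
Proof.
rewrite /lift_der raddf_sum /=.
have [mP|mP] := boolP (m \in msupp P).
  rewrite (bigD1_seq m) //= mcoeffZ mcoeffX eqxx mulr1 big1 ?addr0 // => i ne.
  by rewrite mcoeffZ mcoeffX (negPf ne) mulr0.
rewrite [X in map_poly D X](memN_msupp_eq0 mP) map_poly0 add0r [X in _ * X](memN_msupp_eq0 mP) mulr0.
rewrite big_seq big1 // => i iP; rewrite mcoeffZ mcoeffX; case: eqP => [E|_]; last by rewrite mulr0.
by move: mP; rewrite -E iP.
Qed.

Lemma Dnat n : D n%:R = 0.
Proof. by rewrite -(rmorph_nat iota) (ffDC hff). Qed.

Lemma spec_lift_der n P : spec u n (lift_der P) = D (spec u n P).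
Proof.
rewrite [in RHS]specE /lift_der (rmorph_sum (spec u n)) (D_sum DD) big_seq [RHS]big_seq; apply: eq_bigr => m mP.
rewrite -mul_mpolyC (rmorphM (spec u n)) specX specC DM (D_horner DD DM) Dnat mulr0 addr0.
rewrite !(hornerD, hornerM, hornerC, hornerX) mulrDl; congr (_ + _).
rewrite (DXn DM) /mono_dlog; have := umono_neq0 u0 m; case: n => [|n] h; first by rewrite /=; ring.
by rewrite /= exprS; field.
Qed.

(** Comparing degrees, the cofactor would be some c in K[T] with D P_m = (c - dlog(u^m) T) P_m for
    all m. The left side has no larger degree in T, so dlog(u^m) is the same for all monomials of P,
    and two of them would be proportional over [k]. *)
Lemma lift_der_ndivides P : (1 < size (msupp P))%N -> ~ divides P (lift_der P).
Proof.
move=> sP [Q E].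
have P0 : P != 0 by apply: contraTneq sP => ->; rewrite msupp0.
have Q0 : Q = (Q@_0%MM)%:MP.
  have [->|Q0] := eqVneq Q 0; first by rewrite mcoeff0.
  apply: msize1_polyC.
  have : (msize (lift_der P) <= msize P)%N.
    apply: leq_trans (msize_sum _ _ _) _; rewrite big_seq; apply/bigmax_leqP_seq => m mP _.
    apply: leq_trans (msizeZ_le _ _) _; rewrite msizeX; exact: msize_mdeg_lt.
  rewrite E msizeM //; have := mpolySpred _ P0; lia.
pose c : {poly K} := Q@_0%MM.
have Em m : map_poly D P@_m = (c - (mono_dlog m)%:P * 'X) * P@_m.
  have := lift_derE P m; rewrite E Q0 mul_mpolyC mcoeffZ -/c mulrBl => ->; ring.
have cm m : m \in msupp P -> c`_1 = mono_dlog m.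
  rewrite mcoeff_msupp => Pm.
  have le : (size (c - (mono_dlog m)%:P * 'X)%R <= 1)%N.
    have [->|n0] := eqVneq (c - (mono_dlog m)%:P * 'X) 0; first by rewrite size_poly0.
    have : (size (map_poly D P@_m)%R <= size (P@_m)%R)%N by apply: size_poly.
    by rewrite Em size_mul // -subn1 leq_subLR leq_add2r.
  have : (c - (mono_dlog m)%:P * 'X)`_1 = 0 by apply: nth_default.
  by rewrite coefB coefMX /= coefC /= => /eqP; rewrite subr_eq0 => /eqP.
case Es : (msupp P) sP => [|m1 [|m2 s]] // _.
have := msupp_uniq P; rewrite Es /= inE negb_or => /andP [/andP [n12 _] _].
have Ed : mono_dlog m1 = mono_dlog m2 by rewrite -!cm // Es !inE eqxx ?orbT.
have D0m m : D (mmap1 u m) = mono_dlog m * mmap1 u m by rewrite /mono_dlog divfK // umono_neq0.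
have h1 := umono_neq0 u0 m1; have h2 := umono_neq0 u0 m2.
have [e Ee] : exists e, mmap1 u m1 / mmap1 u m2 = iota e.
  apply: (ff_const hff); rewrite (D_div DM) // !D0m Ed.
  by apply/eqP; rewrite mulf_eq0; apply/orP; left; apply/eqP; ring.
by move: n12; rewrite (indep_u (m := m1) (m' := m2) (c := e)) ?eqxx // -Ee divfK.
Qed.

(** Suppose that d does not divide e. A zero of P(n, u^n) outside S that is not one of Q(n, u^n)
    would be simple with H a unit, and the d-th power would have value e there. So all zeros are
    common ones, and there are too many of them for the gcd bound. *)
Lemma multiplicity_dvd (P H : {mpoly {poly K}[r]}) (d e : nat) : (0 < d)%N -> prime_el P ->
  (1 < size (msupp P))%N -> ~ divides P H ->
  (forall N, exists n, (N <= n)%N /\ exists y, spec u n (P ^+ e * H) = y ^+ d) -> (d %| e)%N.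
Proof.
move=> d0 Pp sP nPH hinf; have [P0 _ Pm] := Pp.
apply/negPn/negP => nde.
have H0 : H != 0 by apply/eqP => E; apply: nPH; rewrite E; apply: divides0.
set Q := lift_der P * H.
have nPQ : ~ divides P Q by case/Pm => // /lift_der_ndivides; apply.
have Q0 : Q != 0 by apply/eqP => E; apply: nPQ; rewrite E; apply: divides0.
have [w0 [eps [eps0 hlow]]] := spec_sum_upper hff hK u0 indep_u sP.
have [|S0 [wS0 ad0]] := @admissible_exists _ _ _ _ _ _ hff (codom u) [::] [:: w0].
  by move=> x /codomP [i ->].
have unit0 p : p \notin S0 -> forall i, vv p (u i) = 0.
  by move=> pS i; apply: (adm_unit ad0 pS); apply: codom_f.
set h := height vv u S0; have h0 : 0 <= h by apply: sumr_ge0 => w _; apply: sumr_ge0.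
(* The gcd bound gives 4 h n / A common zeros and [loc] loses a factor 2, so A eps > 8 h is what the
   contradiction requires; 16 leaves a margin. *)
have [A [A1 hA]] : exists A : nat, (1 < A)%N /\ 16%:R * h < A%:R * eps.
  have [A hA] := natr_mul_large (16%:R * h) eps0.
  by exists (maxn 2 A); split; [rewrite leq_maxl|apply: hA; rewrite leq_maxr].
have [S [C [n0 [S0S ad hg']]]] :=
  gcd_bound (coef_list (lift_der P) ++ coef_list H) Pp nPQ A1 (adm_uniq ad0) unit0.
have wS : w0 \in S by apply: S0S; apply: wS0; rewrite inE.
have adP : admissible D vv (codom u) (coef_list P) S.
  by apply: admissible_sub ad => // x h'; rewrite mem_cat h'.
have [C1 [n1 hn1]] := hlow S wS adP.
have [n2 hn2] := spec_large hff hK u0 indep_u P0.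
have [n3 hn3] := spec_large hff hK u0 indep_u Q0.
have gap : 0 < A%:R * eps - 8%:R * h by lra.
have [n4 hn4] := natr_mul_large (2%:R * C + A%:R * C1) gap.
have [n [hn [y Ey]]] := hinf (maxn n0 (maxn n1 (maxn n2 (maxn n3 n4)))).
move: hn; rewrite !geq_max => /and5P [nn0 nn1 nn2 nn3 nn4].
have Pn := hn2 n nn2; have Qn := hn3 n nn3.
have [Ln Hn] : spec u n (lift_der P) != 0 /\ spec u n H != 0.
  by move: Qn; rewrite (rmorphM (spec u n)) mulf_eq0 negb_or => /andP.
have int p (pS : p \notin S) F : {subset coef_list F <= coef_list P ++ coef_list Q ++ coef_list (lift_der P) ++ coef_list H} ->
    spec u n F != 0 -> exists a : nat, vv p (spec u n F) = a%:R.
  move=> sF Fn; have [a Ea] := adm_int ad pS Fn.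
  have := vge_nz Fn (spec_vge hff u0 n sF ad pS); rewrite Ea ler0z => a0.
  by exists `|a|%N; rewrite -{1}(gez0_abs a0).
(* With a the order of P, D lowers the order by at most 1, so Q has order at least a - 1 >= a / 2
   when a >= 2; the case a = 1 with Q a unit is excluded because d does not divide e. *)
have loc p : p \notin S -> vv p (spec u n P) <=
    2%:R * Num.min (vv p (spec u n P)) (vv p (spec u n Q)).
  move=> pS.
  have [|a Ea] := int p pS P _ Pn; first by move=> x xP; rewrite !mem_cat xP.
  have [|b Eb] := int p pS H _ Hn; first by move=> x xP; rewrite !mem_cat xP !orbT.
  have [|c Ec] := int p pS (lift_der P) _ Ln; first by move=> x xP; rewrite !mem_cat xP !orbT.
  have EQ : vv p (spec u n Q) = (c + b)%:R.
    by rewrite (rmorphM (spec u n)) (placeM (pv p)) // Ec Eb natrD.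
  rewrite Ea EQ.
  have : (a <= 2 * minn a (c + b))%N.
    have c1 : (a <= c.+1)%N.
      have := vge_nz _ (adm_D1 ad pS Pn); rewrite -spec_lift_der Ea Ec => /(_ Ln).
      by rewrite lerBlDr natr1 ler_nat.
    case: (posnP (c + b)) => [cb0|]; last by move: c1; clear; lia.
    case: (posnP a) => [->//|a0]; have a1 : a = 1%N by move: c1 cb0 a0; clear; lia.
    have yn : y != 0.
      have : y ^+ d != 0 by rewrite -Ey (rmorphM (spec u n)) (rmorphXn (spec u n)) mulf_neq0 ?expf_neq0.
      by rewrite expf_eq0 d0.
    have [l El] := adm_int ad pS yn.
    have : vv p (y ^+ d) = (e * a + b)%:R.
      rewrite -Ey (rmorphM (spec u n)) (rmorphXn (spec u n)) (placeM (pv p)) ?expf_neq0 //.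
      by rewrite (placeX (pv p)) // Ea Eb natrD natrM.
    have -> : b = 0%N by move: cb0; clear; lia.
    rewrite (placeX (pv p)) // El a1 muln1 addn0 => /eqP.
    rewrite -[d%:R]/((d%:Z)%:~R) -[e%:R]/((e%:Z)%:~R) -intrM eqr_int => /eqP E.
    exfalso; move/negP: nde; apply; apply/dvdnP; exists `|l|%N.
    by have := congr1 absz E; rewrite abszM !absz_nat mulnC.
  rewrite -(ler_nat rat) natrM; congr (_ <= _ * _).
  by rewrite minEle ler_nat; case: leqP.
have [s hs] := ff_supp hff Pn.
pose T := [seq p <- undup s | p \notin S].
have uT : uniq T by rewrite filter_uniq // undup_uniq.
have dT p : p \in T -> p \notin S by rewrite mem_filter => /andP [].
have PF : \sum_(p <- S) vv p (spec u n P) + \sum_(p <- T) vv p (spec u n P) = 0.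
  rewrite -big_cat; apply: (ff_prod hff Pn).
    rewrite cat_uniq (adm_uniq ad) uT andbT -all_predC; apply/allP => p /dT.
    by [].
  move=> p; rewrite mem_cat mem_filter mem_undup negb_or negb_and => /andP [-> /= ps].
  exact: hs.
have up : \sum_(p <- T) vv p (spec u n P) <=
    2%:R * \sum_(p <- T) Num.min (vv p (spec u n P)) (vv p (spec u n Q)).
  rewrite mulr_sumr big_seq [X in _ <= X]big_seq; apply: ler_sum => p pT.
  by apply: loc; apply: dT.
have lo := hn1 n nn1.
have mid := hg' n T nn0 uT dT.
have big := hn4 n nn4.
have x1 : n%:R * eps - C1 <= \sum_(p <- T) vv p (spec u n P) by move: PF lo; lra.
have x2 := ler_wpM2l (ler0n _ A) (le_trans x1 up).
move: x2 mid big; rewrite -/h; lra.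
Qed.
End Multiplicity.

(** * Extraction of the d-th power part *)

Lemma seq_nat_bound (T : eqType) (s : seq T) (Q : T -> nat -> Prop) :
  (forall x, exists n0, forall n, (n0 <= n)%N -> Q x n) ->
  exists n0, forall n, (n0 <= n)%N -> forall x, x \in s -> Q x n.
Proof.
move=> h; elim: s => [|x s [n0 IH]]; first by exists 0%N.
have [n1 h1] := h x; exists (maxn n0 n1) => n; rewrite geq_max => /andP [a b] z.
by rewrite inE => /orP [/eqP ->|]; [apply: h1|apply: IH].
Qed.

(** Over a field, a prime that does not divide z is coprime to z in the Bezout sense. *)
Lemma prime_el_coprimep (K : fieldType) (q z : {poly K}) : prime_el q -> ~ divides q z ->
  exists a b : {poly K}, a * q + b * z = 1.
Proof.
move=> [q0 qu qm] nz.
suff /Bezout_eq1_coprimepP [[a b] E] : coprimep q z by exists a, b.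
have /dvdpP [c Ec] := dvdp_gcdl q z; have /dvdpP [c' Ec'] := dvdp_gcdr q z.
have : divides q (c * gcdp q z) by rewrite -Ec; apply: divides_refl.
case/qm => [[x Ex]|[x Ex]]; last by case: nz; exists (c' * x); rewrite -mulrA -Ex.
rewrite /coprimep -dvdp1; apply/dvdpP; exists x; apply: (mulfI q0).
by rewrite mulr1 {1}Ec Ex; ring.
Qed.

(** * Factors in K[T] that do not come from k[T] *)

Section ConstantCoefficients.
Variables (k : closedFieldType) (hchar : [pchar k] =i pred0) (K : fieldType)
  (iota : {rmorphism k -> K}) (D : K -> K) (Pl : eqType) (vv : Pl -> K -> rat).
Hypothesis hff : is_ff iota D vv.
Let pv p := ff_place hff p.
Let DD := ffDD hff.
Let DM := ffDM hff.
Let hK : [pchar K] =i pred0.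
Proof. by move=> p; rewrite -hchar; apply: fmorph_pchar. Qed.

(** Divided by a coefficient of least value, p reduces to a nonzero polynomial over [k], which has
    no large integer zeros; so p(n) attains this least value. *)
Lemma place_horner_large w (p : {poly K}) : p != 0 -> exists n0, forall n, (n0 <= n)%N ->
  forall i, p`_i != 0 -> vv w p.[n%:R] <= vv w p`_i.
Proof.
move=> p0.
have lt : ((size p).-1 < size p)%N by rewrite prednK // size_poly_gt0.
have lc : p`_(Ordinal lt) != 0 by rewrite /= -lead_coefE lead_coef_eq0.
case: (@arg_minP _ _ _ (Ordinal lt) (fun i : 'I_(size p) => p`_i != 0) (fun i => vv w p`_i) lc).
move=> i1 c0 imin.
have ge i : vge (vv w) 0 (p`_i / p`_i1).
  have [->|ci] := eqVneq p`_i 0; first by rewrite mul0r vge_0.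
  have li : (i < size p)%N by rewrite ltnNge; apply: contra ci => /(nth_default _) ->.
  by rewrite /vge (place_div (pv w)) // subr_ge0 (imin (Ordinal li)) ?orbT.
have [rho Hrho] := boolp.choice (fun i => vgt_res (pv w) (ge i)).
pose R := \poly_(i < size p) rho i.
have R0 : R != 0.
  apply/eqP => E; have := Hrho i1; rewrite mulfV //.
  have -> : rho i1 = 0 by have := congr1 (fun q : {poly k} => q`_i1) E; rewrite coef_poly ltn_ord coef0.
  by rewrite rmorph0 subr0 /vgt oner_eq0 (place1 (pv w)) ltxx.
have [n0 hn0] := horner_large hchar R0.
exists n0 => n hn i ci.
have pE : p.[n%:R] = p`_i1 * (iota R.[n%:R] - - \sum_(i < size p) (p`_i / p`_i1 - iota (rho i)) * n%:R ^+ i).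
  rewrite opprK horner_poly rmorph_sum /= -big_split /= mulr_sumr horner_coef.
  apply: eq_bigr => l _; rewrite rmorphM rmorphXn /= rmorph_nat; field; exact: c0.
have c1 : iota R.[n%:R] != 0 by rewrite fmorph_eq0 hn0.
have v1 : vv w (iota R.[n%:R]) = 0 by apply: (placeC (pv w)); apply: hn0.
have m1 : vgt (vv w) (- \sum_(i < size p) (p`_i / p`_i1 - iota (rho i)) * n%:R ^+ i).
  rewrite (vgtN (pv w)); elim/big_ind: _ => [||l _]; first by rewrite /vgt eqxx.
    by move=> x y; apply: (vgtD (pv w)).
  rewrite mulrC; apply: (vgtMr (pv w)) => //.
  by rewrite -(rmorph_nat iota) -rmorphXn; apply: (vge_iota (pv w)).
have [h1 h2] := unit_sub_max (pv w) c1 v1 m1.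
have li : (i < size p)%N by rewrite ltnNge; apply: contra ci => /(nth_default _) ->.
by rewrite pE (placeM (pv w)) // h2 addr0 (imin (Ordinal li)).
Qed.

(** A nonconstant coefficient has a pole w0. For n large q(n) has a pole at w0 and, q being monic,
    no zero in S; the product formula yields a zero outside S. *)
Lemma nonconstant_polynomial_zeros (q : {poly K}) : q \is monic ->
  (forall q' : {poly k}, q <> map_poly iota q') ->
  exists w0, forall S, uniq S -> w0 \in S -> exists n0, forall n, (n0 <= n)%N ->
    exists2 p, p \notin S & 0 < vv p q.[n%:R].
Proof.
move=> qm nq; have q0 : q != 0 by apply: monic_neq0.
have [i0 hi0] : exists i0, forall c, q`_i0 <> iota c.
  apply: boolp.contrapT => /boolp.forallNP h.
  have h' i : exists c, q`_i = iota c.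
    by apply: boolp.contrapT => /boolp.forallNP; apply: h.
  have [f Hf] := boolp.choice h'; apply: (nq (\poly_(i < size q) f i)).
  apply/polyP => i; rewrite coef_map coef_poly /=; case: ltnP => hi; first exact: Hf.
  by rewrite rmorph0 nth_default.
have [w0 hw0] := nonconstant_pole hff hi0.
have qi0 : q`_i0 != 0 by apply/eqP => E; apply: (hi0 0); rewrite E rmorph0.
exists w0 => S uS wS.
have [n1 hn1] := seq_nat_bound S (fun w => place_horner_large w q0).
have [n2 hn2] := horner_large hK q0.
exists (maxn n1 n2) => n; rewrite geq_max => /andP [h1 h2].
have qn := hn2 n h2.
apply: boolp.contrapT => np.
have le0 : \sum_(w <- S) vv w q.[n%:R] < 0.
  rewrite (bigD1_seq w0) //= -[ltRHS]addr0; apply: ltr_leD.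
    by apply: le_lt_trans hw0; apply: hn1.
  rewrite big_seq_cond; apply: sumr_le0 => w /andP [wS' _].
  have <- : vv w q`_(size q).-1 = 0 by rewrite -lead_coefE (monicP qm) (place1 (pv w)).
  by apply: hn1; rewrite // -lead_coefE (monicP qm) oner_neq0.
have [s hs] := ff_supp hff qn.
pose T := [seq p <- undup s | p \notin S].
have dT p : p \in T -> p \notin S by rewrite mem_filter => /andP [].
have : \sum_(p <- S) vv p q.[n%:R] + \sum_(p <- T) vv p q.[n%:R] = 0.
  rewrite -big_cat; apply: (ff_prod hff qn).
    rewrite cat_uniq uS filter_uniq ?undup_uniq // andbT -all_predC; apply/allP => p /dT.
    by [].
  move=> p; rewrite mem_cat mem_filter mem_undup negb_or negb_and => /andP [-> /= ps].
  exact: hs.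
have : \sum_(p <- T) vv p q.[n%:R] <= 0.
  rewrite big_seq; apply: sumr_le0 => p /dT pS.
  by rewrite leNgt; apply/negP => h; apply: np; exists p.
by move: le0; lra.
Qed.

(** Differentiating the coefficients of the monic q lowers the degree, so q does not divide the
    result. By the Bezout relation a zero of q(n) outside S is a simple zero where h(n) is a unit,
    so that q^e h g^n has value e there. One such zero suffices. *)
Lemma constant_multiplicity_dvd (q h : {poly K}) (g : K) (d e : nat) : (0 < d)%N -> g != 0 ->
  prime_el q -> q \is monic -> (forall q' : {poly k}, q <> map_poly iota q') -> ~ divides q h ->
  (forall N, exists n, (N <= n)%N /\ exists y, (q ^+ e * h).[n%:R] * g ^+ n = y ^+ d) -> (d %| e)%N.
Proof.
move=> d0 g0 qp qm nq nqh hinf; have [q0 _ qP] := qp.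
have nqD : ~ divides q (map_poly D q).
  have lt : (size (map_poly D q) < size q)%N.
    rewrite -(prednK (n := size q)) ?size_poly_gt0 // ltnS; apply/leq_sizeP => i li.
    rewrite coef_map_id0 ?(D0 DD) //; move: li; rewrite leq_eqVlt => /orP [/eqP <-|li].
      by rewrite -lead_coefE (monicP qm) (D1 DM).
    by rewrite nth_default ?(D0 DD) //; move: li; case: (size q).
  move=> [x E]; have [x0|x0] := eqVneq x 0.
    have cst i : exists c, q`_i = iota c.
      apply: (ff_const hff).
      by have := congr1 (fun z : {poly K} => z`_i) E; rewrite coef_map_id0 ?(D0 DD) // x0 mul0r coef0.
    have [f Hf] := boolp.choice cst.
    apply: (nq (\poly_(i < size q) f i)); apply/polyP => i; rewrite coef_map coef_poly /=.
    by case: ltnP => hi; [exact: Hf|rewrite rmorph0 nth_default].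
  move: lt; rewrite E size_mul // ltnNge => /negP; apply.
  by rewrite -subn1 -addnBAC ?size_poly_gt0 // leq_addl.
have nqz : ~ divides q (map_poly D q * h) by case/qP.
have h0 : h != 0 by apply/eqP => E; apply: nqh; rewrite E; apply: divides0.
have [a [b Eab]] := prime_el_coprimep qp nqz.
have [w0 hw0] := nonconstant_polynomial_zeros qm nq.
have [|S [S0 ad]] := @admissible_exists _ _ _ _ _ _ hff [:: g]
  ((q : seq K) ++ (map_poly D q : seq K) ++ (h : seq K) ++ (a : seq K) ++ (b : seq K)) [:: w0].
  by move=> x; rewrite inE => /eqP ->.
have [|n0 hn0] := hw0 S (adm_uniq ad); first by apply: S0; rewrite inE.
have [n1 hn1] := horner_large hK q0; have [n2 hn2] := horner_large hK h0.
have [n [hn [y Ey]]] := hinf (n0 + n1 + n2)%N.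
have [p pS vp] := hn0 n ltac:(lia).
have qn := hn1 n ltac:(lia); have hn' := hn2 n ltac:(lia).
have ge (f : {poly K}) : {subset (f : seq K) <= (q : seq K) ++ (map_poly D q : seq K) ++ (h : seq K) ++ (a : seq K) ++ (b : seq K)} ->
    vge (vv p) 0 f.[n%:R].
  move=> sf; apply: (admissible_span hff ad pS); apply: span_horner => x /sf; exact.
have Dq : D q.[n%:R] = (map_poly D q).[n%:R].
  by rewrite (D_horner DD DM) -[D n%:R](congr1 D (rmorph_nat iota n)) (ffDC hff) mulr0 addr0.
have gq : vge (vv p) 0 q.[n%:R] by apply: ge => x; rewrite !mem_cat => ->.
have gD : vge (vv p) 0 (map_poly D q).[n%:R] by apply: ge => x; rewrite !mem_cat => ->; rewrite !orbT.
have gh : vge (vv p) 0 h.[n%:R] by apply: ge => x; rewrite !mem_cat => ->; rewrite !orbT.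
have ga : vge (vv p) 0 a.[n%:R] by apply: ge => x; rewrite !mem_cat => ->; rewrite !orbT.
have gb : vge (vv p) 0 b.[n%:R] by apply: ge => x; rewrite !mem_cat => ->; rewrite !orbT.
have nz : ~ vgt (vv p) ((map_poly D q).[n%:R] * h.[n%:R]).
  move=> hz; have : vgt (vv p) 1.
    have := congr1 (fun f : {poly K} => f.[n%:R]) Eab.
    rewrite /= hornerD !hornerM hornerC => <-.
    by apply: (vgtD (pv p)); apply: (vgtMr (pv p)) => //; rewrite /vgt vp orbT.
  by rewrite /vgt oner_eq0 (place1 (pv p)) ltxx.
have vh : vv p h.[n%:R] = 0.
  apply/eqP; rewrite eq_le (vge_nz hn' gh) andbT leNgt; apply/negP => h1.
  by apply: nz; apply: (vgtMr (pv p)) => //; rewrite /vgt h1 orbT.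
have nD : ~ vgt (vv p) (map_poly D q).[n%:R].
  by move=> h1; apply: nz; rewrite mulrC; apply: (vgtMr (pv p)).
have v1 : vv p q.[n%:R] = 1.
  have [l El] := adm_int ad pS qn.
  have : vge (vv p) (vv p q.[n%:R] - 1) (map_poly D q).[n%:R] by rewrite -Dq; apply: (adm_D1 ad pS).
  move: vp; rewrite El ltr0z => l0 hD.
  have [->//|l1] := eqVneq l 1; exfalso; apply: nD; case/orP: hD => [/eqP ->|hD].
    by rewrite /vgt eqxx.
  rewrite /vgt; apply/orP; right; apply: lt_le_trans hD.
  by rewrite subr_gt0 ltr1z; move: l0 l1; clear; lia.
have Ey' : q.[n%:R] ^+ e * h.[n%:R] * g ^+ n = y ^+ d by rewrite -Ey hornerM horner_exp.
have yn : y != 0.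
  have : y ^+ d != 0 by rewrite -Ey' !mulf_neq0 ?expf_neq0.
  by rewrite expf_eq0 d0.
have [l El] := adm_int ad pS yn.
have : vv p (y ^+ d) = e%:R.
  have g1 : vv p g = 0 by apply: (adm_unit ad pS); rewrite mem_head.
  rewrite -Ey' !(placeM (pv p)) ?mulf_neq0 ?expf_neq0 // !(placeX (pv p)) // v1 vh g1.
  by rewrite mulr0 !addr0 mulr1.
rewrite (placeX (pv p)) // El => /eqP.
rewrite -[d%:R]/((d%:Z)%:~R) -[e%:R]/((e%:Z)%:~R) -intrM eqr_int => /eqP E.
apply/dvdnP; exists `|l|%N.
by have := congr1 absz E; rewrite abszM !absz_nat mulnC.
Qed.

Lemma prime_el_unit_mul (A : idomainType) (w p : A) : w \is a GRing.unit -> prime_el p -> prime_el (w * p).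
Proof.
move=> wu [p0 pu pm]; have w0 : w != 0 by apply: contraTneq wu => ->; rewrite unitr0.
split; first by rewrite mulf_neq0.
  by rewrite unitrM wu.
move=> a b [c E]; case: (pm a b) => [|[x ->]|[x ->]]; first by exists (c * w); rewrite E mulrA.
  by left; exists (x / w); rewrite -mulrA mulKr.
by right; exists (x / w); rewrite -mulrA mulKr.
Qed.

Lemma monic_prime_eq (p q : {poly K}) : prime_el p -> prime_el q -> p \is monic -> q \is monic ->
  divides p q -> q = p.
Proof.
move=> pp qp pm qm dpq; have [w wu E] := prime_el_assoc pp qp dpq.
move: wu; rewrite poly_unitE => /andP [/size_poly1P [c c0 Ew] _].
have := monicP qm; rewrite E Ew mul_polyC lead_coefZ (monicP pm) mulr1 => ->.
by rewrite scale1r.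
Qed.

(** Factors from k[T] are moved into R; any other prime occurs with multiplicity divisible by d, and
    its power can be removed from the d-th powers. *)
Lemma constant_power_factor d g : (0 < d)%N -> g != 0 ->
  forall m (ps : seq {poly K}), (size ps <= m)%N ->
  (forall p, p \in ps -> prime_el p /\ p \is monic) ->
  forall (c0 : K) (R : {poly k}), c0 != 0 -> R != 0 ->
  (forall N, exists n, (N <= n)%N /\ exists y,
     (c0 *: map_poly iota R * \prod_(p <- ps) p).[n%:R] * g ^+ n = y ^+ d) ->
  exists c (R' : {poly k}) G, [/\ c != 0, G != 0 &
    c0 *: map_poly iota R * \prod_(p <- ps) p = c *: map_poly iota R' * G ^+ d].
Proof.
move=> d0 g0; elim=> [|m IH] ps sps pps c0 R c00 R0 hinf.
  move: sps; rewrite leqn0 size_eq0 => /eqP ->; exists c0, R, 1.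
  by rewrite big_nil expr1n oner_neq0.
case: ps sps pps hinf => [|p ps] sps pps hinf.
  by exists c0, R, 1; rewrite big_nil expr1n oner_neq0.
have [pp pm] := pps p (mem_head _ _); have [p0 pu _] := pp.
have pps' q : q \in ps -> prime_el q /\ q \is monic by move=> h; apply: pps; rewrite inE h orbT.
case: (boolp.EM (exists p', p = map_poly iota p')) => [[p' Ep]|/boolp.forallNP np].
  have Em : c0 *: map_poly iota R * \prod_(q <- p :: ps) q =
     c0 *: map_poly iota (R * p') * \prod_(q <- ps) q.
    by rewrite big_cons rmorphM /= -Ep -scalerAl mulrA scalerAl.
  rewrite Em; apply: IH => //.
    by rewrite mulf_neq0 //; apply: contraNneq p0 => E; rewrite Ep E rmorph0.
  by move=> N; have [n [hn [y Ey]]] := hinf N; exists n; split => //; exists y; rewrite -Ey Em.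
pose rest := [seq q <- ps | q != p]; pose e := count_mem p (p :: ps).
pose h := c0 *: map_poly iota R * \prod_(q <- rest) q.
have Em : c0 *: map_poly iota R * \prod_(q <- p :: ps) q = p ^+ e * h.
  rewrite /h /e (bigID (pred1 p)) /= mulrCA; congr (_ * (_ * _)).
    rewrite -big_filter (eq_big_seq (fun=> p)); last first.
      by move=> q; rewrite mem_filter => /andP [/eqP ->].
    by rewrite big_const_seq count_predT size_filter iter_mulr_1.
  by rewrite big_cons eqxx /= big_filter.
have nph : ~ divides p h.
  move=> dph; have [_ _ pmul] := pp; case/pmul: dph => [|dpr]; last first.
    have [q qr dpq] := prime_el_prod_in pp dpr; move: qr; rewrite mem_filter => /andP [qp /pps' [qpp qm]].
    by rewrite (monic_prime_eq pp qpp pm qm dpq) eqxx in qp.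
  (* R splits over [k], so a monic prime of K[T] dividing it is T - a with a in [k], contrary to
     [np]. *)
  have [rs Ers] := closed_field_poly_normal R; rewrite Ers map_polyZ /= scalerA rmorph_prod /=.
  rewrite -mul_polyC => /pmul [[x Ex]|].
    case/negP: pu; apply/unitrP; exists ((c0 * iota (lead_coef R))^-1%:P * x).
    have E : (c0 * iota (lead_coef R))^-1%:P * x * p = 1.
      rewrite -mulrA -Ex -polyCM mulVf ?mulf_neq0 ?fmorph_eq0 ?lead_coef_eq0 //.
    by split; [exact: E|rewrite mulrC].
  rewrite -(big_map (fun a => map_poly iota ('X - a%:P)) predT id) => dpr.
  have [q qr [x Ex]] := prime_el_prod_in pp dpr.
  have /mapP [a _ Eq] := qr.
  have sq : q = 'X - (iota a)%:P by rewrite Eq rmorphB /= map_polyX map_polyC.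
  have x0 : x != 0 by apply/eqP => x0; move/eqP: Ex; rewrite x0 mul0r sq polyXsubC_eq0.
  have sp : (1 < size p)%N.
    rewrite ltnNge; apply/negP => le; case/negP: pu; rewrite poly_unitE unitfE.
    have Ep := size1_polyC le; move: (monicP pm); rewrite lead_coefE (_ : (size p).-1 = 0%N).
      by move=> ->; rewrite oner_neq0 andbT eqn_leq le size_poly_gt0.
    by move: le; case: (size p) => [|[]].
  have : size q = 2 by rewrite sq size_XsubC.
  rewrite Ex size_mul // => s2.
  have s1 : (size x <= 1)%N by move: s2 sp; case: (size x) => [|[|i]] //=; case: (size p) => [|[|j]] //=; rewrite !addSn !addnS /=; lia.
  move: Ex; rewrite (size1_polyC s1) mul_polyC => Ex.
  have := congr1 (fun z : {poly K} => lead_coef z) Ex.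
  rewrite sq lead_coefXsubC lead_coefZ (monicP pm) mulr1 => x1.
  by apply: (np ('X - a%:P)); rewrite -Eq Ex -x1 scale1r.
have /dvdnP [f Ef] : (d %| e)%N.
  apply: (@constant_multiplicity_dvd p h g) => // N.
  by have [n [hn [y Ey]]] := hinf N; exists n; split => //; exists y; rewrite -Em.
have [n0 hn0] := horner_large hK p0.
have [|||c [R' [G [c1 G0 E]]]] := IH rest _ _ c0 R c00 R0.
- by rewrite size_filter; apply: leq_trans (count_size _ _) _; exact: sps.
- by move=> q; rewrite mem_filter => /andP [_ /pps'].
- move=> N; have [n [hn [y Ey]]] := hinf (N + n0)%N.
  exists n; split; first by lia.
  exists (y / p.[n%:R] ^+ f); have pn := hn0 n ltac:(lia).
  have E2 : (p ^+ e * h).[n%:R] = p.[n%:R] ^+ e * h.[n%:R] by rewrite hornerM horner_exp.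
  by rewrite -/h expr_div_n -Ey Em E2 -exprM -Ef; field; rewrite expf_neq0.
exists c, R', (p ^+ f * G); split => //; first by rewrite mulf_neq0 ?expf_neq0.
by rewrite Em /h E exprMn -exprM -Ef; ring.
Qed.

Lemma power_constant_coefficients d g (c : {poly K}) : (0 < d)%N -> g != 0 -> c != 0 ->
  (forall N, exists n, (N <= n)%N /\ exists y, c.[n%:R] * g ^+ n = y ^+ d) ->
  exists c0 (R : {poly k}) G, [/\ c0 != 0, G != 0 & c = c0 *: map_poly iota R * G ^+ d].
Proof.
move=> d0 g0 cn0 hinf; have [w [ps [wu pps Ec]]] := factorial_poly (@factorial_field K) cn0.
pose ps' := [seq (lead_coef p)^-1 *: p | p <- ps].
pose a := \prod_(p <- ps) lead_coef p.
have lp p : p \in ps -> lead_coef p != 0 by move=> /pps [p0 _ _]; rewrite lead_coef_eq0.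
move: wu; rewrite poly_unitE => /andP [/size_poly1P [b b0 Ew] _].
have a0 : a != 0 by rewrite prodf_seq_neq0; apply/allP => p /lp.
have Ec' : c = (b * a) *: map_poly iota 1 * \prod_(p <- ps') p.
  rewrite rmorph1 Ec Ew big_map -scalerA -!scalerAl mul1r mul_polyC; congr (_ *: _).
  rewrite /a; elim: ps {ps' a a0 Ec pps} lp => [|p ps IH] lp; first by rewrite !big_nil scale1r.
  rewrite !big_cons IH; last by move=> q h; apply: lp; rewrite inE h orbT.
  by rewrite -scalerAr -scalerAl scalerA mulrAC mulfV ?mul1r ?lp ?mem_head.
rewrite {1}Ec'; apply: (@constant_power_factor d g d0 g0 (size ps')) => //.
- move=> _ /mapP [p pin ->]; split.
    rewrite -mul_polyC; apply: prime_el_unit_mul (pps p pin).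
    by rewrite poly_unitE size_polyC invr_eq0 lp // coefC /= unitfE invr_eq0 lp.
  by rewrite monicE lead_coefZ mulVf // lp.
- by rewrite mulf_neq0.
- exact: oner_neq0.
by move=> N; have [n [hn [y Ey]]] := hinf N; exists n; split => //; exists y; rewrite -Ec'.
Qed.
End ConstantCoefficients.

Lemma mpoly_unitE (R : idomainType) n (p : {mpoly R[n]}) : p \is a GRing.unit ->
  exists2 c, c != 0 & p = c%:MP.
Proof.
move=> pu; have : p \in @mpoly_unit n R by [].
case/andP => /eqP Ep cu; exists p@_0%MM => //.
by apply: contraTneq cu => ->; rewrite unitr0.
Qed.

(** A prime dividing a constant times a monomial divides the constant or a variable, and degrees
    leave it a single term. *)
Lemma monomial_factor (R : idomainType) n (p : {mpoly R[n]}) (m : 'X_{1..n}) (a : R) :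
  prime_el p -> a != 0 -> divides p (a%:MP * 'X_[m]) -> (size (msupp p) <= 1)%N.
Proof.
move=> pp a0; have [p0 _ pm] := pp.
have one_term (q : {mpoly R[n]}) m' (b : R) : b != 0 -> b *: q = 'X_[m'] -> (size (msupp q) <= 1)%N.
  by move=> b0 E; rewrite -(perm_size (msuppZ q b0)) E msuppX.
have size1 : (msize p <= 1)%N -> (size (msupp p) <= 1)%N.
  move/msize1_polyC => ->; rewrite msuppC; by case: eqP.
case/pm => [[x Ex]|].
  apply: size1; have x0 : x != 0.
    by apply: contra_neq a0 => x0; apply/eqP; rewrite -(mpolyC_eq0 n) Ex x0 mul0r.
  have := congr1 (fun q => msize q) Ex; rewrite /= msizeM // msizeC a0 (mpolySpred _ x0); lia.
rewrite mpolyXE_id -(big_map (fun i => 'X_i ^+ m i) predT id) => dp.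
have [q /mapP [i _ ->] dpi] := prime_el_prod_in pp dp.
have {dpi} [x Ex] : divides p 'X_i.
  elim: (m i) dpi => [|l IH]; last by rewrite exprS => /pm [].
  by rewrite expr0 => /(divides_mull 'X_i); rewrite mulr1.
have x0 : x != 0.
  apply: contra_eq_neq Ex => ->; rewrite mul0r -msize_poly_eq0 msizeX //.
have := congr1 (fun q => msize q) Ex; rewrite /= msizeM // msizeX mdeg1 => ms.
have [/size1 //|p1] := leqP (msize p) 1.
have x1 : (msize x <= 1)%N by have := mpolySpred _ x0; move: ms p1; clear; lia.
have Ex' := msize1_polyC x1.
apply: (one_term p U_(i)%MM x@_0%MM); last by rewrite -mul_mpolyC -Ex'.
by apply: contra_neq x0 => c0; rewrite Ex' c0.
Qed.

Lemma associates_prod (A : idomainType) (p : A) (ps : seq A) (a : pred A) :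
  prime_el p -> (forall q, q \in ps -> prime_el q) -> (forall q, a q -> divides p q) ->
  exists2 w, w \is a GRing.unit & \prod_(q <- ps | a q) q = w * p ^+ count a ps.
Proof.
move=> pp; elim: ps => [|q ps IH] pps ha.
  by exists 1; rewrite ?unitr1 // big_nil expr0 mulr1.
have [w wu E] := IH (fun x h => pps x (mem_behead (s := q :: ps) h)) ha.
rewrite big_cons /=; case: (boolP (a q)) => [aq|naq]; last by exists w.
have [w' wu' Eq] := prime_el_assoc pp (pps q (mem_head _ _)) (ha _ aq).
exists (w' * w); first by rewrite unitrM wu'.
by rewrite E Eq exprS; ring.
Qed.

(** * F as c X^I times a d-th power *)

Section PowerPart.
Variables (k K : fieldType) (iota : {rmorphism k -> K}) (D : K -> K)
  (Pl : eqType) (vv : Pl -> K -> rat).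
Hypothesis hff : is_ff iota D vv.
Hypothesis hK : [pchar K] =i pred0.
Variables (g : nat) (bas : nat -> 'I_g -> K).
Hypothesis hg : has_growth iota bas.
Variables (r : nat) (u : 'I_r -> K).
Hypothesis u0 : forall i, u i != 0.
Hypothesis indep_u : forall m m' c, mmap1 u m = iota c * mmap1 u m' -> m = m'.
Variable d : nat.
Hypothesis d0 : (0 < d)%N.

Definition often_power (F : {mpoly {poly K}[r]}) :=
  forall N, exists n, (N <= n)%N /\ exists y, spec u n F = y ^+ d.

(** Primes with one monomial, including those of K[T], are absorbed in c X^I; the others are
    gathered up to units and removed by [multiplicity_dvd]. *)
Lemma power_part_factors m : forall (ps : seq {mpoly {poly K}[r]}), (size ps <= m)%N ->
  (forall p, p \in ps -> prime_el p) -> forall (c : {poly K}) I, c != 0 ->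
  often_power (c%:MP * 'X_[I] * \prod_(p <- ps) p) ->
  exists (c' : {poly K}) I' G, [/\ c' != 0, G != 0 &
    c%:MP * 'X_[I] * \prod_(p <- ps) p = c'%:MP * 'X_[I'] * G ^+ d].
Proof.
elim: m => [|m IH] ps sps pps c I c0 hinf.
  move: sps; rewrite leqn0 size_eq0 => /eqP ->; exists c, I, 1.
  by rewrite big_nil expr1n oner_neq0.
case: ps sps pps hinf => [|p ps] sps pps hinf.
  by exists c, I, 1; rewrite big_nil expr1n oner_neq0.
have pp := pps p (mem_head _ _); have [p0 pu _] := pp.
have pps' q : q \in ps -> prime_el q by move=> h; apply: pps; rewrite inE h orbT.
have [sp|sp] := leqP (size (msupp p)) 1.
  have [m1 Em1] : exists m1, msupp p = [:: m1].
    case E : (msupp p) sp => [|m1 [|]] // _; last by exists m1.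
    by move/eqP: E; rewrite msupp_eq0 (negPf p0).
  have Ep : p = (p@_m1)%:MP * 'X_[m1] by rewrite {1}[p]mpolyE Em1 big_seq1 mul_mpolyC.
  have pm0 : p@_m1 != 0 by rewrite -mcoeff_msupp Em1 mem_head.
  have Em : c%:MP * 'X_[I] * \prod_(q <- p :: ps) q =
      (c * p@_m1)%:MP * 'X_[I + m1] * \prod_(q <- ps) q.
    by rewrite big_cons {1}Ep mpolyXD mpolyCM; ring.
  by rewrite Em; apply: IH => //; [rewrite mulf_neq0|rewrite -Em].
pose a q := boolp.asbool (divides p q).
have ap : a p by apply/boolp.asboolP; apply: divides_refl.
have [w /mpoly_unitE [w0 wn0 Ew] Ea] := @associates_prod _ p (p :: ps) a pp pps (fun q h => boolp.asboolW h).
pose rest := [seq q <- ps | ~~ a q]; pose e := count a (p :: ps).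
pose h := (c * w0)%:MP * 'X_[I] * \prod_(q <- rest) q.
have Em : c%:MP * 'X_[I] * \prod_(q <- p :: ps) q = p ^+ e * h.
  rewrite (bigID a) /= Ea [X in _ * (_ * X)]big_cons ap /= -[X in _ * (_ * X)]big_filter Ew /h mpolyCM -/e.
  by rewrite -/rest; move: (\prod_(_ <- rest) _) (p ^+ e) => z pe; ring.
have cw0 : c * w0 != 0 by rewrite mulf_neq0.
have nph : ~ divides p h.
  have [_ _ pmul] := pp; case/pmul.
    by move/(monomial_factor pp cw0); rewrite leqNgt sp.
  move=> dpr; have [q qr dpq] := prime_el_prod_in pp dpr.
  by move: qr; rewrite mem_filter => /andP [/negP []]; apply/boolp.asboolP.
have /dvdnP [f Ef] : (d %| e)%N.
  apply: (@multiplicity_dvd _ _ _ _ _ _ hff hK _ _ hg _ _ u0 indep_u p h d e) => // N.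
  by have [n [hn [y Ey]]] := hinf N; exists n; split => //; exists y; rewrite -Em.
have [n0 hn0] := spec_large hff hK u0 indep_u p0.
have srest : (size rest <= m)%N by rewrite size_filter; apply: leq_trans (count_size _ _) _.
have prest q : q \in rest -> prime_el q by rewrite mem_filter => /andP [_ /pps'].
have inf' : often_power h.
  move=> N; have [n [hn [y Ey]]] := hinf (N + n0)%N.
  exists n; split; first by lia.
  have pn := hn0 n ltac:(lia); exists (y / spec u n p ^+ f).
  have E2 : spec u n (p ^+ e * h) = spec u n p ^+ e * spec u n h.
    by rewrite (rmorphM (spec u n)) (rmorphXn (spec u n)).
  rewrite expr_div_n -Ey Em E2 -exprM -Ef.
  by rewrite mulrAC mulfV ?mul1r ?expf_neq0.
have [c' [I' [G [c1 G0 E]]]] := IH rest srest prest _ I cw0 inf'.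
exists c', I', (p ^+ f * G); split; [exact: c1|by rewrite mulf_neq0 ?expf_neq0|].
by rewrite Em /h E exprMn -exprM -Ef mulrCA.
Qed.

Lemma power_part F : F != 0 -> often_power F ->
  exists (c : {poly K}) I G, [/\ c != 0, G != 0 & F = c%:MP * 'X_[I] * G ^+ d].
Proof.
move=> F0 hinf.
have [w [ps [/mpoly_unitE [c c0 Ew] pps EF]]] := @factorial_mpoly _ r (factorial_poly (@factorial_field K)) F F0.
have E : F = c%:MP * 'X_[0%MM] * \prod_(p <- ps) p by rewrite mpolyX0 mulr1 -Ew.
by rewrite E; apply: (@power_part_factors (size ps)) => //; rewrite -E.
Qed.
End PowerPart.

(** * A basis of the group Gamma *)

Section FreeBasis.
Variables (k : closedFieldType) (hchar : [pchar k] =i pred0) (K : fieldType) (iota : {rmorphism k -> K}).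

Definition pw r (u : 'I_r -> K) (e : 'I_r -> int) : K := \prod_i u i ^ e i.

Definition generated_by r s (u : 'I_r -> K) (v : 'I_s -> K) :=
  forall i, exists e : 'I_s -> int, u i = pw v e.

Definition constant_free r (u : 'I_r -> K) := (forall i, u i != 0) /\
  forall e, (exists c, pw u e = iota c) -> pw u e = 1.

Lemma pw_exprz r (u : 'I_r -> K) e (a : int) : pw u e ^ a = pw u (fun i => e i * a).
Proof.
rewrite /pw; elim/big_rec2: _ => [|i x y _ <-]; first by rewrite exp1rz.
by rewrite expfzMl exprz_exp.
Qed.

Lemma exprz_sum (x : K) I (r : seq I) (F : I -> int) : x != 0 ->
  x ^ (\sum_(i <- r) F i) = \prod_(i <- r) x ^ F i.
Proof.
move=> x0; elim: r => [|i r IH]; first by rewrite !big_nil expr0z.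
by rewrite !big_cons expfzDr // IH.
Qed.

Lemma pw_comp r s (u : 'I_r -> K) (v : 'I_s -> K) (E : 'I_r -> 'I_s -> int) e :
  (forall j, v j != 0) -> (forall i, u i = pw v (E i)) ->
  pw u e = pw v (fun j => \sum_i E i j * e i).
Proof.
move=> v0 uE; rewrite {1}/pw (eq_bigr (fun i => \prod_j v j ^ (E i j * e i))); last first.
  by move=> i _; rewrite uE pw_exprz.
by rewrite exchange_big; apply: eq_bigr => j _; rewrite exprz_sum.
Qed.

Lemma pw_delta r (u : 'I_r -> K) i : pw u (fun l => (l == i)%:Z) = u i.
Proof. by rewrite /pw (bigD1 i) //= eqxx expr1z big1 ?mulr1 // => l /negPf ->. Qed.

Lemma generated_by_refl r (u : 'I_r -> K) : generated_by u u.
Proof. by move=> i; exists (fun l => (l == i)%:Z); rewrite pw_delta. Qed.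

Lemma generated_by_trans r s t (u : 'I_r -> K) (v : 'I_s -> K) (w : 'I_t -> K) :
  (forall l, w l != 0) -> generated_by u v -> generated_by v w -> generated_by u w.
Proof.
move=> w0 uv vw i; have [e ->] := uv i; have [E HE] := fin_all_exists vw.
by exists (fun j => \sum_i E i j * e i); apply: pw_comp.
Qed.

Lemma constant_free_gen r s (u : 'I_r -> K) (v : 'I_s -> K) :
  constant_free u -> (forall i, v i != 0) -> generated_by v u -> constant_free v.
Proof.
move=> [u0 uc] v0 vu; split => // e; have [E HE] := fin_all_exists vu.
by rewrite (pw_comp e u0 HE); apply: uc.
Qed.

Lemma root_of_unity_constant (x : K) n : (0 < n)%N -> x ^+ n = 1 -> exists c, x = iota c.
Proof.
move=> n0 xn.
have [rs Ers] := closed_field_poly_normal ('X^n - 1 : {poly k}).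
have : (map_poly iota ('X^n - 1)).[x] = 0.
  by rewrite rmorphB rmorphXn rmorph1 /= map_polyX hornerD hornerN hornerXn hornerC xn subrr.
rewrite Ers map_polyZ /= lead_coefDl ?lead_coefXn; last by rewrite size_polyN size_poly1 size_polyXn.
rewrite rmorph1 scale1r rmorph_prod horner_prod => /eqP; elim: rs {Ers} => [|a rs IH].
  by rewrite big_nil oner_eq0.
rewrite big_cons mulf_eq0 => /orP [|/IH //].
by rewrite rmorphB /= map_polyX map_polyC hornerD hornerN hornerX hornerC subr_eq0 => /eqP ->; exists a.
Qed.

Lemma reduce_generators r : forall N (u : 'I_r.+1 -> K) (e : 'I_r.+1 -> int),
  (\sum_i `|e i| <= N)%N -> constant_free u -> (exists i, e i != 0) -> pw u e = 1 ->
  exists v : 'I_r -> K, constant_free v /\ generated_by u v.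
Proof.
elim=> [|N IH] u e sN uc [a ea] ue.
  by move: sN; rewrite (bigD1 a) //= leqn0 addn_eq0 absz_eq0 (negPf ea).
have [u0 cf] := uc.
case: (boolp.EM (exists2 b, b != a & e b != 0)) => [[b ba eb]|single].
  wlog le : a b ea eb ba / (`|e b| <= `|e a|)%N.
    move=> H; case: (leqP `|e b| `|e a|) => [|/ltnW] le; first exact: (H a b).
    by apply: (H b a) => //; rewrite eq_sym.
  (* Replacing u_b by u_b u_a^s changes the exponent of u_a in the relation to e_a - s e_b; the sign
     s makes it smaller. *)
  have [s hs] : exists s : int, (`|(e a - s * e b)%R| < `|e a|)%N.
    case: (boolP ((0 <= e a) == (0 <= e b))) => h; [exists 1|exists (- 1)]; move: h le ea eb; clear; lia.
  pose u' i := if i == b then u b * u a ^ s else u i.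
  pose e' i := if i == a then e a - s * e b else e i.
  have u'0 i : u' i != 0 by rewrite /u'; case: (i =P b) => _; rewrite ?mulf_neq0 ?expfz_neq0 ?u0.
  have gu' : generated_by u' u.
    move=> i; rewrite /u'; case: (i =P b) => [_|_]; last exact: generated_by_refl.
    exists (fun l => (l == b)%:Z + (l == a)%:Z * s).
    rewrite -[in LHS](pw_delta u b) -[in X in _ * X](pw_delta u a) pw_exprz /pw -big_split.
    by apply: eq_bigr => l _; rewrite expfzDr.
  have gu : generated_by u u'.
    move=> i; have [->|ib] := eqVneq i b; last first.
      have -> : u i = u' i by rewrite /u' (negPf ib).
      exact: generated_by_refl.
    exists (fun l => (l == b)%:Z + (l == a)%:Z * - s).
    transitivity (u' b * u' a ^ (- s)).
      by rewrite /u' eqxx [a == b]eq_sym (negPf ba) -mulrA -expfzDr // subrr expr0z mulr1.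
    rewrite -[in LHS](pw_delta u' b) -[in X in _ * X](pw_delta u' a) pw_exprz /pw -big_split.
    by apply: eq_bigr => l _; rewrite expfzDr.
  have [||||v [cv gv]] := IH u' e'.
  - rewrite -ltnS; apply: leq_trans sN; rewrite [ltnRHS](bigD1 a) //= (bigD1 a) //= /e' eqxx -addSn.
    by apply: leq_add => //; apply: eq_leq; apply: eq_bigr => i /negPf ->.
  - exact: constant_free_gen uc _ _.
  - by exists b; rewrite /e' (negPf ba).
  - rewrite -ue /pw (bigD1 b) // [RHS](bigD1 b) //= (bigD1 a) 1?eq_sym // [in RHS](bigD1 a) 1?eq_sym //=.
    rewrite !mulrA; congr (_ * _); last first.
      by apply: eq_bigr => i /andP [ib ia]; rewrite /u' /e' (negPf ib) (negPf ia).
    rewrite /u' /e' !eqxx (negPf ba) [a == b]eq_sym (negPf ba) expfzMl exprz_exp -mulrA -expfzDr //.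
    by rewrite [s * _ + _]addrC subrK.
  by exists v; split => //; apply: (generated_by_trans _ gu gv); case: cv.
have eU i : i != a -> e i = 0.
  by move=> ia; apply/eqP/negPn/negP => ei; apply: single; exists i.
have ua1 : u a = 1.
  have uea : u a ^ e a = 1.
    by rewrite -ue /pw (bigD1 a) //= big1 ?mulr1 // => i ia; rewrite eU.
  have [c Ec] : exists c, u a = iota c.
    apply: (@root_of_unity_constant _ `|e a|%N); first by rewrite absz_gt0.
    case: (e a) uea => n; first by rewrite -exprnP.
    by rewrite NegzE -exprnN => /(congr1 GRing.inv); rewrite invrK invr1.
  by rewrite -(pw_delta u a); apply: cf; exists c; rewrite pw_delta.
pose v l := u (lift a l).
have v0 l : v l != 0 by apply: u0.
exists v; split.
  by apply: constant_free_gen uc v0 _ => l; apply: (generated_by_refl u).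
move=> i; case: (unliftP a i) => [l ->|->]; first exact: (generated_by_refl v).
by exists (fun=> 0); rewrite ua1 /pw big1 // => l _; rewrite expr0z.
Qed.

Lemma free_basis r : forall u : 'I_r -> K, constant_free u ->
  exists s (v : 'I_s -> K), [/\ constant_free v, generated_by u v &
    forall e, (exists c, pw v e = iota c) -> forall i, e i = 0].
Proof.
elim: r => [|r IH] u uc.
  by exists 0%N, u; split => //; [exact: generated_by_refl|move=> e _ []].
case: (boolp.EM (exists2 e, pw u e = 1 & exists i, e i != 0)) => [[e ue ei]|indep].
  have [v [vc gv]] := reduce_generators (leqnn _) uc ei ue.
  have [s [w [wc gw iw]]] := IH v vc.
  by exists s, w; split => //; apply: (generated_by_trans _ gv gw); case: wc.
exists r.+1, u; split => //; first exact: generated_by_refl.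
move=> e ec i; apply/eqP/negPn/negP => ei; apply: indep; exists e; last by exists i.
by case: uc => _; apply.
Qed.

Lemma monomial_indep r (u : 'I_r -> K) : (forall i, u i != 0) ->
  (forall e, (exists c, pw u e = iota c) -> forall i, e i = 0) ->
  forall m m' c, mmap1 u m = iota c * mmap1 u m' -> m = m'.
Proof.
move=> u0 h m m' c E; apply/mnmP => i.
have m'0 : mmap1 u m' != 0 by apply/prodf_neq0 => l _; rewrite expf_neq0.
have := h (fun i => (m i)%:Z - (m' i)%:Z) _ i.
move/(_ _)/eqP; rewrite subr_eq0 eqz_nat => H; apply/eqP/H; exists c.
apply: (mulIf m'0); rewrite -E /mmap1 /pw -big_split; apply: eq_bigr => l _ /=.
by rewrite [u l ^+ m' l]exprnP -expfzDr // subrK exprnP.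
Qed.
End FreeBasis.

(** * Roots in L and conclusion *)

Lemma closed_root (L : closedFieldType) (x : L) d : (0 < d)%N -> exists y, y ^+ d = x.
Proof.
move=> d0; have /closed_rootP [y] : size ('X^d - x%:P) != 1 by rewrite size_XnsubC // eqSS -lt0n.
by rewrite /root !hornerE subr_eq0 => /eqP; exists y.
Qed.

Theorem theorem1p2
  (d : nat) (hd : (2 <= d)%N)
  (k : closedFieldType) (hchar : [pchar k] =i pred0)
  (K : fieldType) (iota : {rmorphism k -> K})
  (hK : function_field_of_curve iota)
  (L : closedFieldType) (j : {rmorphism K -> L}) (hL : algebraic_over j)
  (ell : nat) (B : 'I_ell -> {poly K}) (beta : 'I_ell -> K)
  (hbeta : forall i, beta i != 0)
  (hGamma : forall e : 'I_ell -> int,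
      (exists c : k, \prod_(i < ell) beta i ^ e i = iota c) ->
      \prod_(i < ell) beta i ^ e i = 1)
  (hinf : forall N : nat, exists n : nat, (N <= n)%N /\
      exists y : K, expoly B beta n = y ^+ d) :
  exists (r : nat) (A : 'I_r -> {poly L}) (alpha : 'I_r -> L),
    (forall i, alpha i != 0) /\
    exists R : {poly k},
      forall m : nat,
        j (expoly B beta m) = (map_poly (j \o iota) R).[m%:R] * expoly A alpha m ^+ d.
Proof.
have d0 : (0 < d)%N by apply: ltnW.
have [D [Pl [vv [g [bas [hff hg]]]]]] := ff_exists hchar hK j.
have hchK : [pchar K] =i pred0 by move=> p; rewrite -hchar; apply: fmorph_pchar.
have [r [u [[u0 _] gen ind]]] := free_basis (conj hbeta hGamma : constant_free iota beta).
have indep_u := monomial_indep u0 ind.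
have [E HE] := fin_all_exists gen.
(* M bounds the exponents of the beta_i in the basis u; multiplication by the d-th power of [G0]
   makes them nonnegative, so that b becomes the value of a polynomial up to a d-th power. *)
pose M := \max_i \max_l `|E i l|%N.
have ME i l : (`|E i l| <= M)%N.
  apply: leq_trans (leq_bigmax i); exact: (leq_bigmax l).
pose G0 : K := \prod_i u i ^+ M.
have G00 : G0 != 0 by apply/prodf_neq0 => i _; rewrite expf_neq0.
pose mon i : 'X_{1..r} := [multinom `|(E i l + (d * M)%N%:Z)%R|%N | l < r].
have monE i : mmap1 u (mon i) = beta i * G0 ^+ d.
  rewrite HE /pw /G0 -prodrXl -big_split; apply: eq_bigr => l _ /=.
  rewrite mnmE -exprM [u l ^+ (M * d)]exprnP -expfzDr // mulnC exprnP; congr (_ ^ _).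
  have := leq_mul d0 (ME i l); rewrite mul1n mulnC; move: (E i l) (M * d)%N; clear; lia.
pose F : {mpoly {poly K}[r]} := \sum_i (B i)%:MP * 'X_[mon i].
have specF n : spec u n F = expoly B beta n * (G0 ^+ n) ^+ d.
  rewrite /F (rmorph_sum (spec u n)) /expoly mulr_suml; apply: eq_bigr => i _.
  by rewrite (rmorphM (spec u n)) specC specX monE exprMn -!exprM [(d * n)%N]mulnC mulrA.
have jb n : j (expoly B beta n) = j (spec u n F) / (j G0 ^+ n) ^+ d.
  by rewrite specF rmorphM !rmorphXn /= mulfK // !expf_neq0 // fmorph_eq0.
have [F0|F0] := eqVneq F 0.
  exists 0%N, (fun _ => 0), (fun _ => 0); split; first by case.
  by exists 0 => m; rewrite jb F0 rmorph0 rmorph0 mul0r rmorph0 horner0 mul0r.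
have infF : often_power u d F.
  move=> N; have [n [hn [y Ey]]] := hinf N; exists n; split => //.
  by exists (y * G0 ^+ n); rewrite specF Ey exprMn.
have [c [I [G [c0 G1 EF]]]] := power_part hff hchK hg u0 indep_u d0 F0 infF.
have [n0 hn0] := spec_large hff hchK u0 indep_u G1.
have specF' n : spec u n F = c.[n%:R] * mmap1 u I ^+ n * spec u n G ^+ d.
  by rewrite EF !(rmorphM (spec u n)) (rmorphXn (spec u n)) specC specX.
have uI0 : mmap1 u I != 0 by apply: umono_neq0.
have [|c1 [R [H [c10 H0 Ec]]]] := power_constant_coefficients hchar hff d0 uI0 c0.
  move=> N; have [n [hn [y Ey]]] := infF (maxn N n0).
  move: hn; rewrite geq_max => /andP [hn hn']; exists n; split => //.
  exists (y / spec u n G); rewrite expr_div_n -Ey specF' mulfK //.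
  by rewrite expf_neq0 // hn0.
(* The constant c1 and the monomial u^I become d-th powers only in [L]; this is why a(m) has
   coefficients and bases there. *)
have [gam Eg] := closed_root (j c1) d0.
have [del Ed] := closed_root (j (mmap1 u I)) d0.
have del0 : del != 0.
  apply/eqP => E0; move: Ed; rewrite E0 expr0n eqn0Ngt d0 /= => /esym /eqP.
  by rewrite fmorph_eq0 (negPf uI0).
pose q := size (msupp G).
pose m_ (i : 'I_q) := tnth (in_tuple (msupp G)) i.
exists q, (fun i => gam *: map_poly j (H * G@_(m_ i))), (fun i => del * j (mmap1 u (m_ i)) / j G0).
split.
  by move=> i; rewrite !mulf_neq0 // ?invr_eq0 fmorph_eq0 // umono_neq0.
exists R => n.
have -> : expoly (fun i => gam *: map_poly j (H * G@_(m_ i))) (fun i => del * j (mmap1 u (m_ i)) / j G0) n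
    = gam * j H.[n%:R] * del ^+ n / j G0 ^+ n * j (spec u n G).
  rewrite /expoly specE -[msupp G in RHS]/(tval (in_tuple (msupp G))) big_tuple.
  rewrite rmorph_sum mulr_sumr; apply: eq_bigr => i _.
  rewrite -[n%:R](rmorph_nat j) hornerZ horner_map /= hornerM !rmorphM rmorphXn /= !exprMn exprVn; ring.
rewrite jb specF' Ec !exprMn -!exprM.
rewrite map_poly_comp -[n%:R in RHS](rmorph_nat j) horner_map /=.
rewrite !(hornerM, hornerZ, horner_exp) !rmorphM !rmorphXn /= -Eg -Ed.
rewrite -[del ^+ d ^+ n]exprM [(d * n)%N]mulnC exprVn -[j G0 ^+ n ^+ d]exprM.
by move: (j (mmap _ _ _) ^+ d) => z; ring.
Qed.
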